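(* Suppose $\Omega\subset\mathbb{R}$ is a finite union of disjoint open intervals, exactly one of which is unbounded. Then there are no self-adjoint extensions on $L^2(\Omega)$ of the differential operator $D=\frac{1}{2\pi i}\frac{d}{dx}$ on $C_0^\infty(\Omega)$, and there are no unitary groups with the integrability property on $L^2(\Omega)$.
   Context: $C_0^\infty(\Omega)$ is the space of $C^\infty$ compactly supported functions on $\Omega$. A strongly continuous unitary representation $\{U(t)\}_{t\in\mathbb{R}}$ of $\mathbb{R}$ on $L^2(\Omega)$ has the integrability property if for every $x\in\Omega$, all neighborhoods $V$ of $x$ in $\Omega$ and all $\epsilon>0$ such that $V+t\subset\Omega$ for all $t\in\mathbb{R}$ with $|t|<\epsilon$, one has $(U(t)f)(y)=f(y+t)$ for all $y\in V$, all $t\in\mathbb{R}$ with $|t|<\epsilon$ and all $f\in L^2(\Omega)$.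
   Formalization: The case where Ω is the whole real line (a single unbounded interval) is excluded, because the claim is false there: D is essentially self-adjoint on C_0^∞(R) and translations form a unitary group with the integrability property. *)

(* Defs.v *)
From HB Require Import structures.
From mathcomp Require Import all_boot all_order all_algebra.
From mathcomp Require Import all_classical all_reals all_analysis.
From mathcomp Require Import measurable_realfun complex ring lra.

Set Implicit Arguments.
Unset Strict Implicit.
Unset Printing Implicit Defensive.
Import Order.TTheory GRing.Theory Num.Theory.
Import numFieldNormedType.Exports.
Local Open Scope classical_set_scope.
Local Open Scope ring_scope.
Local Open Scope complex_scope.
Local Open Scope quotient_scope.

Section L2.
Context d (T : measurableType d) (R : realType).
Variables (mu : {measure set T -> \bar R}) (D : set T).
Local Notation C := R[i].
Local Notation Re := (@complex.Re R).
Local Notation Im := (@complex.Im R).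

(* [f \_ D] is [f] extended by zero outside of [D], so this says that the
   restriction of [f] to [D] is measurable and square integrable. *)
Definition realL2 (f : T -> R) : Prop := f \_ D \in Lfun mu 2%:E.

Definition sqint : {pred T -> C} :=
  fun f => `[< realL2 (fun x => Re (f x)) /\ realL2 (fun x => Im (f x)) >].

Let le12 : (1 <= 2%:E :> \bar R)%E. Proof. by rewrite lee_fin ler1n. Qed.

Lemma realL2_comb (a b : R) f g : realL2 f -> realL2 g ->
  realL2 (fun x => a * f x + b * g x).
Proof.
move=> hf hg; have [h0 hl] := @Lfun_submod_closed _ T R mu _ le12.
rewrite /realL2 (_ : _ \_ D = a *: (f \_ D) + (b *: (g \_ D) + 0)).
  by apply: (hl) => //; exact: hl.
apply/funext => x; rewrite addr0 /= !fctE /patch; case: ifP => //= _.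
by rewrite /GRing.scale/= !mulr0 addr0.
Qed.

Lemma realL2_0 : realL2 (fun=> 0).
Proof.
have [h0 _] := @Lfun_submod_closed _ T R mu _ le12.
rewrite /realL2 (_ : _ \_ D = 0)//.
by apply/funext => x; rewrite /patch; case: ifP.
Qed.

Lemma sqint_submod_closed : submod_closed sqint.
Proof.
split; first by apply/asboolP; split; exact: realL2_0.
move=> a f g /asboolP[f1 f2] /asboolP[g1 g2]; apply/asboolP.
have re (b c : R) e : realL2 e ->
    realL2 (fun x => b * Re (f x) + c * Im (f x) + e x).
  move=> he; have := realL2_comb 1 1 (realL2_comb b c f1 f2) he.
  by congr realL2; apply/funext => x /=; rewrite !mul1r.
split.
  have := re (Re a) (- Im a) _ g1; congr realL2; apply/funext => x /=.
  rewrite !fctE; case: (f x) (g x) a => [p q] [r s] [u v] /=.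
  by rewrite mulNr.
have := re (Im a) (Re a) _ g2; congr realL2; apply/funext => x /=.
rewrite !fctE; case: (f x) (g x) a => [p q] [r s] [u v] /=.
by rewrite [v * p + _]addrC.
Qed.

HB.instance Definition _ :=
  GRing.isSubmodClosed.Build C (T -> C) sqint sqint_submod_closed.

Record sqfun := SqFun { sqfun_val :> T -> C ; _ : sqfun_val \in sqint }.
HB.instance Definition _ := [isSub for sqfun_val].
HB.instance Definition _ := [Choice of sqfun by <:].
HB.instance Definition _ := [SubChoice_isSubLmodule of sqfun by <:].

Lemma sqfunDE (f g : sqfun) x : (f + g) x = f x + g x. Proof. by []. Qed.
Lemma sqfunBE (f g : sqfun) x : (f - g) x = f x - g x. Proof. by []. Qed.
Lemma sqfunZE a (f : sqfun) x : (a *: f) x = a * f x. Proof. by []. Qed.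

Definition aenull : {pred sqfun} :=
  fun f => `[< (f : T -> C) = cst 0 %[ae mu in D] >].

Lemma aenull_submod_closed : submod_closed aenull.
Proof.
split; first by apply/asboolP; exact: ae_eq_refl.
move=> a f g /asboolP hf /asboolP hg; apply/asboolP.
apply: filterS2 hf hg => x hf hg Dx.
by rewrite sqfunDE sqfunZE hf// hg// mulr0 addr0.
Qed.

HB.instance Definition _ :=
  GRing.isSubmodClosed.Build C sqfun aenull aenull_submod_closed.

Definition L2 : Type := Quotient.quot aenull.
HB.instance Definition _ := GRing.Zmodule.on L2.
HB.instance Definition _ := Quotient.on L2.

Definition scaleL2 (a : C) (u : L2) : L2 := \pi_L2 (a *: repr u).

Lemma pi_L2_eq (f g : sqfun) :
  (\pi_L2 f = \pi_L2 g) <-> (f : T -> C) = g %[ae mu in D].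
Proof.
split.
  move=> /eqP; rewrite -Quotient.idealrBE => /asboolP.
  by apply: filterS => x + Dx => /(_ Dx); rewrite sqfunBE => /subr0_eq.
move=> fg; apply/eqP; rewrite -Quotient.idealrBE; apply/asboolP.
by apply: filterS fg => x + Dx => /(_ Dx) fg; rewrite sqfunBE fg subrr.
Qed.

Lemma repr_pi_L2 (f : sqfun) :
  (repr (\pi_L2 f) : T -> C) = f %[ae mu in D].
Proof. by apply/pi_L2_eq; rewrite reprK. Qed.

Lemma pi_L2D f g : \pi_L2 (f + g) = \pi_L2 f + \pi_L2 g.
Proof. exact: Quotient.pi_add. Qed.

Lemma pi_L20 : \pi_L2 (0 : sqfun) = 0.
Proof. by apply: (addrI (\pi_L2 (0 : sqfun))); rewrite -pi_L2D !addr0. Qed.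

Lemma pi_scaleL2 a f : \pi_L2 (a *: f) = scaleL2 a (\pi_L2 f).
Proof.
apply/pi_L2_eq; have := repr_pi_L2 f; apply: filterS => x + Dx => /(_ Dx) fE.
by rewrite !sqfunZE fE.
Qed.

Let scaleL2A a b u : scaleL2 a (scaleL2 b u) = scaleL2 (a * b) u.
Proof. by rewrite -[u]reprK -!pi_scaleL2 scalerA !reprK. Qed.
Let scale1L2 : left_id 1 scaleL2.
Proof. by move=> u; rewrite -[u]reprK -!pi_scaleL2 scale1r. Qed.
Let scaleL2Dr : right_distributive scaleL2 +%R.
Proof.
move=> a u v; rewrite -[u]reprK -[v]reprK -!pi_scaleL2.
by rewrite -!pi_L2D -pi_scaleL2 scalerDr.
Qed.
Let scaleL2Dl u : {morph scaleL2^~ u : a b / a + b}.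
Proof.
by move=> a b; rewrite -[u]reprK -!pi_scaleL2 -!pi_L2D scalerDl.
Qed.
HB.instance Definition _ := GRing.Zmodule_isLmodule.Build C L2
  scaleL2A scale1L2 scaleL2Dr scaleL2Dl.

Lemma pi_L2_linear : linear (\pi_L2 : sqfun -> L2).
Proof. by move=> a f g; rewrite pi_L2D pi_scaleL2. Qed.

(* The class in L2 of a function; 0 if the function is not square integrable. *)
Definition toL2 (f : T -> C) : L2 := \pi_L2 (insubd (0 : sqfun) f).

Lemma toL2P (f : T -> C) : f \in sqint ->
  (repr (toL2 f) : T -> C) = f %[ae mu in D].
Proof.
move=> hf; apply: ae_eq_trans (repr_pi_L2 _) _.
by rewrite /= insubdK//; exact: ae_eq_refl.
Qed.

Definition Cintegral (h : T -> C) : C :=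
  (\int[mu]_(x in D) Re (h x))%R +i* (\int[mu]_(x in D) Im (h x))%R.

Definition dotL2 (u v : L2) : C :=
  Cintegral (fun x => repr u x * Num.conj (repr v x)).

Let I1 (h : T -> R) := mu.-integrable setT (EFin \o (h \_ D)).

Let I1M f g : realL2 f -> realL2 g -> I1 (fun x => f x * g x).
Proof.
move=> hf hg; have := Lfun2_mul_Lfun1 hf hg; rewrite Lfun1_integrable.
rewrite /I1; congr (mu.-integrable _ (EFin \o _)); apply/funext => x.
by rewrite /= /patch; case: ifP => // _; rewrite mulr0.
Qed.

Let I1_comb (a b : R) f g : I1 f -> I1 g -> I1 (fun x => a * f x + b * g x).
Proof.
move=> hf hg.
have := integrableD measurableT (integrableZl measurableT a hf)
  (integrableZl measurableT b hg).
rewrite /I1; congr (mu.-integrable _ _); apply/funext => x /=.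
by rewrite /patch; case: ifP => // _; rewrite !mule0 adde0.
Qed.

Let RI_comb (a b : R) f g : I1 f -> I1 g ->
  (\int[mu]_(x in D) (a * f x + b * g x) =
  a * \int[mu]_(x in D) f x + b * \int[mu]_(x in D) g x)%R.
Proof.
move=> hf hg; rewrite !(Rintegral_mkcond mu D).
rewrite -!RintegralZl// -RintegralD//; last 2 first.
- exact: (integrableZl measurableT a hf).
- exact: (integrableZl measurableT b hg).
apply: eq_Rintegral => x _ /=.
by rewrite /patch; case: ifP => // _; rewrite !mulr0 addr0.
Qed.

Let RI_ae f g : I1 f -> I1 g -> f = g %[ae mu in D] ->
  (\int[mu]_(x in D) f x = \int[mu]_(x in D) g x)%R.
Proof.
move=> hf hg fg; rewrite !(Rintegral_mkcond mu D) /Rintegral; congr fine.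
apply: ae_eq_integral => //.
- exact: (measurable_int mu).
- exact: (measurable_int mu).
- apply: filterS fg => x fg _ /=; rewrite /patch.
  by case: ifPn => // xD; rewrite fg//; exact: set_mem.
Qed.

Let cI (h : T -> C) := I1 (fun x => Re (h x)) /\ I1 (fun x => Im (h x)).

Let sqfunP (f : sqfun) :
  realL2 (fun x => Re (f x)) /\ realL2 (fun x => Im (f x)).
Proof. by have /asboolP := valP f. Qed.

Let cI_mul (f g : sqfun) : cI (fun x => f x * Num.conj (g x)).
Proof.
have [f1 f2] := sqfunP f; have [g1 g2] := sqfunP g; split.
  have := I1_comb 1 1 (I1M f1 g1) (I1M f2 g2).
  congr I1; apply/funext => x; case: (f x) (g x) => [a b] [p q] /=; ring.
have := I1_comb 1 (-1) (I1M f2 g1) (I1M f1 g2).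
congr I1; apply/funext => x; case: (f x) (g x) => [a b] [p q] /=; ring.
Qed.

Let I1_comb3 (a b : R) f g h : I1 f -> I1 g -> I1 h ->
  I1 (fun x => a * f x + b * g x + h x) /\
  (\int[mu]_(x in D) (a * f x + b * g x + h x) =
  a * \int[mu]_(x in D) f x + b * \int[mu]_(x in D) g x
  + \int[mu]_(x in D) h x)%R.
Proof.
move=> hf hg hh; have hfg := I1_comb a b hf hg.
have E : (fun x => a * f x + b * g x + h x) =
         (fun x => 1 * (a * f x + b * g x) + 1 * h x).
  by apply/funext => x; rewrite !mul1r.
by rewrite E; split; [exact: I1_comb|rewrite RI_comb// RI_comb// !mul1r].
Qed.

Let CI_lin (a : C) h k : cI h -> cI k ->
  cI (fun x => a * h x + k x) /\
  Cintegral (fun x => a * h x + k x) = a * Cintegral h + Cintegral k.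
Proof.
move=> [h1 h2] [k1 k2].
have [r1 r2] := I1_comb3 (Re a) (- Im a) h1 h2 k1.
have [i1 i2] := I1_comb3 (Im a) (Re a) h1 h2 k2.
have ER : (fun x => Re (a * h x + k x)) =
    (fun x => Re a * Re (h x) + - Im a * Im (h x) + Re (k x)).
  by apply/funext => x; case: (a) (h x) (k x) => [p q] [r s] [u v] /=; ring.
have EI : (fun x => Im (a * h x + k x)) =
    (fun x => Im a * Re (h x) + Re a * Im (h x) + Im (k x)).
  by apply/funext => x; case: (a) (h x) (k x) => [p q] [r s] [u v] /=; ring.
split; first by rewrite /cI ER EI.
rewrite /Cintegral ER EI r2 i2; case: (a) => p q /=.
by apply/eqP; rewrite eq_complex /=; apply/andP; split; apply/eqP; ring.
Qed.

Let CI_ae h k : cI h -> cI k -> h = k %[ae mu in D] ->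
  Cintegral h = Cintegral k.
Proof.
move=> [h1 h2] [k1 k2] hk; rewrite /Cintegral; congr (_ +i* _).
  by apply: RI_ae => //; apply: filterS hk => x + Dx => /(_ Dx) ->.
by apply: RI_ae => //; apply: filterS hk => x + Dx => /(_ Dx) ->.
Qed.

Lemma dotL2_pi (f g : sqfun) :
  dotL2 (\pi_L2 f) (\pi_L2 g) = Cintegral (fun x => f x * Num.conj (g x)).
Proof.
apply: CI_ae; [exact: cI_mul|exact: cI_mul|].
apply: filterS2 (repr_pi_L2 f) (repr_pi_L2 g) => x + + Dx.
by move=> /(_ Dx) -> /(_ Dx) ->.
Qed.

Let dotL2_linl (a : C) u v w :
  dotL2 (a *: u + v) w = a * dotL2 u w + dotL2 v w.
Proof.
rewrite -[u]reprK -[v]reprK -[w]reprK -pi_L2_linear !dotL2_pi.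
have [_ <-] := CI_lin a (cI_mul (repr u) (repr w)) (cI_mul (repr v) (repr w)).
by congr Cintegral; apply/funext => x; rewrite sqfunDE sqfunZE mulrDl mulrA.
Qed.

Let dotL2_herm u v : dotL2 u v = Num.conj (dotL2 v u).
Proof.
have [[r1 i1] [r2 i2]] :=
  (cI_mul (repr u) (repr v), cI_mul (repr v) (repr u)).
rewrite /dotL2 /Cintegral /=; congr (_ +i* _).
  apply: eq_Rintegral => x _.
  by case: (repr u x) (repr v x) => [a b] [p q] /=; ring.
rewrite -[RHS]mulN1r -[RHS]addr0 -[X in _ = _ + X](mul0r
  (\int[mu]_(x in D) Im (repr v x * Num.conj (repr u x)))%R) -RI_comb//.
apply: eq_Rintegral => x _.
by case: (repr u x) (repr v x) => [a b] [p q] /=; ring.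
Qed.

Let dotL2_linr u : linear_for (Num.conj \; *%R) (dotL2 u).
Proof.
move=> a v w /=; rewrite dotL2_herm dotL2_linl rmorphD rmorphM.
by rewrite (dotL2_herm u v) (dotL2_herm u w).
Qed.

HB.instance Definition _ := @bilinear_isBilinear.Build C L2 L2 C
  *%R (Num.conj \; *%R) dotL2 (fun w a u v => dotL2_linl a u v w, dotL2_linr).

Let dotL2_herm_subproof u v :
  dotL2 u v = (-1) ^+ false * Num.conj (dotL2 v u).
Proof. by rewrite expr0 mul1r dotL2_herm. Qed.

HB.instance Definition _ := isHermitianSesquilinear.Build C L2 false
  Num.conj dotL2 dotL2_herm_subproof.

Let dotL2_gt0 u : u != 0 -> 0 < dotL2 u u.
Proof.
have [r1 i1] := cI_mul (repr u) (repr u).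
move=> u0; rewrite ltcE /dotL2 /Cintegral /=; apply/andP; split.
  rewrite (@eq_Rintegral _ _ _ mu D (cst 0)) ?/Rintegral ?integral0// => x _.
  by case: (repr u x) => [a b] /=; ring.
have sqE x : Re (repr u x * Num.conj (repr u x)) =
    Re (repr u x) ^+ 2 + Im (repr u x) ^+ 2.
  by case: (repr u x) => [a b] /=; ring.
rewrite lt_def Rintegral_ge0 ?andbT; last first.
  by move=> x _; rewrite sqE addr_ge0// sqr_ge0.
apply: contra u0 => /eqP I0; rewrite -[u]reprK; apply/eqP.
rewrite -pi_L20; apply/pi_L2_eq.
have : (\int[mu]_x `|((fun x => Re (repr u x * Num.conj (repr u x))) \_ D) x|%:E
  = 0)%E.
  rewrite -[RHS]/(0%:E) -I0 Rintegral_mkcond /Rintegral fineK; last first.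
    exact: integrable_fin_num.
  apply: eq_integral => x _ /=; rewrite ger0_norm// /patch; case: ifP => // _.
  by rewrite sqE addr_ge0// sqr_ge0.
move=> /(ae_eq_integral_abs mu measurableT (measurable_int mu r1)).
apply: filterS => x /(_ I) + Dx; rewrite /= /patch mem_set//= sqE => -[].
by move/eqP; rewrite paddr_eq0 ?sqr_ge0// !sqrf_eq0 => /andP[/eqP + /eqP];
  case: (repr u x) => /= a b -> ->.
Qed.

HB.instance Definition _ := isDotProduct.Build C L2 dotL2 dotL2_gt0.

End L2.

Section operators.
Context (R : realType) (H : lmodType R[i]) (dot : {dot H for Num.conj}).

Definition hnorm (u : H) : R := Num.sqrt (complex.Re (dot u u)).

(* An unbounded operator: only the values of [op] on the subspace [dom] are
   relevant. *)
Record linop := LinOp {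
  dom : set H ;
  op :> H -> H ;
  dom0 : dom 0 ;
  linopP : forall a u v, dom u -> dom v ->
    dom (a *: u + v) /\ op (a *: u + v) = a *: op u + op v }.

Definition densely_defined (A : linop) : Prop :=
  forall (u : H) (e : R), 0 < e -> exists2 v, dom A v & hnorm (u - v) < e.

(* (v, w) belongs to the graph of the adjoint of A *)
Definition adjoint_graph (A : linop) (v w : H) : Prop :=
  forall u, dom A u -> dot (A u) v = dot u w.

Definition self_adjoint (A : linop) : Prop :=
  densely_defined A /\
  forall v w, adjoint_graph A v w <-> dom A v /\ A v = w.

Definition unitary_op (V : H -> H) : Prop :=
  [/\ linear V, isometry dot dot V & forall v, exists u, V u = v].

Definition unitary_group (U : R -> H -> H) : Prop :=
  [/\ forall t, unitary_op (U t), U 0 = id,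
      forall s t, U (s + t) = U s \o U t
    & forall u s, hnorm (U t u - U s u) @[t --> s] --> (0 : R)].

End operators.

Section L2_real_line.
Context (R : realType).
Local Notation C := R[i].
Local Notation mu := (@lebesgue_measure R).

Definition L2R (Omega : set R) : lmodType C := L2 mu Omega.

Definition dotL2R (Omega : set R) : {dot L2R Omega for Num.conj} :=
  @dotL2 _ _ R mu Omega.

Definition smooth (f : R -> R) : Prop :=
  forall n x, derivable (derive1n n f) x 1.

Definition test_function (Omega : set R) (phi : R -> C) : Prop :=
  [/\ smooth (fun x => complex.Re (phi x)),
      smooth (fun x => complex.Im (phi x)),
      compact (closure [set x | phi x != 0])
    & closure [set x | phi x != 0] `<=` Omega].

Definition Dexpr (phi : R -> C) : R -> C := fun x =>
  (2 * pi%:C * 'i)^-1 *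
  (derive1 (fun y => complex.Re (phi y)) x +i*
   derive1 (fun y => complex.Im (phi y)) x).

Lemma realL2_smooth (Omega K : set R) f : smooth f -> compact K ->
  (forall x, ~ K x -> f x = 0) -> K `<=` Omega -> realL2 mu Omega f.
Proof.
move=> sf cK fK KO.
have cf : continuous f.
  move=> x; apply: differentiable_continuous.
  exact/derivable1_diffP/(sf 0%N).
rewrite /realL2 (_ : f \_ Omega = f); last first.
  apply/funext => x; rewrite /patch; case: ifPn => // /negP xO.
  by rewrite fK// => /KO xO'; apply: xO; exact: mem_set.
rewrite inE; apply/andP; split.
  by rewrite inE; exact: continuous_measurable_fun.
rewrite inE /= /finite_norm unlock poweR_lty//.
rewrite (_ : (fun x : R => _) = (fun x => (f x ^+ 2)%:E) \_ K); last first.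
  apply/funext => x; rewrite /= powR_mulrn// real_normK ?num_real// /patch.
  by case: ifPn => // /negP xK; rewrite fK ?expr0n// => /mem_set.
rewrite -integral_mkcond.
have cf2 : {within K, continuous (fun x => f x ^+ 2 : R)}.
  by apply: continuous_subspaceT => x; apply: continuousM; exact: cf.
have /integrableP[_] := continuous_compact_integrable cK cf2.
apply: le_lt_trans; rewrite le_eqVlt; apply/orP; left; apply/eqP.
by apply: eq_integral => x _ /=; rewrite ger0_norm// sqr_ge0.
Qed.

Lemma test_function_sqint (Omega : set R) phi :
  test_function Omega phi -> phi \in sqint mu Omega.
Proof.
move=> [s1 s2 cK KO]; apply/asboolP.
have phi0 x : ~ closure [set x | phi x != 0] x -> phi x = 0.
  move=> h; apply/eqP; apply: contra_notT h => px.
  exact: subset_closure.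
by split; [apply: realL2_smooth s1 cK _ KO|apply: realL2_smooth s2 cK _ KO];
  move=> x /phi0 ->.
Qed.

Lemma smoothZ (c : R) f : smooth f -> smooth (fun x => c * f x).
Proof.
move=> sf.
have E n : derive1n n (fun x => c * f x) = (fun x => c * derive1n n f x).
  elim: n => [//|n IH]; rewrite derive1nS IH derive1nS; apply/funext => x.
  by rewrite derive1E deriveZ ?derive1E//; exact: sf.
by move=> n x; rewrite E; apply: derivableZ; exact: sf.
Qed.

Lemma smooth_derive1 f : smooth f -> smooth (derive1 f).
Proof. by move=> sf n x; have := sf n.+1 x; rewrite /derive1n -iterSr. Qed.

Lemma DexprE phi x : Dexpr phi x =
  ((2 * pi)^-1 * derive1 (fun y => complex.Im (phi y)) x) +i*
  (- (2 * pi)^-1 * derive1 (fun y => complex.Re (phi y)) x).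
Proof.
have p0 : 2 * pi != 0 :> R by rewrite mulf_neq0// gt_eqF// pi_gt0.
have E : 2 * pi%:C * 'i = 0 +i* (2 * pi) :> C.
  by apply/eqP; rewrite eq_complex /=; apply/andP; split; apply/eqP; ring.
have z0 : 0 +i* (2 * pi) != 0 :> C by rewrite eq_complex /= eqxx.
rewrite /Dexpr E; apply: (mulfI z0); rewrite mulVKf//.
move: (2 * pi) p0 {E z0} => p p0.
by apply/eqP; rewrite eq_complex /=; apply/andP; split; apply/eqP; field.
Qed.

Lemma Dexpr_test_function (Omega : set R) phi :
  test_function Omega phi -> test_function Omega (Dexpr phi).
Proof.
move=> [s1 s2 cK KO].
have sub : closure [set x | Dexpr phi x != 0] `<=` closure [set x | phi x != 0].
  rewrite [X in _ `<=` X](closure_id _).1; last exact: closed_closure.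
  apply: closureS => x /=; apply: contra_neqP => nx.
  have d0 (h : C -> R) : h 0 = 0 -> derive1 (fun y => h (phi y)) x = 0.
    move=> h0; rewrite derive1E (@near_eq_derive _ _ _ _ (cst 0)) ?derive_cst//.
    have : \forall y \near x, (~` closure [set x | phi x != 0]) y.
      apply: open_nbhs_nbhs; split => //.
      by apply: closed_openC; exact: closed_closure.
    apply: filterS => y yn; rewrite -[RHS]h0; congr h; apply/eqP.
    by apply: contra_notT yn => py; exact: subset_closure.
  by rewrite DexprE !d0// !mulr0.
split.
- have := smoothZ (c := (2 * pi)^-1) (smooth_derive1 s2).
  by congr smooth; apply/funext => x; rewrite DexprE.
- have := smoothZ (c := - (2 * pi)^-1) (smooth_derive1 s1).
  by congr smooth; apply/funext => x; rewrite DexprE.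
- by apply: subclosed_compact cK sub; exact: closed_closure.
- exact: subset_trans sub KO.
Qed.

(* By [test_function_sqint] and [Dexpr_test_function], [toL2] never takes its
   default value here. *)
Definition extends_D (Omega : set R) (A : linop (L2R Omega)) : Prop :=
  forall phi, test_function Omega phi ->
    dom A (toL2 mu Omega phi) /\
    A (toL2 mu Omega phi) = toL2 mu Omega (Dexpr phi).

(* Elements of L2(Omega) are classes of functions, so the identity holds for
   almost every y in V; this does not depend on the representatives. *)
Definition integrability_property (Omega : set R)
    (U : R -> L2R Omega -> L2R Omega) : Prop :=
  forall (x : R) (V : set R) (e : R),
    Omega x -> nbhs x V -> V `<=` Omega -> 0 < e ->
    (forall t, `|t| < e -> forall y, V y -> Omega (y + t)) ->
  forall t, `|t| < e -> forall f : L2R Omega,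
    {ae mu, forall y, V y -> repr (U t f) y = repr f (y + t)}.

End L2_real_line.

(* Main.v *)
From HB Require Import structures.
From mathcomp Require Import all_boot all_order all_algebra.
From mathcomp Require Import all_classical all_reals all_analysis.
From mathcomp Require Import measurable_realfun complex ring lra.
Require Import Defs.

Set Implicit Arguments.
Unset Strict Implicit.
Unset Printing Implicit Defensive.
Import Order.TTheory GRing.Theory Num.Theory.
Import numFieldNormedType.Exports.
Local Open Scope classical_set_scope.
Local Open Scope ring_scope.

(** An open set [Omega] as in the theorem consists, up to empty intervals, of [m] bounded open
    intervals and one open half-line.  It has [2 m + 1] finite end points, [m + 1] of which lie on
    one side of their interval and only [m] on the other; both assertions come from this count.

    Self-adjoint extensions.  Let [A] be a self-adjoint extension of [D].  Testing the symmetry of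
    [A] against smooth functions of compact support shows that every [u] in the domain of [A] is,
    on each interval, absolutely continuous with derivative [2 pi i (A u)]
    ([weak_derivative_primitive], [trace_of_domain]); so [u] has boundary values, which form its
    trace in [C^(2m+1)].  By Green's formula ([Green_Om], [trace_green]) the number
    [<A u, v> - <u, A v>] is, up to a nonzero factor, the value at the traces of [u] and [v] of the
    Hermitian form which has coefficient [+1] at right end points and [-1] at left ones.  There are
    functions with arbitrary traces ([trace_exists]), and therefore self-adjointness says that the
    traces of the domain of [A] form a subspace that is its own orthogonal for this nondegenerate
    form ([self_adjoint_traces_even]).  Such a subspace has half the dimension of the ambient space
    ([self_orthogonal_even]), and [2 m + 1] is odd.

    Unitary groups.  Say that the half-line extends to the right.  For [v > 0] the operator [U v]
    translates functions to the left by [v] as long as they stay inside one interval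
    ([shift_property]).  Mass can leave only through the [m + 1] left ends; it cannot be lost, since
    [U v] is isometric, and it can come in only through the [m] right ends, since on the rest of
    [Omega] the values of [U v f] are values of [f].  More precisely, mass which leaves between two
    given times comes in between the same times ([support_transport], [transport_block]).  Hence for
    a small time [t] and almost every [x] between [0] and [t] the operator [U t] induces a linear map
    from the values at distance [x] from the left ends, a space [C^(m+1)], to the values at distance
    [t - x] from the right ends, a space [C^m].  This map is obtained by Lebesgue differentiation and
    is isometric because [U t] is ([profile_sum]); but [m + 1] orthonormal vectors do not fit in
    [C^m] ([no_orthonormal_rows]). *)

(** * Smooth functions and a smooth step *)

Section smooth_functions.
Context {R : realType}.
Implicit Types f g h : R -> R.

Lemma is_derive_derive1 f (x l : R) : is_derive x (1 : R) f l -> derive1 f x = l.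
Proof. by move=> fl; rewrite derive1E derive_val. Qed.

(** Smoothness speaks of all iterated derivatives; it is enough to exhibit a class of functions that
    contains the function and is closed under differentiation. *)
Lemma smooth_coind (S : set (R -> R)) :
  (forall f, S f -> exists2 g, S g & forall x, is_derive x (1 : R) f (g x)) ->
  S `<=` @smooth R.
Proof.
move=> SD f Sf n; have : S (derive1n n f).
  elim: n => [//|n /SD[g Sg dg]]; rewrite derive1nS (_ : derive1 _ = g)//.
  by apply/funext => x; exact: is_derive_derive1.
by move=> /SD[g _ dg] x; have [] := dg x.
Qed.

Lemma smooth_is_derive f : smooth f ->
  forall x : R, is_derive x (1 : R) f (derive1 f x).
Proof. by move=> sf x; rewrite derive1E; apply: derivableP; exact: (sf 0%N). Qed.

Lemma smooth_continuous f : smooth f -> continuous f.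
Proof.
move=> sf x; apply: differentiable_continuous.
exact/derivable1_diffP/(sf 0%N).
Qed.

Lemma is_derive_affine (g : R -> R) (k d : R) x l : is_derive (k * x + d) (1 : R) g l ->
  is_derive x (1 : R) (fun y => g (k * y + d)) (k * l).
Proof.
move=> dg; have da : is_derive x (1 : R) (fun y : R => k * y + d) k.
  have := is_deriveD (is_deriveZ k (is_derive_id x 1)) (is_derive_cst d x 1).
  by rewrite addr0 /GRing.scale /= mulr1.
by rewrite mulrC; exact: (is_derive1_comp (f := g) (g := fun y : R => k * y + d) dg da).
Qed.

Lemma smooth_affine f (k d : R) : smooth f -> smooth (fun x => f (k * x + d)).
Proof.
move=> sf; pose S := [set g | exists c h, smooth h /\ g = fun x : R => c * h (k * x + d)].
apply: (@smooth_coind S); last first.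
  by exists 1, f; split => //; apply/funext => x; rewrite mul1r.
move=> _ [c [h [sh ->]]].
exists (fun x => c * k * derive1 h (k * x + d)).
  by exists (c * k), (derive1 h); split; [exact: smooth_derive1|by []].
move=> x; have := is_deriveZ c (is_derive_affine (smooth_is_derive sh (k * x + d))).
by rewrite /GRing.scale /= mulrA.
Qed.

(** The smallest class which contains the products of two smooth functions and, by the Leibniz rule,
    is closed under differentiation. *)
Inductive sum_of_products : (R -> R) -> Prop :=
| SOPmul f g : smooth f -> smooth g -> sum_of_products (fun x => f x * g x)
| SOPadd f g : sum_of_products f -> sum_of_products g ->
    sum_of_products (fun x => f x + g x).

Lemma smooth_sum_of_products : sum_of_products `<=` @smooth R.
Proof.
apply: smooth_coind => h; elim=> {h} [f g sf sg|f g _ [f' ? df] _ [g' ? dg]].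
  exists (fun x => (f x * derive1 g x) + (g x * derive1 f x)).
    exact: SOPadd (SOPmul sf (smooth_derive1 sg)) (SOPmul sg (smooth_derive1 sf)).
  by move=> x; exact: is_deriveM (smooth_is_derive sf x) (smooth_is_derive sg x).
exists (fun x => f' x + g' x); first exact: SOPadd.
by move=> x; exact: is_deriveD (df x) (dg x).
Qed.

Lemma smoothM f g : smooth f -> smooth g -> smooth (fun x => f x * g x).
Proof. by move=> sf sg; apply: smooth_sum_of_products; constructor. Qed.

Lemma smooth_cst (c : R) : smooth (cst c : R -> R).
Proof.
apply: (@smooth_coind [set f | exists c, f = cst c]); last by exists c.
move=> _ [d ->]; exists (cst 0); first by exists 0.
by move=> x; exact: is_derive_cst.
Qed.

Lemma smoothD f g : smooth f -> smooth g -> smooth (fun x => f x + g x).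
Proof.
move=> sf sg; have s1 := @smooth_cst 1.
have := smooth_sum_of_products (SOPadd (SOPmul sf s1) (SOPmul sg s1)).
by congr smooth; apply/funext => x; rewrite /= !mulr1.
Qed.

Lemma smoothB f g : smooth f -> smooth g -> smooth (fun x => f x - g x).
Proof.
move=> sf sg; have := smoothD sf (smoothZ (c := -1) sg).
by congr smooth; apply/funext => x; rewrite mulN1r.
Qed.

(** The class used here consists of the functions [P / h ^+ n] with [P] smooth. *)
Lemma smoothV h : smooth h -> (forall x, h x != 0) -> smooth (fun x => (h x)^-1).
Proof.
move=> sh h0.
pose S := [set f | exists P n, smooth P /\ f = fun x : R => P x * (h x) ^- n].
apply: (@smooth_coind S); last first.
  by exists (cst 1), 1%N; split; [exact: smooth_cst|apply/funext=> x; rewrite mul1r expr1].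
move=> _ [P [n [sP ->]]].
exists (fun x => (derive1 P x * h x - (n%:R * (P x * derive1 h x))) * h x ^- n.+1).
  eexists _, n.+1; split; last by [].
  apply: smoothB; first exact: smoothM (smooth_derive1 sP) sh.
  by apply: smoothZ; exact: smoothM sP (smooth_derive1 sh).
move=> x; have hn : (h ^+ n) x != 0 by rewrite !fctE expf_neq0.
have dV := is_deriveV hn (is_deriveX n (smooth_is_derive sh x)).
have -> : (fun x => P x * h x ^- n) = P * (fun y => ((h ^+ n) y)^-1).
  by apply/funext => y; rewrite !fctE.
apply: is_derive_eq (is_deriveM (smooth_is_derive sP x) dV) _.
rewrite /GRing.scale /= !fctE; case: n {hn dV} => [|n] /=.
  by rewrite !mul0r mulr0 mulr0 add0r subr0 !expr0 invr1 mul1r expr1 mulfK.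
have := h0 x; have := expf_neq0 n (h0 x).
rewrite !exprS; move: (h x ^+ n) (h x) (derive1 _ _) (derive1 _ _) (P x) (n.+1%:R).
by move=> a b c d p q a0 b0; field; rewrite a0 b0.
Qed.
End smooth_functions.

Section flat.
Context {R : realType}.

(** The functions [p (1/x) exp (- 1/x)], extended by zero to [x <= 0], contain all derivatives of
    the case [p = 1], and they are closed under differentiation. *)
Definition flat (p : {poly R}) (x : R) : R :=
  if 0 < x then p.[x^-1] * expR (- x^-1) else 0.

(** The exponential series gives [y ^+ i.+1 / i.+1`! <= expR y]; take [y = 1/x]. *)
Lemma flat_bound p : exists2 C, 0 <= C & forall x, `|flat p x| <= C * `|x|.
Proof.
exists (\sum_(i < size p) `|p`_i| * (i.+1`!)%:R).
  by apply: sumr_ge0 => i _; rewrite mulr_ge0.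
move=> x; rewrite /flat; case: ltP => x0; last first.
  by rewrite normr0 mulr_ge0//; apply: sumr_ge0 => i _; rewrite mulr_ge0.
have y0 : 0 < x^-1 by rewrite invr_gt0.
rewrite (gtr0_norm x0) horner_coef normrM (gtr0_norm (expR_gt0 _)) -ler_pdivlMr ?expR_gt0//.
apply: le_trans (ler_norm_sum _ _ _) _; rewrite -mulrA mulr_suml.
apply: ler_sum => i _; rewrite normrM -mulrA ler_wpM2l// (ger0_norm (exprn_ge0 _ (ltW y0))).
rewrite expRN invrK.
have := expR_ge1Dxn i (ltW y0); set F := (i.+1)`!%:R.
have F0 : 0 < F by rewrite ltr0n fact_gt0.
move=> H1; have : x^-1 ^+ i.+1 / F <= expR x^-1.
  by apply: le_trans H1; rewrite lerDr.
rewrite ler_pdivrMr// exprS => H.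
have -> : x^-1 ^+ i = x * (x^-1 * x^-1 ^+ i) by rewrite mulVKf// gt_eqF.
rewrite [leRHS]mulrCA ler_pM2l//.
by rewrite [leRHS]mulrC.
Qed.

Lemma flat_is_derive p (x : R) :
  is_derive x (1 : R) (flat p) (flat ('X^2 * (p - p^`())) x).
Proof.
have [x0|x0|->] := ltgtP x 0.
- rewrite /flat ltNge (ltW x0)/=.
  apply: near_eq_is_derive (is_derive_cst 0 x 1); near=> y.
  rewrite ltNge [X in ~~ X](_ : _ = true)//; apply: ltW.
  by near: y; exact: lt_nbhsl.
- rewrite {2}/flat x0.
  have xn0 : x != 0 by rewrite gt_eqF.
  have dV := is_deriveV xn0 (is_derive_id x (1 : R)).
  have dp := is_derive1_comp (is_derive_poly p x^-1) dV.
  have de := is_derive1_comp (f := expR) (is_derive_expR _) (is_deriveN dV).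
  apply: (@near_eq_is_derive _ _ _ ((horner p \o (fun y : R => y^-1)) * (expR \o (- (fun y : R => y^-1))))).
    near=> y; have y0 : 0 < y by near: y; exact: lt_nbhsr.
    by rewrite /flat y0.
  apply: is_derive_eq (is_deriveM dp de) _.
  rewrite /GRing.scale /= !hornerE !fctE -exprVn.
  move: (x^-1) p.[_] (p^`()).[_] (expR _) => a b c d /=; ring.
rewrite {2}/flat ltxx.
have [C C0 HC] := flat_bound ('X * p).
have E h : h^-1 * flat p h = flat ('X * p) h.
  by rewrite /flat; case: ltP; rewrite ?mulr0// !hornerE ?mulrA.
(* The difference quotient at 0 of [flat p] is [flat ('X * p)], which is O(h). *)
have lim0 : h^-1 *: ((flat p \o shift 0) (h *: (1 : R)) - flat p 0) @[h --> 0^'] --> (0 : R).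
  apply/cvgrPdist_le => e e0; near=> h.
  have -> : flat p 0 = 0 by rewrite /flat ltxx.
  rewrite /= addr0 subr0 sub0r normrN /GRing.scale /= mulr1 E.
  apply: le_trans (HC _) _.
  apply: (@le_trans _ _ ((C + 1) * `|h|)); first by rewrite ler_wpM2r// lerDl.
  rewrite -ler_pdivlMl ?ltr_pwDr// mulrC; apply: ltW; near: h.
  by apply: dnbhs0_lt; rewrite divr_gt0// ltr_pwDr.
split; first by apply/cvg_ex; exists 0.
exact/cvg_lim.
Unshelve. all: by end_near. Qed.

Lemma smooth_flat p : smooth (flat p).
Proof.
apply: (@smooth_coind _ [set f | exists p, f = flat p]); last by exists p.
move=> _ [q ->]; exists (flat ('X^2 * (q - q^`()))); first by eexists.
exact: flat_is_derive.
Qed.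

Lemma flat1_gt0 (x : R) : 0 < x -> 0 < flat 1 x.
Proof. by rewrite /flat => x0; rewrite x0 hornerC mul1r expR_gt0. Qed.

Lemma flat_ge0 (x : R) : 0 <= flat 1 x.
Proof. by rewrite /flat; case: ifP => //; rewrite hornerC mul1r expR_ge0. Qed.

Lemma flat_le0 p (x : R) : x <= 0 -> flat p x = 0.
Proof. by rewrite /flat ltNge => ->. Qed.

Lemma smooth_step : exists B : R -> R, [/\ smooth B,
  forall x, x <= 0 -> B x = 0, forall x, 1 <= x -> B x = 1 & forall x, 0 <= B x <= 1].
Proof.
pose h x : R := flat 1 x + flat 1 ((-1) * x + 1).
have h0 x : 0 < h x.
  have [x0|x0] := ltP 0 x; first by rewrite ltr_wpDr ?flat_ge0 ?flat1_gt0.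
  by rewrite ltr_wpDl ?flat_ge0 ?flat1_gt0// mulN1r ltr_wpDl// oppr_ge0.
have sh : smooth h.
  apply: smoothD; first exact: smooth_flat.
  by apply: smooth_affine; exact: smooth_flat.
exists (fun x => flat 1 x * (h x)^-1); split=> [|x x0|x x1|x].
- apply: smoothM; first exact: smooth_flat.
  by apply: smoothV => // x; rewrite gt_eqF.
- by rewrite flat_le0 ?mul0r.
- rewrite /h (@flat_le0 _ (-1 * x + 1)) ?addr0 ?divff//; last by lra.
  by rewrite gt_eqF// flat1_gt0// (lt_le_trans ltr01).
- rewrite divr_ge0 ?flat_ge0 ?(ltW (h0 x))//= ler_pdivrMr// mul1r lerDl; exact: flat_ge0.
Qed.
End flat.

(** * Lebesgue measure on the line and integrability on segments *)

Section measure_facts.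
Context {R : realType}.
Local Notation mu := (@lebesgue_measure R).

Lemma measurable_shift (v : R) : measurable_fun setT (fun x : R => x + v).
Proof.
by apply: continuous_measurable_fun => x; apply: cvgD; [exact: cvg_id|exact: cvg_cst].
Qed.

(** The translate of Lebesgue measure is a measure with the same values on bounded half-open
    intervals. *)
Lemma lebesgue_measure_shift (v : R) (A : set R) : measurable A ->
  pushforward mu ((fun x => x + v) : _ -> measurableTypeR R) A = mu A.
Proof.
move=> mA; apply/esym/lebesgue_measure_unique => //=; first exact: measurable_shift.
move=> mf _ [[a b] _ <-]; rewrite /pushforward (_ : _ @^-1` _ = `]a - v, b - v]%classic).
  rewrite !lebesgue_measure_itv/= !lte_fin ltrD2r; case: ifPn => // _.
  by rewrite -!EFinD; congr EFin; ring.
by apply/seteqP; split => x /=; rewrite !in_itv/=; lra.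
Qed.

Lemma ae_shift (P : R -> Prop) v : {ae mu, forall x, P x} ->
  {ae mu, forall x, P (x + v)}.
Proof.
move=> aP; have [A [mA A0 NA]] : mu.-negligible (~` [set x | P x]) := aP.
exists ((fun x : R => x + v) @^-1` A); split.
- by rewrite -[X in measurable X]setTI; exact: measurable_shift.
- by have := lebesgue_measure_shift v mA; rewrite A0.
- by move=> x /NA.
Qed.

Lemma ae_exists_itv (P : R -> Prop) (a b : R) : a < b -> {ae mu, forall x, P x} ->
  exists2 x, a < x < b & P x.
Proof.
move=> ab aP; apply: contrapT => H.
have : mu `]a, b[%classic = 0%E.
  apply: measure_negligible => //; apply: negligibleS aP => x /= xab Px.
  by apply: H; exists x => //; move: xab; rewrite in_itv.
by rewrite lebesgue_measure_itv/= lte_fin ab => /eqP; rewrite -EFinD eqe subr_eq0 gt_eqF.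
Qed.

(** At a Lebesgue point the averages of [`|f y - f x|] over [ball x r] tend to 0 with [r]; here the
    length [2 r] of the ball is multiplied out. *)
Lemma near_lebesgue_pt (f : R -> R) x : lebesgue_pt f x -> forall e, 0 < e ->
  exists2 d, 0 < d & forall r, 0 < r < d ->
    (\int[mu]_(y in ball x r) `|f y - f x|%:E <= (e * r)%:E)%E.
Proof.
move=> fx e e0; have e20 : 0 < e / 2 by rewrite divr_gt0.
have nb : nbhs (0%:E : \bar R) [set y : \bar R | (y < (e / 2)%:E)%E].
  exists (e / 2) => //= y /=; rewrite sub0r normrN => H.
  by rewrite lte_fin; exact: le_lt_trans (ler_norm _) H.
have : \forall r \near (0 : R)^'+, (davg f x r < (e / 2)%:E)%E := fx _ nb.
rewrite near_withinE => -[d /= d0 H]; exists d => // r /andP[r0 rd].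
have := H r; rewrite /ball_/= sub0r normrN (gtr0_norm r0) => /(_ rd r0).
rewrite /davg /iavg (lebesgue_measure_ball _ (ltW r0)) /= => {}H.
have r20 : 0 < r *+ 2 by rewrite mulrn_wgt0.
rewrite (_ : e * r = (e / 2) * (r *+ 2)); last by rewrite -mulr_natr; field.
rewrite EFinM; move: H; rewrite inver gt_eqF// => /ltW H.
by rewrite -lee_pdivrMr// muleC.
Qed.
End measure_facts.

Section lfun2.
Context {R : realType}.
Local Notation mu := (@lebesgue_measure R).
Implicit Types (f g : R -> R).

Definition segment_integrable f := forall a b : R, mu.-integrable `[a, b] (EFin \o f).

Lemma Lfun_measurable f p : f \in Lfun mu p -> measurable_fun setT f.
Proof. by rewrite inE => /andP[+ _]; rewrite inE. Qed.

(** The integral of [`|f| ^ 2] is at most that of the constant [M ^+ 2] over [`[a, b]]. *)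
Lemma bounded_Lfun2 f (a b M : R) : measurable_fun setT f ->
  (forall x, `|f x| <= M) -> (forall x, ~~ (a <= x <= b) -> f x = 0) -> f \in Lfun mu 2%:E.
Proof.
move=> mf fM f0; rewrite inE; apply/andP; split; first by rewrite inE.
rewrite inE /= /finite_norm unlock poweR_lty//.
have M0 : 0 <= M by apply: le_trans (fM 0).
apply: (@le_lt_trans _ _ (\int[mu]_(x in `[a, b]) (M ^+ 2)%:E)%E); last first.
  rewrite integral_cst//= lebesgue_measure_itv/=; case: ifP => // _.
    by rewrite -EFinD -EFinM ltry.
  by rewrite mule0 ltry.
rewrite [leRHS]integral_mkcond; apply: ge0_le_integral => //.
- by move=> x _; rewrite lee_fin powR_ge0.
- apply/measurable_EFinP; apply/(@measurableT_comp _ _ _ _ _ _ (fun x : R => x `^ 2)%R) => //.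
  exact/measurableT_comp.
- by apply/(measurable_restrictT _ _).1 => //; exact: measurable_cst.
- move=> x _; rewrite /= powR_mulrn// /patch; case: ifPn => xab.
    by rewrite lee_fin ler_pXn2r ?nnegrE.
  rewrite f0 ?normr0 ?expr0n//; apply: contra xab => xab.
  by rewrite inE /= in_itv.
Qed.

Lemma Lfun2_segment_integrable f : f \in Lfun mu 2%:E -> segment_integrable f.
Proof.
move=> f2 a b; have i2 : (\1_`[a, b] : R -> R) \in Lfun mu 2%:E.
  apply: (@bounded_Lfun2 _ a b 1).
  - exact: measurable_indic.
  - by move=> x; rewrite indicE; case: (_ \in _); rewrite ?normr1 ?normr0.
  - move=> x xab; rewrite indicE memNset//= in_itv/=; exact/negP.
have /Lfun1_integrable := Lfun2_mul_Lfun1 f2 i2.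
move=> H; rewrite integrable_mkcond//; apply: eq_integrable H => // x _.
by rewrite /= indicE /patch; case: ifP; rewrite /= ?mulr1 ?mulr0.
Qed.

Lemma segment_integrable_locally f : measurable_fun setT f -> segment_integrable f -> locally_integrable setT f.
Proof.
move=> mf fi; split=> //; first exact: openT.
move=> K _ cK; have [M [_ MK]] := compact_bounded cK.
have {}MK : forall x, K x -> `|x| <= M + 1 by apply: MK; rewrite ltrDl.
have /integrableP[_ +] := fi (- (M + 1)) (M + 1); apply: le_lt_trans.
apply: ge0_subset_integral => //; first exact: compact_measurable.
  by apply/measurable_EFinP; apply: measurableT_comp => //; exact: measurable_funTS.
by move=> x /MK /=; rewrite in_itv/= ler_norml.
Qed.
End lfun2.

(** * Primitives and weak derivatives *)

Section primitives.
Context {R : realType}.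
Local Notation mu := (@lebesgue_measure R).
Implicit Types (f g F G : R -> R).

(** Pointwise domination is asked for only where [h] does not vanish: this is how an integral against
    a cut-off is bounded by an integral over the small set where the cut-off varies. *)
Lemma norm_Rintegral_le (D A : set R) (h k : R -> R) : measurable D -> measurable A ->
  mu.-integrable D (EFin \o h) -> measurable_fun A k -> (forall x, 0 <= k x) ->
  (forall x, D x -> (A x /\ `|h x| <= k x) \/ h x = 0) ->
  (`|\int[mu]_(x in D) h x|%:E <= \int[mu]_(x in A) (k x)%:E)%E.
Proof.
move=> mD mA hi mk k0 hk; rewrite EFin_normr_Rintegral//.
have mh := measurable_int mu hi.
apply: le_trans (le_abse_integral mu mD mh) _.
rewrite [leLHS]integral_mkcond [leRHS]integral_mkcond; apply: ge0_le_integral => //.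
- by move=> x _; rewrite /patch; case: ifP.
- by apply/(measurable_restrictT _ _).1 => //; exact: measurableT_comp.
- by apply/(measurable_restrictT _ _).1 => //; exact/measurable_EFinP.
move=> x _; rewrite /patch; case: ifPn => [|_]; last first.
  by case: ifP => // _; rewrite lee_fin.
rewrite inE => /hk[[Ax hx]|/= ->]; first by rewrite mem_set.
by rewrite normr0; case: ifP => // _; rewrite lee_fin.
Qed.

Lemma segment_integrable_chasles g (a b c : R) : segment_integrable g -> a <= b -> b <= c ->
  \int[mu]_(x in `[a, c]) g x = \int[mu]_(x in `[a, b]) g x + \int[mu]_(x in `[b, c]) g x.
Proof.
move=> gi ab bc; have := @Rintegral_itvB R g (BLeft a) (BRight c) b (gi a c).
rewrite !bnd_simp => /(_ ab bc) H.
rewrite -(@Rintegral_itv_obnd_cbnd _ b (BRight c)) -?H; first by rewrite addrC subrK.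
by apply: integrableS (gi b c) => //; exact: subset_itv_oc_cc.
Qed.

Lemma segment_integrable_cst (c : R) : segment_integrable (cst c : R -> R).
Proof.
move=> u v; apply: continuous_compact_integrable; first exact: segment_compact.
by apply: continuous_subspaceT => x; exact: cvg_cst.
Qed.

Lemma segment_integrable_comb (a b : R) f g : segment_integrable f -> segment_integrable g ->
  segment_integrable (fun x => a * f x + b * g x).
Proof.
move=> fi gi u v.
have Z c h : segment_integrable h -> mu.-integrable `[u, v] (fun x => c%:E * (EFin \o h) x)%E.
  by move=> hi; apply: integrableZl => //; exact: hi.
by have := integrableD _ (Z a f fi) (Z b g gi); apply.
Qed.

(** Absolute continuity with derivative [g] almost everywhere, in integrated form. *)
Definition primitive g F := forall a b : R, a <= b ->
  F b - F a = \int[mu]_(x in `[a, b]) g x.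

Lemma primitive_exists g : segment_integrable g -> exists F, primitive g F.
Proof.
move=> gi; pose I (a b : R) := \int[mu]_(x in `[a, b]) g x.
exists (fun x => if 0 <= x then I 0 x else - I x 0) => a b ab; rewrite -/(I a b).
case: (lerP 0 a) => a0; last case: (lerP 0 b) => b0.
- rewrite (le_trans a0 ab) /I (segment_integrable_chasles gi a0 ab); ring.
- by rewrite opprK addrC -(segment_integrable_chasles gi (ltW a0) b0).
- rewrite opprK /I (segment_integrable_chasles gi ab (ltW b0)); ring.
Qed.

Lemma smooth_step_derive : exists B : R -> R, exists M : R, [/\ smooth B,
  forall x, x <= 0 -> B x = 0, forall x, 1 <= x -> B x = 1, forall x, 0 <= B x <= 1 &
  (forall x, `|derive1 B x| <= M) /\ forall x, derive1 B x != 0 -> 0 <= x <= 1].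
Proof.
have [B [sB B0 B1 B01]] := @smooth_step R.
have dB0 x : derive1 B x != 0 -> 0 <= x <= 1.
  apply: contraNT; rewrite negb_and -!ltNge => /orP[x0|x1]; apply/eqP.
  - apply: is_derive_derive1; apply: near_eq_is_derive (is_derive_cst (0 : R) x (1 : R)).
    by near=> y; apply/esym/B0/ltW; near: y; exact: lt_nbhsl.
  - apply: is_derive_derive1; apply: near_eq_is_derive (is_derive_cst (1 : R) x (1 : R)).
    by near=> y; apply/esym/B1/ltW; near: y; exact: lt_nbhsr.
have cB : continuous (derive1 B) by apply: smooth_continuous; exact: smooth_derive1.
have cab : {within `[0, 1], continuous (fun x : R => `|derive1 B x|)}.
  by apply: continuous_subspaceT => x; apply: (continuous_comp (cB x)); exact: norm_continuous.
have [c _ Hc] := EVT_max ler01 cab.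
exists B, `|derive1 B c|; split => //; split => // x.
have [->|/dB0 x01] := eqVneq (derive1 B x) 0; first by rewrite normr0.
exact: Hc.
Unshelve. all: by end_near. Qed.

End primitives.

Section du_bois_reymond.
Context {R : realType}.
Local Notation mu := (@lebesgue_measure R).
Implicit Types (f g F G : R -> R).
Variables (B : R -> R) (M : R).
Hypothesis sB : smooth B.
Hypothesis B0 : forall x, x <= 0 -> B x = 0.
Hypothesis B1 : forall x, 1 <= x -> B x = 1.
Hypothesis B01 : forall x, 0 <= B x <= 1.
Hypothesis dBM : forall x, `|derive1 B x| <= M.
Hypothesis dB0 : forall x, derive1 B x != 0 -> 0 <= x <= 1.

(** A smooth step from 0 to 1 whose rise takes place between [r] and [r + e]. *)
Definition step_at (r e x : R) := B (e^-1 * x + (- (e^-1 * r))).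

Lemma smooth_step_at r e : smooth (step_at r e).
Proof. exact: smooth_affine. Qed.

Lemma derive_step_at r e x : derive1 (step_at r e) x = e^-1 * derive1 B (e^-1 * (x - r)).
Proof.
apply: is_derive_derive1; rewrite mulrBr; apply: is_derive_affine.
exact: smooth_is_derive.
Qed.

Lemma step_at0 r e x : 0 < e -> x <= r -> step_at r e x = 0.
Proof. by move=> e0 xr; rewrite /step_at -mulrBr B0// pmulr_rle0 ?invr_gt0// subr_le0. Qed.

Lemma step_at1 r e x : 0 < e -> r + e <= x -> step_at r e x = 1.
Proof.
move=> e0 xr; rewrite /step_at -mulrBr B1// mulrC ler_pdivlMr// mul1r; lra.
Qed.

Lemma integrable_mul_continuous f (h : R -> R) (a b : R) : segment_integrable f -> measurable_fun setT f ->
  continuous h -> mu.-integrable `[a, b] (EFin \o (fun x => h x * f x)).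
Proof.
move=> fi mf ch.
have ch' : {within `[a, b], continuous h} by exact: continuous_subspaceT.
have [k0|] := pselect (`[a, b]%classic = set0 :> set R).
  by rewrite k0; exact: integrable_set0.
have [C [_ HC]] := compact_bounded (continuous_compact ch' (@segment_compact _ a b)).
move=> _; have {}HC x : `[a, b]%classic x -> `|h x| <= C + 1.
  by move=> xab; apply: (HC (C + 1)); [rewrite ltrDl|exists x].
apply: (@le_integrable _ _ _ mu _ _ _ (EFin \o (fun x => (C + 1) * f x))) => //.
- apply/measurable_EFinP; apply: measurable_funM; apply: measurable_funTS => //.
  exact: continuous_measurable_fun.
- move=> x /HC hx; rewrite /= lee_fin !normrM; apply: ler_wpM2r => //.
  by apply: le_trans hx (ler_norm _).
- exact: (integrableZl _ (C + 1) (fi a b)).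
Qed.

(** The derivative of [step_at r e] has integral 1, is bounded by [M / e] and vanishes outside of
    [`[r, r + e]]: as [e] tends to 0, integrating [f] against it gives the value of [f] at the Lebesgue
    point [r]. *)
Lemma step_at_kernel f r : segment_integrable f -> measurable_fun setT f -> lebesgue_pt f r ->
  forall n, 0 < n -> exists2 d, 0 < d & forall e a b, 0 < e < d -> a <= r -> r + e <= b ->
  `|\int[mu]_(x in `[a, b]) (derive1 (step_at r e) x * f x) - f r| <= n.
Proof.
move=> fi mf fr n n0.
have M0 : 0 <= M by apply: le_trans (dBM 0).
have [|d d0 Hd] := near_lebesgue_pt fr (e := n / (2 * (M + 1))).
  by rewrite divr_gt0// mulr_gt0// ltr_wpDl.
exists (d / 2); first by rewrite divr_gt0.
move=> e a b /andP[e0 ed] ar reb.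
have ab : a < b by lra.
have cd : continuous (derive1 (step_at r e)).
  by apply: smooth_continuous; apply: smooth_derive1; exact: smooth_step_at.
have i1 := @segment_integrable_cst R 1.
have ik : mu.-integrable `[a, b] (EFin \o derive1 (step_at r e)).
  have := integrable_mul_continuous a b i1 (measurable_cst _) cd.
  by apply: eq_integrable => // x _; rewrite /= mulr1.
have I1 : \int[mu]_(x in `[a, b]) derive1 (step_at r e) x = 1.
  rewrite /Rintegral (@continuous_FTC2 _ _ (step_at r e))//.
  - by rewrite step_at1// step_at0// -EFinD/= subr0.
  - exact: continuous_subspaceT.
  - have cs : continuous (step_at r e) by apply: smooth_continuous; exact: smooth_step_at.
    split => [x _|/=|/=].
    + exact: (@smooth_step_at r e 0%N x).
    + by apply: cvg_at_right_filter; exact: cs.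
    + by apply: cvg_at_left_filter; exact: cs.
have -> : \int[mu]_(x in `[a, b]) (derive1 (step_at r e) x * f x) - f r =
   \int[mu]_(x in `[a, b]) (derive1 (step_at r e) x * (f x - f r)).
  rewrite -[X in _ - X]mul1r -I1 -RintegralZr// -RintegralB//.
  - by apply: eq_Rintegral => x _; rewrite mulrBr.
  - exact: integrable_mul_continuous.
  - exact: (integrable_mul_continuous a b (@segment_integrable_cst R (f r)) (measurable_cst _) cd).
rewrite -lee_fin.
apply: (@le_trans _ _ (\int[mu]_(x in ball r (2 * e)) ((M / e) * `|f x - f r|)%:E)%E).
  apply: norm_Rintegral_le => //.
  - exact: measurable_ball.
  - have := integrable_mul_continuous a b (f := fun x => f x - f r) _ _ cd; apply.
      have := segment_integrable_comb 1 (- f r) fi i1; congr segment_integrable; apply/funext => x.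
      by rewrite mul1r mulr1.
    by apply: measurable_funB.
  - apply: measurable_funM => //; apply: measurableT_comp => //.
    by apply: measurable_funB => //; exact: measurable_funTS.
  - by move=> x; rewrite mulr_ge0// divr_ge0// ltW.
  - move=> x _; rewrite derive_step_at.
    have [->|/dB0 /andP[x0 x1]] := eqVneq (derive1 B (e^-1 * (x - r))) 0.
      by right; rewrite mulr0 mul0r.
    left; split.
      rewrite /ball/= ltr_norml; move: x0 x1.
      rewrite pmulr_rge0 ?invr_gt0// mulrC ler_pdivrMr// mul1r; lra.
    rewrite !normrM ler_wpM2r// gtr0_norm ?invr_gt0// mulrC.
    by rewrite ler_wpM2r// invr_ge0 ltW.
under eq_integral do rewrite EFinM.
rewrite ge0_integralZl//; first last.
- by rewrite lee_fin divr_ge0// ltW.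
- apply/measurable_EFinP; apply: measurableT_comp => //.
  by apply: measurable_funB => //; exact: measurable_funTS.
- exact: measurable_ball.
have := Hd (2 * e); rewrite mulr_gt0//= => /(_ ltac:(lra)) H.
apply: (@le_trans _ _ ((M / e)%:E * (n / (2 * (M + 1)) * (2 * e))%:E)%E).
  by apply: lee_wpmul2l => //; rewrite lee_fin divr_ge0// ltW.
rewrite -EFinM lee_fin.
have -> : M / e * (n / (2 * (M + 1)) * (2 * e)) = n * (M / (M + 1)).
  by field; lra.
have M1 : 0 < M + 1 by lra.
by rewrite ler_piMr ?(ltW n0)// ler_pdivrMr// mul1r; lra.
Qed.
End du_bois_reymond.

Section weak_derivatives.
Context {R : realType}.
Local Notation mu := (@lebesgue_measure R).
Implicit Types (f g F G : R -> R).

Lemma small_integral g (r n : R) : segment_integrable g -> measurable_fun setT g -> 0 < n ->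
  exists2 d, 0 < d & forall e, 0 < e < d ->
    (\int[mu]_(x in `[r, (r + e)%R]) (`|g x|)%:E <= n%:E)%E.
Proof.
move=> gi mg n0; pose h := g \_ `[r, r + 1].
have hi : mu.-integrable setT (EFin \o h).
  by have := gi r (r + 1); rewrite integrable_mkcond// restrict_EFin.
have [d [d0 Hd]] := integral_normr_continuous hi n0.
exists (Num.min d 1); first by rewrite lt_min d0 ltr01.
move=> e /andP[e0]; rewrite lt_min => /andP[ed e1].
have mA : (mu `[r, (r + e)%R] < d%:E)%E.
  by rewrite lebesgue_measure_itv/= lte_fin ltrDl e0 -EFinD addrAC subrr add0r lte_fin.
have H := Hd _ (measurable_itv `[r, r + e]) mA.
have hgi : mu.-integrable `[r, r + e] (fun x => (`|g x|)%:E).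
  by have := integrable_norm (gi r (r + e)).
rewrite -[leLHS]fineK; last exact: integrable_fin_num.
rewrite lee_fin ltW//; apply: le_lt_trans H; rewrite le_eqVlt; apply/orP; left; apply/eqP.
congr fine; apply: eq_integral => x; rewrite inE/= in_itv/= => /andP[rx xe].
rewrite /h /patch mem_set//= in_itv/= rx/=; apply: le_trans xe _.
by rewrite lerD2l ltW.
Qed.

Lemma ereal_le_Rle (a b : R) (c : \bar R) : (a%:E <= c)%E -> (c <= b%:E)%E -> a <= b.
Proof. by move=> ac cb; rewrite -lee_fin; exact: le_trans cb. Qed.

(** As [e] tends to 0, the difference [step_at r e - step_at s e] tends to the indicator of [`[r, s]]:
    the two functions differ only on [`[r, r + e]] and [`[s, s + e]], where [g] has small integral. *)
Lemma step_at_integral (B : R -> R) g (r s T : R) :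
  smooth B -> (forall x, x <= 0 -> B x = 0) -> (forall x, 1 <= x -> B x = 1) ->
  (forall x, 0 <= B x <= 1) ->
  segment_integrable g -> measurable_fun setT g -> r < s -> s < T ->
  forall n, 0 < n -> exists2 d, 0 < d & forall e, 0 < e < d ->
  `|\int[mu]_(x in `[r, T]) ((step_at B r e x - step_at B s e x) * g x)
    - \int[mu]_(x in `[r, s]) g x| <= n.
Proof.
move=> sB B0 B1 B01 gi mg rs sT n n0.
have n2 : 0 < n / 2 by rewrite divr_gt0.
have [d1 d10 H1] := small_integral r gi mg n2.
have [d2 d20 H2] := small_integral s gi mg n2.
exists (Num.min (Num.min d1 d2) (s - r)); first by rewrite !lt_min d10 d20 subr_gt0.
move=> e; rewrite !lt_min => /andP[e0 /andP[/andP[ed1 ed2] ed3]].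
have step01 a x : 0 <= step_at B a e x <= 1 by exact: B01.
pose phi x := step_at B r e x - step_at B s e x.
have cphi : continuous phi.
  by apply: smooth_continuous; apply: smoothB; exact: smooth_step_at.
have Ip a b : mu.-integrable `[a, b] (EFin \o (fun x => phi x * g x)).
  exact: integrable_mul_continuous.
rewrite (segment_integrable_chasles Ip (ltW rs) (ltW sT)) addrAC -RintegralB; [|by []|exact: Ip|exact: gi].
rewrite (splitr n); apply: le_trans (ler_normD _ _) _; apply: lerD.
  apply: (ereal_le_Rle _ (H1 e _)); last by rewrite e0.
  apply: norm_Rintegral_le => //.
  - have := segment_integrable_comb 1 (-1) Ip gi r s; apply: eq_integrable => // x _.
    by rewrite /= mul1r mulN1r.
  - by apply: measurableT_comp => //; exact: measurable_funTS.
  move=> x; rewrite /= !in_itv/= => /andP[rx xs].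
  rewrite /phi (step_at0 B0 e0 xs) subr0.
  have [xre|xre] := leP x (r + e); last first.
    by right; rewrite (step_at1 B1 e0 (ltW xre)) mul1r subrr.
  left; split; first by rewrite rx.
  rewrite -{2}[g x]mul1r -mulrBl normrM ler_piMl// ler_norml.
  have := step01 r x; lra.
apply: (ereal_le_Rle _ (H2 e _)); last by rewrite e0.
apply: norm_Rintegral_le => //.
- by apply: measurableT_comp => //; exact: measurable_funTS.
move=> x; rewrite /= !in_itv/= => /andP[sx xT].
have xre : r + e <= x by lra.
rewrite /phi (step_at1 B1 e0 xre).
have [xse|xse] := leP x (s + e); last first.
  by right; rewrite (step_at1 B1 e0 (ltW xse)) subrr mul0r.
left; split; first by rewrite sx.
rewrite normrM ler_piMl// ler_norml.
have := step01 s x; lra.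
Qed.

(** Use [step_at r e - step_at s e] as a test function.  Its derivative samples [f] at [r] and [s]
    ([step_at_kernel]), and it becomes itself the indicator of [`[r, s]] ([step_at_integral]). *)
Lemma weak_derivative_jump f g (r s T : R) :
  segment_integrable f -> measurable_fun setT f -> segment_integrable g -> measurable_fun setT g ->
  r < s -> s < T -> lebesgue_pt f r -> lebesgue_pt f s ->
  (forall phi, smooth phi -> (forall x, ~~ (r <= x <= T) -> phi x = 0) ->
    \int[mu]_(x in `[r, T]) (derive1 phi x * f x) =
    - \int[mu]_(x in `[r, T]) (phi x * g x)) ->
  f s - f r = \int[mu]_(x in `[r, s]) g x.
Proof.
move=> fi mf gi mg rs sT fr fs W.
have [B [M [sB B0 B1 B01 [dBM dB0]]]] := @smooth_step_derive R.
apply/eqP; rewrite -subr_eq0 -normr_le0; apply/ler_addgt0Pl => n n0; rewrite addr0.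
have n3 : 0 < n / 3 by rewrite divr_gt0.
have [d1 d10 H1] := step_at_kernel sB B0 B1 dBM dB0 fi mf fr n3.
have [d2 d20 H2] := step_at_kernel sB B0 B1 dBM dB0 fi mf fs n3.
have [d3 d30 H3] := step_at_integral sB B0 B1 B01 gi mg rs sT n3.
pose d := Num.min (Num.min d1 d2) (Num.min d3 (T - s)).
have d0 : 0 < d by rewrite !lt_min d10 d20 d30 subr_gt0.
have : d / 2 < d by rewrite ltr_pdivrMr// ltr_pMr// ltr1n.
rewrite [in ltRHS]/d !lt_min => /andP[/andP[e1 e2] /andP[e3 e4]].
have e0 : 0 < d / 2 by rewrite divr_gt0.
move: (d / 2) e0 e1 e2 e3 e4 => e e0 e1 e2 e3 e4.
have {}H1 := H1 e r T; rewrite e0 e1 lexx in H1.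
have {}H1 := H1 erefl erefl ltac:(lra).
have {}H2 := H2 e r T; rewrite e0 e2 (ltW rs) in H2.
have {}H2 := H2 erefl erefl ltac:(lra).
have {}H3 := H3 e; rewrite e0 e3 in H3; have {}H3 := H3 erefl.
pose phi x := step_at B r e x - step_at B s e x.
have sphi : smooth phi by apply: smoothB; exact: smooth_step_at.
have Ik a : mu.-integrable `[r, T] (EFin \o (fun x => derive1 (step_at B a e) x * f x)).
  apply: integrable_mul_continuous => //; apply: smooth_continuous.
  by apply: smooth_derive1; exact: smooth_step_at.
have := W phi sphi; rewrite (_ : \int[mu]_(x in _) (_ * f x) =
  \int[mu]_(x in `[r, T]) (derive1 (step_at B r e) x * f x)
  - \int[mu]_(x in `[r, T]) (derive1 (step_at B s e) x * f x)); last first.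
  rewrite -RintegralB//; apply: eq_Rintegral => x _; rewrite -mulrBl; congr (_ * _).
  apply: is_derive_derive1; have := is_deriveB (smooth_is_derive (@smooth_step_at _ _ sB r e) x)
    (smooth_is_derive (@smooth_step_at _ _ sB s e) x); exact.
have supp x : ~~ (r <= x <= T) -> phi x = 0.
  rewrite negb_and -!ltNge => /orP[xr|Tx]; rewrite /phi.
    by rewrite !step_at0 ?subrr//; lra.
  by rewrite !step_at1 ?subrr//; lra.
move=> /(_ supp); rewrite -/(phi _) => E.
(* [p - q] stands for the integral of [f] against the derivative of the test function and [z] for the
   integral of [g] against the test function; each is within [n / 3] of its limit. *)
have close (p q u v w z : R) : p - q = - z -> `|p - u| <= n / 3 -> `|q - v| <= n / 3 ->
    `|z - w| <= n / 3 -> `|v - u - w| <= n.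
  by clear; rewrite !ler_norml; lra.
exact: close E H1 H2 H3.
Qed.

(** Almost every point is a Lebesgue point of [f], and between two of them the increment of [f] is
    the integral of [g].  So [f] agrees almost everywhere with the primitive of [g] that is equal to
    [f] at one chosen Lebesgue point. *)
Lemma weak_derivative_primitive f g (J : set R) :
  open J -> J !=set0 ->
  f \in Lfun mu 2%:E -> g \in Lfun mu 2%:E ->
  (forall phi a b, smooth phi -> J a -> J b -> (forall x, ~~ (a <= x <= b) -> phi x = 0) ->
    \int[mu]_(x in `[a, b]) (derive1 phi x * f x) =
    - \int[mu]_(x in `[a, b]) (phi x * g x)) ->
  exists2 F, primitive g F & {ae mu, forall x, J x -> f x = F x}.
Proof.
move=> oJ J0 f2 g2 W.
have [fi gi] := (Lfun2_segment_integrable f2, Lfun2_segment_integrable g2).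
have [mf mg] := (Lfun_measurable f2, Lfun_measurable g2).
have aeL := lebesgue_differentiation (segment_integrable_locally mf fi).
have jump r s : lebesgue_pt f r -> lebesgue_pt f s -> J r -> J s -> r < s ->
    f s - f r = \int[mu]_(x in `[r, s]) g x.
  move=> Lr Ls Jr Js rs.
  have [e /= e0 He] : nbhs s J by apply: open_nbhs_nbhs.
  have JT : J (s + e / 2).
    apply: He; rewrite /ball_/= opprD addrA subrr sub0r normrN gtr0_norm ?divr_gt0//.
    by rewrite ltr_pdivrMr// ltr_pMr// ltr1n.
  apply: (weak_derivative_jump (T := s + e / 2)) => //; first by rewrite ltrDl divr_gt0.
  by move=> phi sphi supp; exact: W.
have [x0 Jx0] := J0.
have [e /= e0 He] : nbhs x0 J by apply: open_nbhs_nbhs.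
have x0e : x0 < x0 + e by rewrite ltrDl.
have [p /andP[p1 p2] Lp] := ae_exists_itv x0e aeL.
have Jp : J p by apply: He; rewrite /ball_/= ltr_norml; lra.
have [G0 pG] := primitive_exists gi.
exists (fun x => G0 x - G0 p + f p).
  by move=> a b ab; rewrite -pG//; ring.
apply: (@filterS _ _ (ae_filter_ringOfSetsType mu) _ _ _ aeL) => x Lx Jx.
have [xp|xp|->] := ltgtP x p; last by rewrite subrr add0r.
- have := jump _ _ Lx Lp Jx Jp xp; rewrite -pG ?ltW// => ?; lra.
- have := jump _ _ Lp Lx Jp Jx xp; rewrite -pG ?ltW// => ?; lra.
Qed.
End weak_derivatives.

(** * Integration by parts for square integrable functions on an interval *)

Section green.
Context {R : realType}.
Local Notation mu := (@lebesgue_measure R).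
Implicit Types (f g F G : R -> R).

Lemma primitive_continuous g F : segment_integrable g -> primitive g F -> continuous F.
Proof.
move=> gi gF x.
have ab : x - 1 < x + 1 by lra.
have [+ _ _] := (continuous_within_itvP _ ab).1
  (parameterized_integral_continuous (ltW ab) (gi _ _)).
move=> /(_ x); rewrite in_itv/= => /(_ ltac:(lra)) c.
have c2 : {for x, continuous (cst (F (x - 1)) \+ (fun y => parameterized_integral mu (x - 1) y g))}.
  by apply: continuousD => //; exact: cvg_cst.
rewrite /continuous_at in c2 *.
have E y : x - 1 < y -> F y = F (x - 1) + parameterized_integral mu (x - 1) y g.
  by move=> xy; rewrite /parameterized_integral -gF ?ltW//; ring.
rewrite (E x); last by lra.
apply: cvg_trans c2; apply: near_eq_cvg; near=> y; rewrite /= -E//.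
by near: y; apply: lt_nbhsr; lra.
Unshelve. all: by end_near. Qed.

(** Integrate [f x * g y] over the triangle [a <= y <= x <= b] in both orders. *)
Lemma Green_formula f g F G (a b : R) : segment_integrable f -> measurable_fun setT f ->
  segment_integrable g -> measurable_fun setT g -> primitive f F -> primitive g G -> a <= b ->
  \int[mu]_(x in `[a, b]) (F x * g x + f x * G x) = F b * G b - F a * G a.
Proof.
move=> fi mf gi mg fF gG ab.
have cF := primitive_continuous fi fF; have cG := primitive_continuous gi gG.
pose f0 := f \_ `[a, b]; pose g0 := g \_ `[a, b].
have f0i : mu.-integrable setT (EFin \o f0).
  by have := fi a b; rewrite integrable_mkcond// restrict_EFin.
have g0i : mu.-integrable setT (EFin \o g0).
  by have := gi a b; rewrite integrable_mkcond// restrict_EFin.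
have mf0 : measurable_fun setT f0 by apply/measurable_EFinP; exact: (measurable_int mu f0i).
have mg0 : measurable_fun setT g0 by apply/measurable_EFinP; exact: (measurable_int mu g0i).
pose ind (x y : R) : R := if y <= x then 1 else 0.
pose H (z : R * R) : \bar R := (f0 z.1 * g0 z.2 * ind z.1 z.2)%:E.
have mH : measurable_fun setT H.
  apply/measurable_EFinP; apply: measurable_funM; first apply: measurable_funM.
  - exact: measurableT_comp.
  - exact: measurableT_comp.
  - apply: measurable_fun_ifT => //.
    exact: measurable_fun_ler.
have absind x y : `|ind x y| <= 1 by rewrite /ind; case: ifP; rewrite ?normr1 ?normr0.
have iH : (mu \x mu)%E.-integrable setT H.
  apply: (integrable12ltyP mu mu mH).2.
  pose C := \int[mu]_y `|g0 y|.
  have gn : mu.-integrable setT (fun y => (`|g0 y|)%:E) by have := integrable_norm g0i.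
  have CE : (\int[mu]_y (`|g0 y|)%:E = C%:E)%E.
    by rewrite fineK//; exact: integrable_fin_num.
  have fC : mu.-integrable setT (fun x => C%:E * (`|f0 x|)%:E)%E.
    by apply: integrableZl => //; have := integrable_norm f0i.
  have /integrableP[_] := fC; apply: le_lt_trans; apply: ge0_le_integral => //.
  - by move=> x _; exact: integral_ge0.
  - apply: (measurable_fun_fubini_tonelli_F (m2 := mu) (abse \o H)) => //.
    by apply: measurableT_comp.
    by move=> z; exact: abse_ge0.
  - by apply: measurableT_comp => //; exact: (measurable_int mu fC).
  move=> x _; rewrite gee0_abs; last first.
    by rewrite -EFinM lee_fin mulr_ge0// /C Rintegral_ge0.
  rewrite muleC -CE -ge0_integralZl//; first last.
  - exact: (measurable_int mu gn).
  apply: ge0_le_integral => //.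
  - apply/measurable_EFinP; apply: measurableT_comp => //=.
    apply: measurable_funM; first by apply: measurable_funM => //; exact: measurable_cst.
    apply: measurable_fun_ifT => //.
    by apply: measurable_fun_ler => //; exact: measurable_cst.
  - by apply/measurable_EFinP; apply: measurable_funM => //; exact: measurableT_comp.
  - by move=> y _; rewrite -EFinM lee_fin !normrM ler_piMr// mulr_ge0.
have I1 x : (\int[mu]_y H (x, y))%E = (((fun x => f x * (G x - G a)) \_ `[a, b]) x)%:E.
  rewrite /H/= /f0 /patch; case: ifPn => [|_]; last first.
    by rewrite integral0_eq// => y _; rewrite !mul0r.
  rewrite inE/= in_itv/= => /andP[ax xb].
  transitivity (\int[mu]_(y in `[a, x]) ((f x)%:E * (g y)%:E))%E.
    rewrite [RHS]integral_mkcond; apply: eq_integral => y _ /=.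
    rewrite /g0 /patch /ind; case: (leP y x) => yx; last first.
      by rewrite mulr0 memNset//= in_itv/= [y <= x]leNgt yx andbF.
    rewrite mulr1; case: (leP a y) => ay; last first.
      by rewrite !memNset ?mulr0//= in_itv/= [a <= y]leNgt ay.
    by rewrite !mem_set//= in_itv/= ay ?yx// (le_trans yx xb).
  rewrite integralZl; [|by []|exact: gi].
  by rewrite gG// EFinM; congr (_ * _)%E; rewrite fineK//; exact: integrable_fin_num.
have I2 y : (\int[mu]_x H (x, y))%E = (((fun x => g x * (F b - F x)) \_ `[a, b]) y)%:E.
  rewrite /H/= /g0 /patch; case: ifPn => [|_]; last first.
    by rewrite integral0_eq// => x _; rewrite mulr0 mul0r.
  rewrite inE/= in_itv/= => /andP[ay yb].
  transitivity (\int[mu]_(x in `[y, b]) ((g y)%:E * (f x)%:E))%E.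
    rewrite [RHS]integral_mkcond; apply: eq_integral => x _ /=.
    rewrite /f0 /patch /ind; case: (leP y x) => yx; last first.
      by rewrite mulr0 [in RHS]memNset//= in_itv/= [y <= x]leNgt yx.
    rewrite mulr1; case: (leP x b) => xb; last first.
      by rewrite !memNset ?mul0r//= in_itv/= [x <= b]leNgt xb andbF.
    by rewrite !mem_set//= ?in_itv/= ?xb ?yx ?(le_trans ay yx)// mulrC.
  rewrite integralZl; [|by []|exact: fi].
  by rewrite fF// EFinM; congr (_ * _)%E; rewrite fineK//; exact: integrable_fin_num.
have := Fubini iH; under eq_integral do rewrite I1.
under [in RHS]eq_integral do rewrite I2.
move=> /(congr1 fine); rewrite -/(Rintegral _ _ _) -[RHS]/(Rintegral _ _ _) -!Rintegral_mkcond => E.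
have Ic (c : R) (h k : R -> R) : segment_integrable h -> measurable_fun setT h -> continuous k ->
   mu.-integrable `[a, b] (EFin \o (fun x => (k x + c) * h x)).
  move=> hi mh ck; apply: integrable_mul_continuous => // x.
  by apply: cvgD; [exact: ck|exact: cvg_cst].
have If (c : R) (h : R -> R) : segment_integrable h -> mu.-integrable `[a, b] (EFin \o (fun x => c * h x)).
  by move=> hi; have := segment_integrable_comb c 0 hi hi a b;
    apply: eq_integrable => // x _; rewrite /= mul0r addr0.
have IFg : mu.-integrable `[a, b] (EFin \o (fun x => F x * g x)).
  by have := Ic 0 _ _ gi mg cF; apply: eq_integrable => // x _; rewrite /= addr0.
have IGf : mu.-integrable `[a, b] (EFin \o (fun x => f x * G x)).
  by have := Ic 0 _ _ fi mf cG; apply: eq_integrable => // x _; rewrite /= addr0 mulrC.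
rewrite RintegralD//.
have E1 : \int[mu]_(x in `[a, b]) (f x * (G x - G a)) =
  \int[mu]_(x in `[a, b]) (f x * G x) - G a * (F b - F a).
  rewrite fF// -RintegralZl; [|by []|exact: fi].
  rewrite -RintegralB; [|by []|exact: IGf|exact: (If _ _ fi)].
  by apply: eq_Rintegral => x _; ring.
have E2 : \int[mu]_(x in `[a, b]) (g x * (F b - F x)) =
  F b * (G b - G a) - \int[mu]_(x in `[a, b]) (F x * g x).
  rewrite gG// -RintegralZl; [|by []|exact: gi].
  rewrite -RintegralB; [|by []|exact: (If _ _ gi)|exact: IFg].
  by apply: eq_Rintegral => x _; ring.
move: E; rewrite E1 E2 => E.
have -> : \int[mu]_(x in `[a, b]) (f x * G x) =
    G a * (F b - F a) + (F b * (G b - G a) - \int[mu]_(x in `[a, b]) (F x * g x)).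
  by rewrite -E addrC subrK.
ring.
Qed.
End green.

Section component_green.
Context {R : realType}.
Local Notation mu := (@lebesgue_measure R).
Implicit Types (f g h F G P : R -> R) (J : set R).

Lemma continuous_segment_integrable f : continuous f -> segment_integrable f.
Proof.
move=> cf u v; apply: continuous_compact_integrable; first exact: segment_compact.
exact: continuous_subspaceT.
Qed.

Lemma integrable_comb J (a b : R) f g : measurable J ->
  mu.-integrable J (EFin \o f) -> mu.-integrable J (EFin \o g) ->
  mu.-integrable J (EFin \o (fun x => a * f x + b * g x)).
Proof.
move=> mJ fi gi.
have Z c h : mu.-integrable J (EFin \o h) -> mu.-integrable J (fun x => c%:E * (EFin \o h) x)%E.
  by move=> hi; apply: integrableZl.
by have := integrableD _ (Z a f fi) (Z b g gi); apply.
Qed.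

Lemma smooth_primitive f : smooth f -> primitive (derive1 f) f.
Proof.
move=> sf a b; rewrite le_eqVlt => /orP[/eqP ->|ab].
  by rewrite subrr set_itv1 Rintegral_set1.
have cf := smooth_continuous sf.
rewrite /Rintegral (@continuous_FTC2 _ _ f)//.
- by apply: continuous_subspaceT; apply: smooth_continuous; exact: smooth_derive1.
- split => [x _|/=|/=].
  + exact: (sf 0%N).
  + by apply: cvg_at_right_filter; exact: cf.
  + by apply: cvg_at_left_filter; exact: cf.
Qed.

Lemma segment_integrable_mul_continuous f g : segment_integrable f -> measurable_fun setT f -> continuous g ->
  segment_integrable (fun x => g x * f x).
Proof. by move=> fi mf cg a b; exact: integrable_mul_continuous. Qed.

Lemma ae_integrable J f g : measurable J -> measurable_fun J f ->
  f = g %[ae mu in J] -> mu.-integrable J (EFin \o g) -> mu.-integrable J (EFin \o f).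
Proof.
move=> mJ mf fg /integrableP[mg gfin].
have mf' : measurable_fun J (EFin \o f) by exact/measurable_EFinP.
apply/integrableP; split=> //; apply: le_lt_trans gfin; rewrite le_eqVlt; apply/orP; left; apply/eqP.
apply: ae_eq_integral => //; [exact: measurableT_comp|exact: measurableT_comp|].
apply: (@filterS _ _ (ae_filter_ringOfSetsType mu) _ _ _ fg) => x /= H /H ->.
by [].
Qed.

Lemma ae_Rintegral J f g : measurable J -> measurable_fun J f -> measurable_fun J g ->
  f = g %[ae mu in J] -> \int[mu]_(x in J) f x = \int[mu]_(x in J) g x.
Proof.
move=> mJ mf mg fg; congr fine; apply: ae_eq_integral => //.
- exact/measurable_EFinP.
- exact/measurable_EFinP.
apply: (@filterS _ _ (ae_filter_ringOfSetsType mu) _ _ _ fg) => x /= H /H ->.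
by [].
Qed.

(** The integrals against the cut-offs [eta n] converge to the integral of [h] by dominated
    convergence: [P], which will be the product of two square integrable functions, is integrable, and
    the derivatives of the [eta n] are bounded and eventually vanish at each point. *)
Lemma cutoff_limit J h P (eta : nat -> R -> R) (M K : R) :
  measurable J -> mu.-integrable J (EFin \o h) -> mu.-integrable J (EFin \o P) ->
  (forall n, smooth (eta n)) -> (forall n x, `|eta n x| <= 1) ->
  (forall n x, `|derive1 (eta n) x| <= M) ->
  (forall x, J x -> \forall n \near \oo, eta n x = 1 /\ derive1 (eta n) x = 0) ->
  (forall n, \int[mu]_(x in J) (P x * derive1 (eta n) x + h x * eta n x) = K) ->
  \int[mu]_(x in J) h x = K.
Proof.
move=> mJ hi Pi seta eta1 detaM etaJ IK.
pose q n x := P x * derive1 (eta n) x + h x * eta n x.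
have mh : measurable_fun J h by apply/measurable_EFinP; exact: (measurable_int mu hi).
have mP : measurable_fun J P by apply/measurable_EFinP; exact: (measurable_int mu Pi).
have ms phi : smooth phi -> measurable_fun J phi.
  move=> sphi; apply: measurable_funTS; apply: continuous_measurable_fun.
  exact: smooth_continuous.
have mq n : measurable_fun J (q n).
  apply: measurable_funD; apply: measurable_funM => //; apply: ms; last exact: seta.
  by apply: smooth_derive1; exact: seta.
have dom : mu.-integrable J (EFin \o (fun x => M * `|P x| + `|h x|)).
  have := integrable_comb M 1 mJ (integrable_norm Pi) (integrable_norm hi).
  by apply: eq_integrable => // x _; rewrite /= mul1r.
have M0 : 0 <= M by apply: le_trans (detaM 0%N 0).
have qdom n x : `|q n x| <= M * `|P x| + `|h x|.
  apply: le_trans (ler_normD _ _) _; rewrite !normrM; apply: lerD.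
    by rewrite mulrC ler_wpM2r.
  by rewrite ler_piMr.
have E n : (\int[mu]_(x in J) (q n x)%:E = K%:E)%E.
  rewrite -(IK n) /Rintegral fineK//; apply: integrable_fin_num => //.
  apply: (le_integrable _ _ _ dom) => //; first by apply/measurable_EFinP; exact: mq.
  move=> x _; rewrite /= lee_fin; exact: le_trans (qdom n x) (ler_norm _).
have lim x : J x -> (EFin \o q n) x @[n --> \oo] --> (EFin \o h) x.
  move=> Jx; apply: cvg_near_cst; have := etaJ x Jx; apply: filterS => n [e1 e2].
  by rewrite /= /q e1 e2 mulr0 add0r mulr1.
have dom' x : forall n, J x -> (`|(EFin \o q n) x| <= (EFin \o (fun x => (M * `|P x| + `|h x|)%R)) x)%E.
  by move=> n _; rewrite /= lee_fin.
have DC := @dominated_convergence _ _ _ mu J mJ (fun n => EFin \o q n) (EFin \o h) _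
  (fun n => proj2 (measurable_EFinP _ _) (mq n)) (proj2 (measurable_EFinP _ _) mh).
have [_ _ H] := DC _ ltac:(by apply: aeW) dom ltac:(by apply: aeW).
have : (fun _ : nat => K%:E) @ \oo --> (\int[mu]_(x in J) (h x)%:E)%E.
  rewrite (_ : (fun _ : nat => _) = (fun n => \int[mu]_(x in J) (q n x)%:E)%E)//.
  by apply/funext => n; rewrite E.
move=> /cvg_lim; rewrite lim_cst// => /(_ (@ereal_hausdorff _)) HK.
by rewrite /Rintegral -HK.
Qed.

End component_green.

Section rep.
Context {R : realType}.
Local Notation mu := (@lebesgue_measure R).
Implicit Types (f g h F G P : R -> R) (J : set R).

(** [F] is an absolutely continuous representative of [f] on [J], with derivative [g].  The derivative
    is extended by zero outside of [J], so that [F] is defined on the whole line and its values at the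
    end points of [J] are the boundary values of [f]. *)
Definition ac_rep J f g F := primitive (g \_ J) F /\ {ae mu, forall x, J x -> f x = F x}.

Lemma realL2_mul J f g : measurable J -> realL2 mu J f -> realL2 mu J g ->
  mu.-integrable J (EFin \o (fun x => f x * g x)).
Proof.
move=> mJ f2 g2; have /Lfun1_integrable H := Lfun2_mul_Lfun1 f2 g2.
rewrite integrable_mkcond//; apply: eq_integrable H => // x _.
by rewrite /= /patch; case: ifP; rewrite //= mulr0.
Qed.

Lemma realL2_measurable J f : measurable J -> realL2 mu J f -> measurable_fun J f.
Proof. by move=> mJ /Lfun_measurable; rewrite -measurable_restrictT. Qed.

Lemma integral_support (A B : set R) (q : R -> \bar R) : B `<=` A ->
  (forall x, A x -> ~ B x -> q x = 0%E) ->
  (\int[mu]_(x in A) q x = \int[mu]_(x in B) q x)%E.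
Proof.
move=> BA q0; rewrite [LHS]integral_mkcond [RHS]integral_mkcond.
apply: eq_integral => x _; rewrite /patch.
case: (boolP (x \in B)) => [/set_mem Bx|/negP nB].
  by rewrite mem_set//; exact: BA.
by case: ifPn => // /set_mem Ax; rewrite q0// => Bx; apply: nB; exact: mem_set.
Qed.

Variables (J : set R) (f1 g1 f2 g2 F1 F2 : R -> R).
Hypothesis mJ : measurable J.
Hypotheses (L1 : realL2 mu J f1) (K1 : realL2 mu J g1) (r1 : ac_rep J f1 g1 F1).
Hypotheses (L2 : realL2 mu J f2) (K2 : realL2 mu J g2) (r2 : ac_rep J f2 g2 F2).

(* [P] is the product that is to be differentiated, [h] its derivative. *)
Let P x := F1 x * F2 x.
Let h x := F1 x * (g2 \_ J) x + (g1 \_ J) x * F2 x.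

Let c1 : continuous F1.
Proof. exact: primitive_continuous (Lfun2_segment_integrable K1) r1.1. Qed.
Let c2 : continuous F2.
Proof. exact: primitive_continuous (Lfun2_segment_integrable K2) r2.1. Qed.
Let cP : continuous P.
Proof. by move=> x; apply: cvgM; [exact: c1|exact: c2]. Qed.
Let mF (F : R -> R) : continuous F -> measurable_fun setT F.
Proof. exact: continuous_measurable_fun. Qed.
Let mh : measurable_fun setT h.
Proof.
apply: measurable_funD; apply: measurable_funM; try exact: mF.
  exact: Lfun_measurable K2.
exact: Lfun_measurable K1.
Qed.

Let lh : segment_integrable h.
Proof.
have := segment_integrable_comb 1 1
  (segment_integrable_mul_continuous (Lfun2_segment_integrable K2) (Lfun_measurable K2) c1)
  (segment_integrable_mul_continuous (Lfun2_segment_integrable K1) (Lfun_measurable K1) c2).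
by congr segment_integrable; apply/funext => x; rewrite /h !mul1r [F2 x * _]mulrC.
Qed.

Let hP : primitive h P.
Proof.
move=> a b ab; rewrite -(Green_formula (Lfun2_segment_integrable K1) (Lfun_measurable K1)
  (Lfun2_segment_integrable K2) (Lfun_measurable K2) r1.1 r2.1 ab)//.
Qed.

Let ff : ae_eq mu J P (fun x => f1 x * f2 x).
Proof.
have FF := ae_filter_ringOfSetsType mu.
by apply: filterS2 r1.2 r2.2 => x e1 e2 Jx; rewrite /P e1// e2.
Qed.

Let hh : ae_eq mu J h (fun x => f1 x * g2 x + g1 x * f2 x).
Proof.
have FF := ae_filter_ringOfSetsType mu.
by apply: filterS2 r1.2 r2.2 => x e1 e2 Jx; rewrite /h e1// e2// !patchE mem_set.
Qed.

Let iP : mu.-integrable J (EFin \o P).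
Proof.
apply: ae_integrable ff _ => //; last exact: realL2_mul.
by apply: measurable_funTS; exact: mF.
Qed.

Let ih : mu.-integrable J (EFin \o h).
Proof.
apply: ae_integrable hh _ => //; first exact: measurable_funTS.
have := integrable_comb 1 1 mJ (realL2_mul mJ L1 K2) (realL2_mul mJ K1 L2).
by apply: eq_integrable => // x _; rewrite /= !mul1r.
Qed.

Let Ih : \int[mu]_(x in J) (f1 x * g2 x + g1 x * f2 x) = \int[mu]_(x in J) h x.
Proof.
apply/esym/ae_Rintegral => //; first exact: measurable_funTS.
by apply: measurable_funD; apply: measurable_funM; exact: realL2_measurable.
Qed.

Let GreenP eta a b : smooth eta -> a <= b ->
  \int[mu]_(x in `[a, b]) (P x * derive1 eta x + h x * eta x) = P b * eta b - P a * eta a.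
Proof.
move=> se ab; have ce := smooth_continuous (smooth_derive1 se).
apply: (Green_formula lh mh (continuous_segment_integrable ce) (mF ce) hP (smooth_primitive se) ab).
Qed.

Lemma Green_bounded a b : a < b -> J = `]a, b[%classic ->
  \int[mu]_(x in J) (f1 x * g2 x + g1 x * f2 x) = F1 b * F2 b - F1 a * F2 a.
Proof.
move=> ab JE; rewrite Ih -[RHS]/(P b - P a) (hP (ltW ab)) JE.
rewrite Rintegral_itv_bndo_bndc; last by rewrite -JE; exact: ih.
rewrite Rintegral_itv_obnd_cbnd//.
by apply: integrableS (lh a b) => //; exact: subset_itv_oc_cc.
Qed.

(** There is no boundary term at infinity.  The product [P] is integrable on [J], so multiplying it by
    a cut-off that is 1 up to distance [n] from [c] and 0 from distance [n + 1] on, and letting [n] tend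
    to infinity, removes that term ([cutoff_limit]). *)
Lemma Green_half_line (c : R) (right : bool) :
  J = (if right then `]c, +oo[%classic else `]-oo, c[%classic) ->
  \int[mu]_(x in J) (f1 x * g2 x + g1 x * f2 x) =
    if right then - (F1 c * F2 c) else F1 c * F2 c.
Proof.
move=> JE; rewrite Ih.
have [B [M [sB B0 B1 B01 [dBM dB0]]]] := @smooth_step_derive R.
have dM r x : `|derive1 (step_at B r 1) x| <= M.
  by rewrite derive_step_at// invr1 mul1r.
have sr r : smooth (step_at B r 1) by exact: smooth_step_at.
have dout (r x : R) : x < r \/ r + 1 < x -> derive1 (step_at B r 1) x = 0.
  rewrite derive_step_at// invr1 !mul1r.
  by have [->//|/dB0] := eqVneq (derive1 B (x - r)) 0; lra.
have mq eta : smooth eta -> measurable_fun J (fun x => P x * derive1 eta x + h x * eta x).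
  move=> se; apply: measurable_funTS; apply: measurable_funD; apply: measurable_funM => //.
  - exact: mF.
  - by apply: mF; apply: smooth_continuous; exact: smooth_derive1.
  - by apply: mF; exact: smooth_continuous.
case: right JE => JE.
- pose eta n : R -> R := fun x => cst 1 x - step_at B (c + n%:R) 1 x.
  have seta n : smooth (eta n) by exact: smoothB (@smooth_cst R 1) (sr _).
  have deta n x : derive1 (eta n) x = - derive1 (step_at B (c + n%:R) 1) x.
    apply: is_derive_derive1; have := is_deriveB (is_derive_cst (1 : R) x (1 : R))
      (smooth_is_derive (@sr (c + n%:R)) x).
    by rewrite sub0r.
  apply: (@cutoff_limit _ J h P eta M) => //.
  + by move=> n x; rewrite /eta/= ler_norml;
      have := B01 (1^-1 * x + - (1^-1 * (c + n%:R))); rewrite -/(step_at B _ _ _); lra.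
  + by move=> n x; rewrite deta normrN.
  + move=> x _; near=> n.
    have xn : x < c + n%:R by rewrite -ltrBlDl; near: n; exact: nbhs_infty_gtr.
    rewrite deta /eta/= step_at0 ?subr0 ?ltW//; split=> //.
    by rewrite dout ?oppr0//; left.
  move=> n; transitivity (\int[mu]_(x in `[c, c + n%:R + 1]) (P x * derive1 (eta n) x + h x * eta n x)).
    rewrite JE /Rintegral integral_itv_obnd_cbnd -?JE;
      last exact: (proj2 (measurable_EFinP _ _) (mq _ (seta n))).
    congr fine; apply: (@integral_support `[c, +oo[%classic `[c, c + n%:R + 1]%classic) => x /=;
      rewrite !in_itv/= ?andbT; first by case/andP.
    move=> cx /negP; rewrite cx/= -ltNge => xn; rewrite deta dout; last by right.
    by rewrite /eta/= step_at1// ?(ltW xn)// subrr oppr0 !mulr0 addr0.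
  rewrite (GreenP (seta n)); last by rewrite -addrA lerDl addr_ge0.
  by rewrite /eta/= step_at1// step_at0// ?lerDl// subrr subr0 mulr0 mulr1 sub0r.
- pose eta n : R -> R := step_at B (c - n%:R - 1) 1.
  have seta n : smooth (eta n) by exact: sr.
  apply: (@cutoff_limit _ J h P eta M) => //.
  + by move=> n x; rewrite /eta ler_norml;
      have := B01 (1^-1 * x + - (1^-1 * (c - n%:R - 1))); rewrite -/(step_at B _ _ _); lra.
  + by move=> n x; exact: dM.
  + move=> x _; near=> n.
    have xn : c - x < n%:R by near: n; exact: nbhs_infty_gtr.
    rewrite /eta/= step_at1//; last by lra.
    by split=> //; rewrite dout//; right; lra.
  move=> n; transitivity (\int[mu]_(x in `[c - n%:R - 1, c]) (P x * derive1 (eta n) x + h x * eta n x)).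
    rewrite JE /Rintegral integral_itv_bndo_bndc -?JE;
      last exact: (proj2 (measurable_EFinP _ _) (mq _ (seta n))).
    congr fine; apply: (@integral_support `]-oo, c]%classic `[c - n%:R - 1, c]%classic) => x /=;
      rewrite !in_itv/=; first by case/andP.
    move=> xc /negP; rewrite xc andbT -ltNge => xn; rewrite dout; last by left.
    by rewrite /eta/= step_at0// ?(ltW xn)// !mulr0 addr0.
  rewrite (GreenP (seta n)); last by have := ler0n R n; lra.
  have n0 := ler0n R n.
  rewrite /eta step_at1//; last by lra.
  by rewrite step_at0// mulr1 mulr0 subr0.
Unshelve. all: by end_near. Qed.
End rep.

(** * Linear algebra over the complex numbers *)

Section linear_algebra.
Local Open Scope complex_scope.
Local Open Scope quotient_scope.
Context {R : realType}.
Local Notation C := R[i].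

(** Take a matrix of maximal rank among those whose rows lie in [L]. *)
Lemma rowspace_of_subspace N (L : set 'rV[C]_N) : L 0 ->
  (forall a u v, L u -> L v -> L (a *: u + v)) ->
  exists M : 'M[C]_N, forall v, L v <-> (v <= M)%MS.
Proof.
move=> L0 Llin.
have Lsum m (M : 'M[C]_(m, N)) (u : 'rV_m) : (forall i, L (row i M)) -> L (u *m M).
  move=> LM; rewrite mulmx_sum_row; elim/big_ind: _ => //.
  - by move=> x y Lx Ly; have := Llin 1 _ _ Lx Ly; rewrite scale1r.
  - by move=> i _; have := Llin (u 0 i) _ _ (LM i) L0; rewrite addr0.
pose P r := `[< exists M : 'M[C]_N, (forall i, L (row i M)) /\ \rank M = r >].
have exP : exists r, P r.
  exists 0%N; apply/asboolP; exists 0; rewrite mxrank0; split=> // i.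
  by rewrite row0.
have boundP r : P r -> (r <= N)%N.
  by move=> /asboolP[M [_ <-]]; exact: rank_leq_row.
have [r /asboolP[M [LM rM]] rmax] := ex_maxnP exP boundP.
exists M => v; split=> [Lv|/submxP[u ->]]; last exact: Lsum.
have : (\rank (M + v)%MS <= r)%N.
  apply: rmax; apply/asboolP; exists (M + v)%MS; split=> // i.
  have /sub_addsmxP[[u1 u2] /= ->] := row_sub i (M + v)%MS.
  have := Llin 1 _ _ (Lsum _ _ u1 LM) (Lsum _ v u2 _); rewrite scale1r; apply.
  by move=> j; rewrite row_id.
rewrite -rM => le.
have HM : (M + v <= M)%MS.
  by rewrite -(geq_leqif (mxrank_leqif_sup (addsmxSl M v))).
exact: submx_trans (addsmxSr M v) HM.
Qed.

(** The orthogonal of a subspace of dimension [r] for a nondegenerate form has dimension [N - r]. *)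
Lemma self_orthogonal_even N (d : 'rV[C]_N) (L : set 'rV[C]_N) :
  (forall i, d 0 i != 0) -> L 0 ->
  (forall a u v, L u -> L v -> L (a *: u + v)) ->
  (forall v, L v <-> forall u, L u -> \sum_i d 0 i * u 0 i * Num.conj (v 0 i) = 0) ->
  ~~ odd N.
Proof.
move=> d0 L0 Llin Lperp.
have [M LM] := rowspace_of_subspace L0 Llin.
pose K := map_mx Num.conj (kermx (M *m diag_mx d)^T).
have conjK n m (A : 'M[C]_(n, m)) : map_mx Num.conj (map_mx Num.conj A) = A.
  by apply/matrixP => i j; rewrite !mxE conjCK.
have EL (v : 'rV_N) : (v <= M)%MS = (v <= K)%MS.
  apply/idP/idP => [vM|H].
    have /Lperp H := (LM v).2 vM.
    rewrite -[v]conjK map_submx; apply/sub_kermxP.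
    apply/rowP => k; rewrite mul_mx_diag !mxE.
    have /H : L (row k M) by apply: (LM _).2; exact: row_sub.
    move=> E; rewrite -[RHS]E.
    by apply: eq_bigr => i _; rewrite !mxE mulrC [d 0 i * _]mulrC.
  apply: (LM v).1; apply: (Lperp v).2 => u Lu; have /submxP[w ->] := (LM u).1 Lu.
  move: H; rewrite -[v in (v <= _)%MS]conjK map_submx => /sub_kermxP H.
  transitivity ((map_mx Num.conj v *m (M *m diag_mx d)^T *m w^T) 0 0); last first.
    by rewrite H mul0mx mxE.
  rewrite -mulmxA -trmx_mul mxE; apply: eq_bigr => i _; rewrite mxE mulrC; congr (_ * _).
    by rewrite mxE.
  by rewrite mulmxA mul_mx_diag !mxE mulrC.
have rD : \rank (M *m diag_mx d) = \rank M.
  apply: mxrankMfree; rewrite row_free_unit unitmxE det_diag unitfE.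
  by apply/prodf_neq0 => i _.
have rMK : \rank M = \rank K.
  apply/eqP; rewrite eqn_leq; apply/andP; split; apply: mxrankS; apply/row_subP => i.
    by rewrite -EL row_sub.
  by rewrite EL row_sub.
have : \rank K = (N - \rank M)%N by rewrite /K mxrank_map mxrank_ker mxrank_tr rD.
rewrite -rMK => H.
have -> : N = (\rank M).*2.
  by rewrite -addnn {1}H subnK// rank_leq_row.
by rewrite odd_double.
Qed.

(** Such a [G] would satisfy [G *m G^* = 1%:M], of rank [m] bigger than the rank of [G]. *)
Lemma no_orthonormal_rows m n (G : 'M[C]_(m, n)) : (n < m)%N ->
  ~ (forall j l, \sum_k G j k * Num.conj (G l k) = (j == l)%:R).
Proof.
move=> nm H; have E : G *m (map_mx Num.conj G)^T = 1%:M.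
  by apply/matrixP => j l; rewrite !mxE -H; apply: eq_bigr => k _; rewrite !mxE.
have := mxrankM_maxl G (map_mx Num.conj G)^T; rewrite E mxrank1.
by move=> /leq_trans/(_ (rank_leq_col G)); rewrite leqNgt nm.
Qed.
End linear_algebra.

Section traces.
Local Open Scope complex_scope.
Local Open Scope quotient_scope.
Context {R : realType} (H : lmodType R[i]) (dot : {dot H for Num.conj}).
Local Notation C := R[i].

(** [G u w z] is meant to say that [u] lies in the domain of the maximal operator, that this operator
    maps it to [w], and that [z] is its trace.  By Green's formula a vector with trace [z] satisfies the
    condition that defines the adjoint of [A] exactly when [z] is orthogonal to the traces of the domain
    of [A]; since [A] is its own adjoint, these traces are their own orthogonal. *)
Lemma self_adjoint_traces_even (A : linop H) N (d : 'rV[C]_N) (kappa : C)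
    (G : H -> H -> 'rV[C]_N -> Prop) :
  self_adjoint dot A -> kappa != 0 -> (forall i, d 0 i != 0) ->
  (forall u, dom A u -> exists z, G u (A u) z) ->
  (forall z, exists u w, G u w z) ->
  (forall u w z u' w' z', G u w z -> G u' w' z' ->
     dot w u' - dot u w' = kappa * \sum_i d 0 i * z 0 i * Num.conj (z' 0 i)) ->
  (forall a u w z u' w' z', G u w z -> G u' w' z' ->
     G (a *: u + u') (a *: w + w') (a *: z + z')) ->
  ~~ odd N.
Proof.
move=> [_ sa] k0 d0 trA trE green lin.
pose L z := exists u, dom A u /\ G u (A u) z.
apply: (@self_orthogonal_even R N d L) => //.
- have [z Gz] := trA _ (dom0 A); exists (-1 *: 0 + 0).
  have [d00 ->] := linopP (-1) (dom0 A) (dom0 A); split=> //.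
  have -> : 0 = -1 *: z + z by rewrite scaleN1r addNr.
  exact: lin.
- move=> a z z' [u [du Gu]] [u' [du' Gu']]; exists (a *: u + u').
  by have [d1 ->] := linopP a du du'; split=> //; exact: lin.
move=> v; split=> [[u [du Gu]] z [u' [du' Gu']]|Hv].
  have ad : adjoint_graph dot A u (A u) by apply/sa.
  have := green _ _ _ _ _ _ Gu' Gu; rewrite ad// subrr => /esym/eqP.
  by rewrite mulf_eq0 (negbTE k0)/= => /eqP.
have [e [w Gv]] := trE v.
have /sa[de Ae] : adjoint_graph dot A e w.
  move=> u du; have [z Gz] := trA _ du.
  apply/eqP; rewrite -subr_eq0 (green _ _ _ _ _ _ Gz Gv) Hv ?mulr0//.
  by exists u.
by exists e; rewrite Ae.
Qed.
End traces.

(** * Disjoint intervals with one half-line *)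

Section ac_rep_linear.
Context {R : realType}.
Local Notation mu := (@lebesgue_measure R).
Implicit Types (f g F : R -> R) (J : set R).

Lemma Rintegral_comb J (a b : R) f g : measurable J ->
  mu.-integrable J (EFin \o f) -> mu.-integrable J (EFin \o g) ->
  \int[mu]_(x in J) (a * f x + b * g x) =
  a * \int[mu]_(x in J) f x + b * \int[mu]_(x in J) g x.
Proof.
move=> mJ fi gi.
have Z c h : mu.-integrable J (EFin \o h) -> mu.-integrable J (EFin \o (fun x => c * h x)).
  by move=> hi; have := integrable_comb c 0 mJ hi hi; apply: eq_integrable => // x _ /=; rewrite mul0r addr0.
rewrite RintegralD; [|by []|exact: Z|exact: Z].
by congr (_ + _); rewrite RintegralZl.
Qed.

(** Representatives are insensitive to null sets, as they must be for elements of [L2R]. *)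
Lemma ac_rep_ae J f g f' g' F : measurable J ->
  realL2 mu J g -> realL2 mu J g' -> f = f' %[ae mu in J] -> g = g' %[ae mu in J] ->
  ac_rep J f g F -> ac_rep J f' g' F.
Proof.
move=> mJ mg mg' ff gg [pF fF].
have FF := ae_filter_ringOfSetsType mu; split.
  move=> a b ab; rewrite pF//; apply: ae_Rintegral => //.
  - exact: measurable_funTS (Lfun_measurable mg).
  - exact: measurable_funTS (Lfun_measurable mg').
  apply: filterS gg => x e _; rewrite /patch; case: ifP => // xJ; apply: e.
  exact: set_mem.
by apply: filterS2 ff fF => x e1 e2 Jx; rewrite -e1// e2.
Qed.

Lemma ac_rep_comb J (a b : R) f g F f' g' F' :
  realL2 mu J g -> realL2 mu J g' -> ac_rep J f g F -> ac_rep J f' g' F' ->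
  ac_rep J (fun x => a * f x + b * f' x) (fun x => a * g x + b * g' x)
    (fun x => a * F x + b * F' x).
Proof.
move=> lg lg' [p e] [p' e'].
have FF := ae_filter_ringOfSetsType mu; split.
  move=> u v uv; transitivity (a * (F v - F u) + b * (F' v - F' u)); first by ring.
  rewrite p// p'// -Rintegral_comb//.
  - apply: eq_Rintegral => x _; rewrite /patch; case: ifP => // _.
    by rewrite !mulr0 addr0.
  - exact: (Lfun2_segment_integrable lg).
  - exact: (Lfun2_segment_integrable lg').
by apply: filterS2 e e' => x e1 e2 Jx; rewrite e1// e2.
Qed.

Lemma realL2_sub A B f : measurable A -> measurable B -> A `<=` B ->
  realL2 mu B f -> realL2 mu A f.
Proof.
move=> mA mB AB f2; have i2 : mu.-integrable setT (EFin \o (fun x => (f \_ B) x ^+ 2)).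
  exact: Lfun2_integrable_sqr.
rewrite /realL2 inE; apply/andP; split.
  rewrite inE /=; have -> : f \_ A = (f \_ B) \_ A.
    apply/funext => x; rewrite /patch; case: ifPn => // xA.
    by rewrite mem_set//; apply: AB; exact: set_mem.
  apply/(measurable_restrictT _ _).1 => //; apply: measurable_funTS.
  exact: Lfun_measurable f2.
rewrite inE /= /finite_norm unlock poweR_lty//.
have /integrableP[_] := i2; apply: le_lt_trans.
apply: ge0_le_integral => //.
- by move=> x _; rewrite lee_fin powR_ge0.
- apply/measurable_EFinP; apply/(@measurableT_comp _ _ _ _ _ _ (fun x : R => x `^ 2)%R) => //.
  apply: measurableT_comp => //; have -> : f \_ A = (f \_ B) \_ A.
    apply/funext => x; rewrite /patch; case: ifPn => // xA.
    by rewrite mem_set//; apply: AB; exact: set_mem.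
  apply/(measurable_restrictT _ _).1 => //; apply: measurable_funTS.
  exact: Lfun_measurable f2.
- by apply: measurableT_comp => //; exact: (measurable_int mu i2).
move=> x _; rewrite /= powR_mulrn// lee_fin normrX ler_pXn2r ?nnegrE//.
rewrite /patch; case: ifPn => xA; last by rewrite normr0.
by rewrite mem_set//; apply: AB; exact: set_mem.
Qed.
End ac_rep_linear.

Section normal_form.
Context {R : realType}.
Local Notation mu := (@lebesgue_measure R).
Variables (m : nat) (a b : 'I_m -> R) (c : R) (right : bool).
Implicit Types (f g F : R -> R) (j : option 'I_m).

(** The index [None] stands for the half-line, which extends to the right or to the left. *)
Definition piece j : set R := match j with
  | Some k => `]a k, b k[%classic
  | None => if right then `]c, +oo[%classic else `]-oo, c[%classic
  end.

(** [Some (k, s)] is the right end point of the [k]-th bounded interval if [s], and the left one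
    otherwise; [None] is the end point of the half-line. *)
Definition endpoint : finType := option ('I_m * bool).
Definition ep_piece (p : endpoint) : option 'I_m := omap fst p.
Definition ep_pt (p : endpoint) : R := match p with
  | Some (k, s) => if s then b k else a k | None => c end.
Definition ep_top (p : endpoint) : bool := match p with
  | Some (k, s) => s | None => ~~ right end.
Definition ep_sign (p : endpoint) : R := if ep_top p then 1 else -1.

Hypothesis ab : forall k, a k < b k.
Hypothesis tpiece : trivIset setT piece.
Definition Om : set R := \bigcup_j piece j.

Lemma measurable_piece j : measurable (piece j).
Proof. by case: j => [k|] /=; first exact: measurable_itv; case: right. Qed.
Let mpiece := measurable_piece.

Lemma Om_big : Om = \big[setU/set0]_(j : option 'I_m) piece j.
Proof.
rewrite -bigcup_seq; apply/seteqP; split => x [j _ ?]; exists j => //=.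
exact: mem_index_enum.
Qed.

Lemma measurable_Om : measurable Om.
Proof. by rewrite Om_big; apply: bigsetU_measurable => j _; exact: mpiece. Qed.

Lemma piece_sub_Om j : piece j `<=` Om.
Proof. by move=> x jx; exists j. Qed.

Lemma Rintegral_Om f : mu.-integrable Om (EFin \o f) ->
  \int[mu]_(x in Om) f x = \sum_(j : option 'I_m) \int[mu]_(x in piece j) f x.
Proof.
move=> fi; rewrite /Rintegral Om_big integral_bigsetU_EFin//=.
- have -> : (\sum_j \int[mu]_(x in piece j) (f x)%:E)%E =
      (\sum_j (fine (\int[mu]_(x in piece j) (f x)%:E))%:E)%E.
    apply: eq_bigr => j _; rewrite fineK//; apply: integrable_fin_num; first exact: mpiece.
    by apply: integrableS fi; [exact: measurable_Om|exact: mpiece|exact: piece_sub_Om].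
  by rewrite sumEFin.
- exact: index_enum_uniq.
- by apply: sub_trivIset tpiece.
- rewrite -Om_big; exact: (measurable_int mu fi).
Qed.

Lemma Green_piece j f1 g1 F1 f2 g2 F2 :
  realL2 mu (piece j) f1 -> realL2 mu (piece j) g1 -> ac_rep (piece j) f1 g1 F1 ->
  realL2 mu (piece j) f2 -> realL2 mu (piece j) g2 -> ac_rep (piece j) f2 g2 F2 ->
  \int[mu]_(x in piece j) (f1 x * g2 x + g1 x * f2 x) =
  \sum_(p : endpoint | ep_piece p == j) ep_sign p * (F1 (ep_pt p) * F2 (ep_pt p)).
Proof.
move=> L1 K1 r1 L2 K2 r2; case: j L1 K1 r1 L2 K2 r2 => [k|] L1 K1 r1 L2 K2 r2.
  rewrite (Green_bounded (mpiece _) L1 K1 r1 L2 K2 r2 (ab k) erefl).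
  rewrite (bigD1 (Some (k, true)))//= (bigD1 (Some (k, false)))//=; last first.
    by rewrite eqxx; apply/eqP; case.
  rewrite big1; first by rewrite /ep_sign/=; ring.
  case=> [[k' s]|]//= /andP[/andP[/eqP[->]] + +]; by case: s; rewrite eqxx.
rewrite (Green_half_line (mpiece _) L1 K1 r1 L2 K2 r2 (c := c) (right := right) erefl).
rewrite (bigD1 None)//= big1; last by case.
by rewrite /ep_sign/=; case: right => /=; ring.
Qed.

(** The boundary terms at the end points of all intervals add up, with sign [+1] at right end points
    and [-1] at left end points. *)
Lemma Green_Om f1 g1 (F1 : option 'I_m -> R -> R) f2 g2 (F2 : option 'I_m -> R -> R) :
  realL2 mu Om f1 -> realL2 mu Om g1 -> (forall j, ac_rep (piece j) f1 g1 (F1 j)) ->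
  realL2 mu Om f2 -> realL2 mu Om g2 -> (forall j, ac_rep (piece j) f2 g2 (F2 j)) ->
  \int[mu]_(x in Om) (f1 x * g2 x + g1 x * f2 x) =
  \sum_(p : endpoint) ep_sign p *
    (F1 (ep_piece p) (ep_pt p) * F2 (ep_piece p) (ep_pt p)).
Proof.
move=> L1 K1 r1 L2 K2 r2.
have S f j : realL2 mu Om f -> realL2 mu (piece j) f.
  by apply: realL2_sub; [exact: mpiece|exact: measurable_Om|exact: piece_sub_Om].
rewrite Rintegral_Om; last first.
  have := integrable_comb 1 1 measurable_Om (realL2_mul measurable_Om L1 K2)
    (realL2_mul measurable_Om K1 L2).
  by apply: eq_integrable => [|x _]; [exact: measurable_Om|rewrite /= !mul1r].
rewrite [RHS](partition_big ep_piece predT)//=; apply: eq_bigr => j _.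
rewrite (Green_piece (S _ _ L1) (S _ _ K1) (r1 j) (S _ _ L2) (S _ _ K2) (r2 j)).
by apply: eq_bigr => p /eqP ->.
Qed.

Lemma odd_endpoint : odd #|endpoint|.
Proof. by rewrite card_option card_prod card_ord card_bool muln2 /= odd_double. Qed.
End normal_form.

(** * Boundary values and self-adjoint extensions *)

Section trace_relation.
Local Open Scope complex_scope.
Local Open Scope quotient_scope.
Context {R : realType}.
Local Notation mu := (@lebesgue_measure R).
Local Notation C := R[i].
Local Notation Re := (@complex.Re R).
Local Notation Im := (@complex.Im R).

Lemma Re_sum (I : finType) (F : I -> C) : Re (\sum_i F i) = \sum_i Re (F i).
Proof. by elim/big_rec2: _ => // i x y _ <-; case: (F i) => a b; case: y => p q. Qed.
Lemma Im_sum (I : finType) (F : I -> C) : Im (\sum_i F i) = \sum_i Im (F i).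
Proof. by elim/big_rec2: _ => // i x y _ <-; case: (F i) => a b; case: y => p q. Qed.

Section L2facts.
Variable D : set R.
Hypothesis mD : measurable D.

Lemma repr_realL2 (u : L2R D) : realL2 mu D (fun x => Re (repr u x)) /\
  realL2 mu D (fun x => Im (repr u x)).
Proof. by have /asboolP := valP (repr u). Qed.

Lemma realL2_scale (a : R) f : realL2 mu D f -> realL2 mu D (fun x => a * f x).
Proof.
move=> f2; have := realL2_comb a 0 f2 f2; congr realL2; apply/funext => x.
by rewrite mul0r addr0.
Qed.

Lemma realL2_mul_comb (a b : R) f g f' g' : realL2 mu D f -> realL2 mu D g ->
  realL2 mu D f' -> realL2 mu D g' ->
  \int[mu]_(x in D) (a * (f x * g x) + b * (f' x * g' x)) =
  a * \int[mu]_(x in D) (f x * g x) + b * \int[mu]_(x in D) (f' x * g' x).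
Proof. by move=> *; apply: Rintegral_comb => //; exact: realL2_mul. Qed.

Lemma dot_Re (u v : L2R D) : Re (dotL2R D u v) =
  \int[mu]_(x in D) (Re (repr u x) * Re (repr v x)) +
  \int[mu]_(x in D) (Im (repr u x) * Im (repr v x)).
Proof.
have [u1 u2] := repr_realL2 u; have [v1 v2] := repr_realL2 v.
rewrite -[X in X + _]mul1r -[X in _ + X]mul1r -realL2_mul_comb//=.
apply: eq_Rintegral => x _; case: (repr u x) (repr v x) => [p q] [r s] /=; ring.
Qed.

Lemma dot_Im (u v : L2R D) : Im (dotL2R D u v) =
  \int[mu]_(x in D) (Im (repr u x) * Re (repr v x)) -
  \int[mu]_(x in D) (Re (repr u x) * Im (repr v x)).
Proof.
have [u1 u2] := repr_realL2 u; have [v1 v2] := repr_realL2 v.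
rewrite -[X in X - _]mul1r -mulN1r -realL2_mul_comb//=.
apply: eq_Rintegral => x _; case: (repr u x) (repr v x) => [p q] [r s] /=; ring.
Qed.

Lemma repr_linear (z : C) (u v : L2R D) :
  {ae mu, forall x, D x -> repr (z *: u + v) x = z * repr u x + repr v x}.
Proof.
have -> : z *: u + v = \pi_(L2 mu D) (z *: repr u + repr v).
  by rewrite -{1}[u]reprK -{1}[v]reprK -pi_L2_linear.
exact: repr_pi_L2.
Qed.
End L2facts.

Variables (m : nat) (a b : 'I_m -> R) (c : R) (right : bool).
Hypothesis ab : forall k, a k < b k.
Hypothesis tpiece : trivIset setT (piece a b c right).
Local Notation Om := (Om a b c right).
Local Notation piece := (piece a b c right).
Local Notation H := (L2R Om).
Local Notation E := (endpoint m).
Local Notation pt := (ep_pt a b c).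
Let mOm : measurable Om := measurable_Om a b c right.
Let mpiece j : measurable (piece j) := measurable_piece a b c right j.

(** The equation [1 / (2 pi i) u' = w] means [(Re u)' = - 2 pi Im w] and [(Im u)' = 2 pi Re w]; on
    each interval [X j] and [Y j] are the absolutely continuous representatives of [Re u] and [Im u], and
    [z] collects their values at the end points. *)
Definition trace_rel (u w : H) (z : 'rV[C]_#|E|) : Prop :=
  exists X Y : option 'I_m -> R -> R,
  [/\ forall j, ac_rep (piece j) (fun x => Re (repr u x)) (fun x => - (2 * pi) * Im (repr w x)) (X j),
      forall j, ac_rep (piece j) (fun x => Im (repr u x)) (fun x => 2 * pi * Re (repr w x)) (Y j) &
      forall i, let p := enum_val i in
        z 0 i = X (ep_piece p) (pt p) +i* Y (ep_piece p) (pt p)].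

Definition trace_sign : 'rV[C]_#|E| := \row_i (@ep_sign R m right (enum_val i))%:C.

Lemma trace_sign_neq0 i : trace_sign 0 i != 0.
Proof.
rewrite mxE /ep_sign eq_complex /= eqxx andbT; case: ifP => _.
  by rewrite oner_eq0.
by rewrite oppr_eq0 oner_eq0.
Qed.

(** Green's formula for the real and imaginary parts; [0 -i* (2 * pi)^-1] is [1 / (2 pi i)]. *)
Lemma trace_green u w z u' w' z' : trace_rel u w z -> trace_rel u' w' z' ->
  dotL2R Om w u' - dotL2R Om u w' =
  (0 -i* (2 * pi)^-1) * \sum_i trace_sign 0 i * z 0 i * Num.conj (z' 0 i).
Proof.
move=> [X [Y [rX rY zE]]] [X' [Y' [rX' rY' zE']]].
have [u1 u2] := repr_realL2 u; have [u1' u2'] := repr_realL2 u'.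
have [w1 w2] := repr_realL2 w; have [w1' w2'] := repr_realL2 w'.
have p0 : 2 * pi != 0 :> R by rewrite mulf_neq0// gt_eqF// pi_gt0.
have sc (r : R) f (h : realL2 mu Om f) := realL2_scale r h.
have G1 := Green_Om ab tpiece u2 (sc _ _ w1) rY u1' (sc _ _ w2') rX'.
have G2 := Green_Om ab tpiece u1 (sc _ _ w2) rX u2' (sc _ _ w1') rY'.
have G3 := Green_Om ab tpiece u1 (sc _ _ w2) rX u1' (sc _ _ w2') rX'.
have G4 := Green_Om ab tpiece u2 (sc _ _ w1) rY u2' (sc _ _ w1') rY'.
have RI (r s : R) (f g f' g' : R -> R) : realL2 mu Om f -> realL2 mu Om g ->
  realL2 mu Om f' -> realL2 mu Om g' ->
  \int[mu]_(x in Om) (f x * (r * g x) + s * f' x * g' x) =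
  r * \int[mu]_(x in Om) (f x * g x) + s * \int[mu]_(x in Om) (f' x * g' x).
  move=> *; rewrite -realL2_mul_comb//; apply: eq_Rintegral => x _; ring.
move: G1 G2 G3 G4; rewrite !RI// => G1 G2 G3 G4.
have RE : Re (\sum_i trace_sign 0 i * z 0 i * Num.conj (z' 0 i)) =
  \sum_(p : E) ep_sign right p * (X (ep_piece p) (pt p) * X' (ep_piece p) (pt p)) +
  \sum_(p : E) ep_sign right p * (Y (ep_piece p) (pt p) * Y' (ep_piece p) (pt p)).
  rewrite Re_sum -big_split/= [RHS](reindex_onto enum_val enum_rank) ?enum_valK//=.
    by apply: eq_big => [i|i _]; rewrite ?enum_valK ?eqxx// zE zE' mxE /=; ring.
  by move=> p _; exact: enum_rankK.
have IM : Im (\sum_i trace_sign 0 i * z 0 i * Num.conj (z' 0 i)) =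
  \sum_(p : E) ep_sign right p * (Y (ep_piece p) (pt p) * X' (ep_piece p) (pt p)) -
  \sum_(p : E) ep_sign right p * (X (ep_piece p) (pt p) * Y' (ep_piece p) (pt p)).
  rewrite Im_sum -sumrB/= [RHS](reindex_onto enum_val enum_rank) ?enum_valK//=.
    by apply: eq_big => [i|i _]; rewrite ?enum_valK ?eqxx// zE zE' mxE /=; ring.
  by move=> p _; exact: enum_rankK.
move: RE IM; rewrite -G1 -G2 -G3 -G4.
have [r1 r2] := (dot_Re mOm w u', dot_Im mOm w u').
have [s1 s2] := (dot_Re mOm u w', dot_Im mOm u w').
move: (\sum_i _) (dotL2R _ _ _) (dotL2R _ _ _) r1 r2 s1 s2.
case=> [Sr Si] [dr di] [er ei] /= -> -> -> -> -> ->.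
move: (2 * pi) p0 => p p0.
by apply/eqP; rewrite eq_complex /=; apply/andP; split; apply/eqP;
  field; rewrite p0.
Qed.

Let S f j : realL2 mu Om f -> realL2 mu (piece j) f.
Proof. by apply: realL2_sub; [exact: mpiece|exact: mOm|exact: piece_sub_Om]. Qed.

Lemma trace_linear z u w t u' w' t' : trace_rel u w t -> trace_rel u' w' t' ->
  trace_rel (z *: u + u') (z *: w + w') (z *: t + t').
Proof.
move=> [X [Y [rX rY tE]]] [X' [Y' [rX' rY' tE']]].
have [u1 u2] := repr_realL2 u; have [u1' u2'] := repr_realL2 u'.
have [w1 w2] := repr_realL2 w; have [w1' w2'] := repr_realL2 w'.
have [v1 v2] := repr_realL2 (z *: w + w').
have FF := ae_filter_ringOfSetsType mu.
have sc (r : R) f (h : realL2 mu Om f) := realL2_scale r h.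
have aeu j : {ae mu, forall x, piece j x -> repr (z *: u + u') x = z * repr u x + repr u' x}.
  by apply: filterS (repr_linear z u u') => x h jx; apply: h; exists j.
have aew j : {ae mu, forall x, piece j x -> repr (z *: w + w') x = z * repr w x + repr w' x}.
  by apply: filterS (repr_linear z w w') => x h jx; apply: h; exists j.
exists (fun j x => 1 * (Re z * X j x + - Im z * Y j x) + 1 * X' j x),
  (fun j x => 1 * (Im z * X j x + Re z * Y j x) + 1 * Y' j x); split.
- move=> j; have L := ac_rep_comb 1 1 _ _ (ac_rep_comb (Re z) (- Im z)
    (S j (sc _ _ w2)) (S j (sc _ _ w1)) (rX j) (rY j)) (rX' j).
  apply: ac_rep_ae (L _ _) => //.
  + by apply: realL2_comb; [apply: realL2_comb|]; apply: S; exact: sc.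
  + by apply: S; exact: sc.
  + apply: filterS (aeu j) => x h /h ->.
    by case: (repr u x) (repr u' x) (z) => [p q] [r s] [e f] /=; ring.
  + apply: filterS (aew j) => x h /h ->.
    by case: (repr w x) (repr w' x) (z) => [p q] [r s] [e f] /=; ring.
  + by apply: realL2_comb; apply: S; exact: sc.
  + by apply: S; exact: sc.
- move=> j; have L := ac_rep_comb 1 1 _ _ (ac_rep_comb (Im z) (Re z)
    (S j (sc _ _ w2)) (S j (sc _ _ w1)) (rX j) (rY j)) (rY' j).
  apply: ac_rep_ae (L _ _) => //.
  + by apply: realL2_comb; [apply: realL2_comb|]; apply: S; exact: sc.
  + by apply: S; exact: sc.
  + apply: filterS (aeu j) => x h /h ->.
    by case: (repr u x) (repr u' x) (z) => [p q] [r s] [e f] /=; ring.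
  + apply: filterS (aew j) => x h /h ->.
    by case: (repr w x) (repr w' x) (z) => [p q] [r s] [e f] /=; ring.
  + by apply: realL2_comb; apply: S; exact: sc.
  + by apply: S; exact: sc.
- move=> i; rewrite !mxE tE tE' /=; case: (z) => p q /=.
  by apply/eqP; rewrite eq_complex /=; apply/andP; split; apply/eqP; ring.
Qed.

End trace_relation.

Section traces_of_domain.
Local Open Scope complex_scope.
Local Open Scope quotient_scope.
Context {R : realType}.
Local Notation mu := (@lebesgue_measure R).
Local Notation C := R[i].
Local Notation Re := (@complex.Re R).
Local Notation Im := (@complex.Im R).
Variables (m : nat) (a b : 'I_m -> R) (c : R) (right : bool).
Hypothesis ab : forall k, a k < b k.
Local Notation Om := (Om a b c right).
Local Notation piece := (piece a b c right).
Local Notation H := (L2R Om).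
Local Notation E := (endpoint m).
Local Notation pt := (ep_pt a b c).
Let mOm : measurable Om := measurable_Om a b c right.
Let mpiece j : measurable (piece j) := measurable_piece a b c right j.
Let S j f : realL2 mu Om f -> realL2 mu (piece j) f.
Proof. by apply: realL2_sub; [exact: mpiece|exact: mOm|exact: piece_sub_Om]. Qed.

Lemma piece_open j : open (piece j).
Proof. by case: j => [k|] /=; first exact: interval_open; case: right; exact: interval_open. Qed.

Lemma piece_nonempty j : piece j !=set0.
Proof.
case: j => [k|] /=.
  by exists ((a k + b k) / 2); rewrite /= in_itv/=; have := ab k; lra.
by case: right; [exists (c + 1)|exists (c - 1)]; rewrite /= in_itv/=; lra.
Qed.

Lemma piece_interval j : is_interval (piece j).
Proof. by case: j => [k|] /=; first exact: interval_is_interval; case: right; exact: interval_is_interval. Qed.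

Lemma real_test_function (D : set R) (phi : R -> R) (p q : R) : smooth phi ->
  `[p, q]%classic `<=` D -> (forall x, ~~ (p <= x <= q) -> phi x = 0) ->
  test_function D (fun x => (phi x)%:C).
Proof.
move=> sphi pqD supp.
have sub : closure [set x | (phi x)%:C != 0] `<=` `[p, q]%classic.
  rewrite [X in _ `<=` X](closure_id _).1; last exact: interval_closed.
  apply: closureS => x /=; apply: contra_neqT; rewrite in_itv/= => /supp ->.
  by [].
split.
- exact: sphi.
- by apply: smooth_cst.
- apply: subclosed_compact sub; first exact: closed_closure.
  exact: segment_compact.
- exact: subset_trans sub pqD.
Qed.

Lemma dot_toL2 (D : set R) (f : R -> C) (u : L2R D) : f \in sqint mu D ->
  dotL2R D (toL2 mu D f) u = Cintegral mu D (fun x => f x * Num.conj (repr u x)).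
Proof.
move=> hf; rewrite -{1}[u]reprK /= dotL2_pi; congr Cintegral.
by apply/funext => x; rewrite insubdK.
Qed.

(** Since [A] is symmetric and extends [D], the function [u] satisfies [D u = A u] in the sense of
    distributions; real test functions are enough to read this off for the real and imaginary parts, and
    [weak_derivative_primitive] applies on each interval. *)
Lemma trace_of_domain (A : linop H) u : self_adjoint (dotL2R Om) A -> extends_D A ->
  dom A u -> exists z, trace_rel u (A u) z.
Proof.
move=> [_ sa] ext du.
have adj : adjoint_graph (dotL2R Om) A u (A u) by apply/sa.
have [u1 u2] := repr_realL2 u; have [w1 w2] := repr_realL2 (A u).
have p0 : 2 * pi != 0 :> R by rewrite mulf_neq0// gt_eqF// pi_gt0.
(* Split [<D phi, u> = <phi, A u>] into real and imaginary parts. *)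
have weak (phi : R -> R) p q j : smooth phi -> piece j p -> piece j q ->
    (forall x, ~~ (p <= x <= q) -> phi x = 0) ->
    \int[mu]_(x in Om) (derive1 phi x * Re (repr u x)) =
      - (\int[mu]_(x in Om) (phi x * (- (2 * pi) * Im (repr (A u) x)))) /\
    \int[mu]_(x in Om) (derive1 phi x * Im (repr u x)) =
      - (\int[mu]_(x in Om) (phi x * (2 * pi * Re (repr (A u) x)))).
  move=> sphi jp jq supp.
  have tf : test_function Om (fun x => (phi x)%:C).
    apply: (real_test_function sphi _ supp) => x /=; rewrite in_itv/= => xpq.
    by exists j => //; exact: (piece_interval jp jq xpq).
  have [dphi Aphi] := ext _ tf.
  have := adj _ dphi; rewrite Aphi !dot_toL2; last 2 first.
  - exact: test_function_sqint tf.
  - exact: test_function_sqint (Dexpr_test_function tf).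
  have DE x : Dexpr (fun x => (phi x)%:C) x = 0 +i* (- (2 * pi)^-1 * derive1 phi x).
    rewrite DexprE /=; congr (_ +i* _); rewrite (_ : derive1 _ x = 0) ?mulr0//.
    by rewrite derive1E derive_cst.
  rewrite /Cintegral => /eqP; rewrite eq_complex => /andP[/eqP /= HR /eqP /= HI].
  have /asboolP[phi1 _] := test_function_sqint tf.
  have /asboolP[_ dphi2] := test_function_sqint (Dexpr_test_function tf).
  have {}dphi2 : realL2 mu Om (derive1 phi).
    have := realL2_scale (- (2 * pi)) dphi2; congr realL2; apply/funext => x.
    rewrite DE /=; move: (2 * pi) p0 => t t0; by field.
  have Z r (f g : R -> R) : realL2 mu Om f -> realL2 mu Om g ->
      \int[mu]_(x in Om) (r * f x * g x) = r * \int[mu]_(x in Om) (f x * g x).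
    move=> lf lg; have := realL2_mul_comb mOm r 0 lf lg lf lg; rewrite mul0r addr0 => <-.
    by apply: eq_Rintegral => x _; rewrite mul0r addr0 mulrA.
  have Z' r (f g : R -> R) : realL2 mu Om f -> realL2 mu Om g ->
      \int[mu]_(x in Om) (f x * (r * g x)) = r * \int[mu]_(x in Om) (f x * g x).
    move=> lf lg; rewrite -Z//; apply: eq_Rintegral => x _; ring.
  rewrite !Z'//; split.
  - have : \int[mu]_(x in Om) (- (2 * pi)^-1 * derive1 phi x * Re (repr u x)) =
        \int[mu]_(x in Om) (-1 * phi x * Im (repr (A u) x)).
      transitivity (\int[mu]_(x in Om) Im (Dexpr (fun x => (phi x)%:C) x * Num.conj (repr u x))).
        by apply: eq_Rintegral => x _; rewrite DE; case: (repr u x) => r s /=; ring.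
      rewrite HI; apply: eq_Rintegral => x _; case: (repr (A u) x) => r s /=; ring.
    rewrite !Z// => /(congr1 (fun x => - (2 * pi) * x)).
    by rewrite mulrA mulrNN divff// !mul1r => ->; ring.
  - have : \int[mu]_(x in Om) (- (2 * pi)^-1 * derive1 phi x * Im (repr u x)) =
        \int[mu]_(x in Om) (1 * phi x * Re (repr (A u) x)).
      transitivity (\int[mu]_(x in Om) Re (Dexpr (fun x => (phi x)%:C) x * Num.conj (repr u x))).
        by apply: eq_Rintegral => x _; rewrite DE; case: (repr u x) => r s /=; ring.
      rewrite HR; apply: eq_Rintegral => x _; case: (repr (A u) x) => r s /=; ring.
    rewrite !Z// => /(congr1 (fun x => - (2 * pi) * x)).
    by rewrite mulrA mulrNN divff// !mul1r => ->; ring.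
have supp_int (f h : R -> R) p q j : piece j p -> piece j q ->
   (forall x, ~~ (p <= x <= q) -> h x = 0) ->
   \int[mu]_(x in Om) (h x * f x) = \int[mu]_(x in `[p, q]) (h x * (f \_ (piece j)) x).
  move=> jp jq supp; transitivity (\int[mu]_(x in `[p, q]) (h x * f x)).
    congr fine; apply: (@integral_support _ Om `[p, q]%classic) => x /=; rewrite in_itv/= => xpq.
      by exists j => //; exact: (piece_interval jp jq xpq).
    by move=> /negP/supp ->; rewrite mul0r.
  apply: eq_Rintegral => x; rewrite inE/= in_itv/= => xpq.
  by rewrite /patch mem_set//; exact: (piece_interval jp jq xpq).
have dsupp (phi : R -> R) p q x : smooth phi -> (forall x, ~~ (p <= x <= q) -> phi x = 0) ->
   ~~ (p <= x <= q) -> derive1 phi x = 0.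
  move=> sphi supp; rewrite negb_and -!ltNge => xpq; apply: is_derive_derive1.
  apply: near_eq_is_derive (is_derive_cst (0 : R) x (1 : R)).
  case/orP: xpq => [xp|qx]; near=> y; apply/esym/supp; rewrite negb_and -!ltNge; apply/orP.
    by left; near: y; exact: lt_nbhsl.
  by right; near: y; exact: lt_nbhsr.
have sc (r : R) f (h : realL2 mu Om f) := realL2_scale r h.
have ex (f g : R -> R) j : realL2 mu Om f -> realL2 mu Om g ->
    (forall phi p q, smooth phi -> piece j p -> piece j q ->
      (forall x, ~~ (p <= x <= q) -> phi x = 0) ->
      \int[mu]_(x in Om) (derive1 phi x * f x) = - \int[mu]_(x in Om) (phi x * g x)) ->
    exists F, ac_rep (piece j) f g F.
  move=> lf lg W.
  have [phi p q sphi jp jq supp|F pF eF] := weak_derivative_primitive (@piece_open j)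
    (piece_nonempty j) (S j lf) (S j lg).
    rewrite -(supp_int _ _ p q j)//; last by move=> x; exact: dsupp.
    rewrite -(supp_int _ _ p q j)//; exact: (W phi p q).
  exists F; split=> //.
  have FF := ae_filter_ringOfSetsType mu; apply: filterS eF => x + jx.
  by move=> /(_ jx); rewrite /patch mem_set.
have exX j : exists F, ac_rep (piece j) (fun x => Re (repr u x)) (fun x => - (2 * pi) * Im (repr (A u) x)) F.
  by apply: ex => //; [exact: sc|move=> phi p q sphi jp jq supp; exact: (weak phi p q j _ _ _ _).1].
have exY j : exists F, ac_rep (piece j) (fun x => Im (repr u x)) (fun x => 2 * pi * Re (repr (A u) x)) F.
  by apply: ex => //; [exact: sc|move=> phi p q sphi jp jq supp; exact: (weak phi p q j _ _ _ _).2].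
have [X HX] := choice exX; have [Y HY] := choice exY.
exists (\row_i let p := enum_val i in X (ep_piece p) (pt p) +i* Y (ep_piece p) (pt p)).
by exists X, Y; split=> // i; rewrite mxE.
Unshelve. all: by end_near. Qed.
End traces_of_domain.

Section realizing_traces.
Local Open Scope complex_scope.
Local Open Scope quotient_scope.
Context {R : realType}.
Local Notation mu := (@lebesgue_measure R).
Local Notation C := R[i].
Local Notation Re := (@complex.Re R).
Local Notation Im := (@complex.Im R).
Variables (m : nat) (a b : 'I_m -> R) (c : R) (right : bool).
Hypothesis ab : forall k, a k < b k.
Hypothesis tpiece : trivIset setT (piece a b c right).
Local Notation Om := (Om a b c right).
Local Notation piece := (piece a b c right).
Local Notation H := (L2R Om).
Local Notation E := (endpoint m).
Local Notation pt := (ep_pt a b c).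
Let mOm : measurable Om := measurable_Om a b c right.
Let mpiece j : measurable (piece j) := measurable_piece a b c right j.

(** A smooth function which, on the interval of [p], is 1 at [p], 0 at the other end point if there is
    one, and 0 far away if the interval is a half-line.  It is a smooth step or 1 minus a smooth step,
    according to the side on which [p] lies; [lo] and [len] place the rise inside the interval. *)
Lemma cutoff_at (p : E) : exists2 th : R -> R, smooth th &
  [/\ forall x, `|th x| <= 1, exists M, forall x, `|derive1 th x| <= M,
      forall x, derive1 th x != 0 -> piece (ep_piece p) x,
      forall q : E, ep_piece q = ep_piece p -> th (pt q) = (p == q)%:R &
      exists lo hi, forall x, piece (ep_piece p) x -> ~~ (lo <= x <= hi) -> th x = 0].
Proof.
have [B [M [sB B0 B1 B01 [dBM dB0]]]] := @smooth_step_derive R.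
pose lo j := if j is Some k then a k + (b k - a k) / 3 else if right then c + 1 else c - 2.
pose len j := if j is Some k then (b k - a k) / 3 else 1.
have len0 j : 0 < len j.
  by case: j => [k|] //=; rewrite divr_gt0// subr_gt0.
pose j := ep_piece p; pose T := step_at B (lo j) (len j).
have sT : smooth T by exact: smooth_step_at.
have T01 x : 0 <= T x <= 1 by exact: B01.
have dT x : derive1 T x != 0 -> piece j x.
  rewrite derive_step_at// mulf_eq0 negb_or => /andP[_ /dB0].
  have := len0 j; rewrite mulrC !ler_pdivrMr ?ler_pdivlMr// mul0r mul1r => l0 /andP[x0 x1].
  move: x0 x1 l0; rewrite /len/lo/j; case: (ep_piece p) => [k|] /=; rewrite ?in_itv/=.
    move=> *; lra.
  by case: right; rewrite /= in_itv/=; lra.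
have dTM x : `|derive1 T x| <= (len j)^-1 * M.
  by rewrite derive_step_at// normrM gtr0_norm ?invr_gt0// ler_wpM2l// invr_ge0 ltW.
have T0 x : x <= lo j -> T x = 0 by move=> ?; exact: step_at0.
have T1 x : lo j + len j <= x -> T x = 1 by move=> ?; exact: step_at1.
have bnd (q : E) : ep_piece q = j -> exists lo' hi', forall x, piece j x ->
    ~~ (lo' <= x <= hi') -> if ep_top right q then T x = 0 else T x = 1.
  move=> qj; move: T0 T1; rewrite -qj; case: q {qj} => [[k s]|] /= T0 T1.
    by exists (a k), (b k) => x; rewrite in_itv/= => /andP[/ltW-> /ltW->].
  case: right T0 T1 => /= T0 T1.
    exists c, (c + 2) => x; rewrite in_itv/= andbT => /ltW ->/=; rewrite -ltNge => ?.
    by apply: T1; lra.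
  exists (c - 2), c => x; rewrite in_itv/= => /ltW ->; rewrite andbT -ltNge => ?.
  by apply: T0; lra.
have Tpt (q : E) : ep_piece q = j -> T (pt q) = (ep_top right q)%:R.
  move=> qj; move: T0 T1; rewrite -qj; case: q {qj} => [[k [] ]|] /= T0 T1.
  - by rewrite T1//; have := ab k; lra.
  - by rewrite T0//; have := ab k; lra.
  - by case: right T0 T1 => /= T0 T1; [rewrite T0|rewrite T1] => //; lra.
have topE (q : E) : ep_piece q = j -> (p == q) = (ep_top right q == ep_top right p).
  rewrite /j {bnd Tpt dT T j T0 T1 sT T01 dTM}; case: p q => [[k s]|] [[k' s']|] //=.
    by move=> [->]; apply/eqP/eqP => [[->]|->].
  by move=> _; rewrite !eqxx.
have {}bnd := bnd p erefl.
case: (boolP (ep_top right p)) bnd => tp [lo' [hi' bnd]].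
  exists T => //; split=> //.
  - by move=> x; rewrite ler_norml; have := T01 x; lra.
  - by exists ((len j)^-1 * M).
  - by move=> q qj; rewrite Tpt// topE// tp eqb_id.
  - by exists lo', hi'.
have sT' : smooth (fun x => cst 1 x - T x) by exact: smoothB (@smooth_cst R 1) sT.
have dT' x : derive1 (fun x => cst 1 x - T x) x = - derive1 T x.
  apply: is_derive_derive1; have := is_deriveB (is_derive_cst (1 : R) x (1 : R))
    (smooth_is_derive sT x).
  by rewrite sub0r.
exists (fun x => cst 1 x - T x) => //; split.
- by move=> x; rewrite /= ler_norml; have := T01 x; lra.
- by exists ((len j)^-1 * M) => x; rewrite dT' normrN.
- by move=> x; rewrite dT' oppr_eq0; exact: dT.
- move=> q qj; rewrite /= Tpt// topE// (negbTE tp) eqbF_neg.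
  by case: (ep_top _ _); rewrite ?subrr ?subr0.
- by exists lo', hi' => x cx /(bnd _ cx) /= ->; rewrite subrr.
Qed.

(** The cut-off at [p], restricted to the interval of [p], has a trace with a single nonzero entry. *)
Lemma trace_basis (p : E) : exists u w : H,
  trace_rel u w (\row_i (enum_val i == p)%:R).
Proof.
have [th sth [th1 [M dthM] dthJ thpt [lo [hi thsupp]]]] := cutoff_at p.
pose j := ep_piece p.
have p0 : 2 * pi != 0 :> R by rewrite mulf_neq0// gt_eqF// pi_gt0.
pose f := th \_ (piece j). pose g := derive1 th \_ (piece j).
have gE : g = derive1 th.
  apply/funext => x; rewrite /g /patch; case: ifPn => // /negP xJ.
  by apply/esym/eqP; apply: contra_notT xJ => /dthJ ?; exact: mem_set.
have fO : f \_ Om = f.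
  apply/funext => x; rewrite /f /patch; case: ifPn => // xO; case: ifPn => // xj.
  by move: xO; rewrite mem_set//; exists j => //; exact: set_mem.
have gO : g \_ Om = g.
  apply/funext => x; rewrite /g /patch; case: ifPn => // xO; case: ifPn => // xj.
  by move: xO; rewrite mem_set//; exists j => //; exact: set_mem.
have mth : measurable_fun setT th.
  by apply: continuous_measurable_fun; exact: smooth_continuous.
have mdth : measurable_fun setT (derive1 th).
  by apply: continuous_measurable_fun; apply: smooth_continuous; exact: smooth_derive1.
have lf : realL2 mu Om f.
  rewrite /realL2 fO; apply: (@bounded_Lfun2 _ f lo hi 1).
  - by apply/(measurable_restrictT _ _).1; [exact: mpiece|exact: measurable_funTS].
  - by move=> x; rewrite /f /patch; case: ifP => // _; rewrite normr0.
  - by move=> x nx; rewrite /f /patch; case: ifPn => // /set_mem jx; exact: thsupp.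
have lg : realL2 mu Om g.
  rewrite /realL2 gO; apply: (@bounded_Lfun2 _ g lo hi M).
  - by rewrite gE.
  - by rewrite gE.
  - move=> x nx; rewrite /g /patch; case: ifPn => // /set_mem jx.
    apply: is_derive_derive1; apply: near_eq_is_derive (is_derive_cst (0 : R) x (1 : R)).
    have nn : \forall y \near x, ~~ (lo <= y <= hi).
      move: nx; rewrite negb_and -!ltNge => /orP[xl|xh]; near=> y; rewrite negb_and -!ltNge; apply/orP.
        by left; near: y; exact: lt_nbhsl.
      by right; near: y; exact: lt_nbhsr.
    near=> y; apply/esym/thsupp; last by near: y; exact: nn.
    by near: y; apply: open_nbhs_nbhs; split=> //; exact: piece_open.
have l0 : realL2 mu Om (fun=> 0) by exact: realL2_0.
pose fu x : C := (f x)%:C; pose fw x : C := 0 +i* (- (2 * pi)^-1 * g x).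
have uL : fu \in sqint mu Om by apply/asboolP; split.
have wL : fw \in sqint mu Om by apply/asboolP; split => //=; exact: realL2_scale.
exists (toL2 mu Om fu), (toL2 mu Om fw).
have [w1 w2] := repr_realL2 (toL2 mu Om fw).
have aeu i : {ae mu, forall x, piece i x -> repr (toL2 mu Om fu) x = fu x}.
  have FF := ae_filter_ringOfSetsType mu.
  have uE : {ae mu, forall x, Om x -> repr (toL2 mu Om fu) x = fu x} := toL2P uL.
  by apply: filterS uE => x h ix; apply: h; exists i.
have aew i : {ae mu, forall x, piece i x -> repr (toL2 mu Om fw) x = fw x}.
  have FF := ae_filter_ringOfSetsType mu.
  have wE : {ae mu, forall x, Om x -> repr (toL2 mu Om fw) x = fw x} := toL2P wL.
  by apply: filterS wE => x h ix; apply: h; exists i.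
have FF := ae_filter_ringOfSetsType mu.
have S i h : realL2 mu Om h -> realL2 mu (piece i) h.
  by apply: realL2_sub; [exact: mpiece|exact: mOm|exact: piece_sub_Om].
have rep0 i : ac_rep (piece i) (fun=> 0 : R) (fun=> 0) (fun=> 0).
  split; last by apply: aeW.
  move=> u v uv; rewrite subrr; apply/esym.
  transitivity (\int[mu]_(x in `[u, v]) (0 : R)); last by rewrite /Rintegral integral0.
  by apply: eq_Rintegral => x _; rewrite /patch; case: ifP.
have repf i : ac_rep (piece i) f g (if i == j then th else fun=> 0).
  case: eqVneq => [->|ij]; last first.
    have [pp ee] := rep0 i.
    have off x (k : R -> R) : piece i x -> (k \_ (piece j)) x = 0.
      move=> ix; rewrite /patch; case: ifPn => // /set_mem jx.
      by move: ij; rewrite (tpiece (i := i) (j := j) I I) ?eqxx//; exists x.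
    split; last by apply: aeW => x ix; rewrite /f off.
    move=> u v uv; rewrite (pp u v uv); apply: eq_Rintegral => x _.
    by rewrite /patch; case: ifPn => // /set_mem ix; apply/esym/off.
  split; last by apply: aeW => x jx; rewrite /f /patch mem_set.
  have -> : g \_ (piece j) = derive1 th.
    apply/funext => x; rewrite patchE; case: ifPn => xj; first by rewrite gE.
    by rewrite -gE /g patchE (negbTE xj).
  exact: smooth_primitive.
exists (fun i => if i == j then th else fun=> 0), (fun _ _ => 0); split.
- move=> i; apply: ac_rep_ae (repf i) => //.
  + exact: S.
  + by apply: S; exact: realL2_scale.
  + by apply: filterS (aeu i) => x h /h ->.
  + apply: filterS (aew i) => x h /h -> /=.
    by rewrite mulrA mulrNN divff// mul1r.
- move=> i; apply: ac_rep_ae (rep0 i) => //.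
  + exact: S.
  + by apply: S; exact: realL2_scale.
  + by apply: filterS (aeu i) => x h /h ->.
  + by apply: filterS (aew i) => x h /h -> /=; rewrite mulr0.
move=> i /=; rewrite mxE; set q := enum_val i.
case: (eqVneq (ep_piece q) j) => [qj|qj].
  by rewrite thpt// eq_sym; case: (_ == _).
by case: (eqVneq q p) qj => [->|//]; rewrite eqxx.
Unshelve. all: by end_near. Qed.

Lemma trace_exists z : exists u w : H, trace_rel u w z.
Proof.
have lin := @trace_linear R m a b c right.
have [u0 [w0 t0]] := trace_basis None.
rewrite [z]row_sum_delta; elim/big_ind: _.
- exists (-1 *: u0 + u0), (-1 *: w0 + w0).
  have -> : 0 = -1 *: (\row_i (enum_val i == None)%:R) + \row_i (enum_val i == None :> E)%:R :> 'rV[C]_#|E|.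
    by rewrite scaleN1r addNr.
  exact: lin.
- move=> x y [u [w t]] [u' [w' t']]; exists (1 *: u + u'), (1 *: w + w').
  by rewrite -[x]scale1r; exact: lin.
move=> i _; have [u [w t]] := trace_basis (enum_val i).
have [u' [w' t']] : exists u w : H, trace_rel u w (0 : 'rV[C]_#|E|).
  exists (-1 *: u0 + u0), (-1 *: w0 + w0).
  have -> : 0 = -1 *: (\row_i (enum_val i == None)%:R) + \row_i (enum_val i == None :> E)%:R :> 'rV[C]_#|E|.
    by rewrite scaleN1r addNr.
  exact: lin.
exists (z 0 i *: u + u'), (z 0 i *: w + w').
rewrite -[z 0 i *: delta_mx _ _]addr0 (_ : delta_mx 0 i = \row_k (enum_val k == enum_val i)%:R).
  exact: lin.
by apply/rowP => k; rewrite !mxE eqxx/= (inj_eq enum_val_inj).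
Qed.

(** The number of end points is odd. *)
Lemma no_self_adjoint_extension :
  ~ (exists A : linop H, self_adjoint (dotL2R Om) A /\ extends_D A).
Proof.
move=> [A [sa ext]].
have := @self_adjoint_traces_even R H (dotL2R Om) A #|E| (trace_sign m right) (0 -i* (2 * pi)^-1)
  (@trace_rel R m a b c right) sa.
have -> /= : (0 -i* (2 * pi)^-1 != 0 :> C) = true.
  rewrite eq_complex /= eqxx/= oppr_eq0 invr_eq0.
  by rewrite mulf_neq0// gt_eqF// pi_gt0.
move=> /(_ isT) H1; have := odd_endpoint m.
apply/negP; apply: H1.
- exact: trace_sign_neq0.
- by move=> u du; exact: trace_of_domain.
- exact: trace_exists.
- by move=> *; exact: trace_green.
- by move=> *; exact: trace_linear.
Qed.
End realizing_traces.

(** * Square integrable functions up to null sets *)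

Section L2_ae.
Local Open Scope complex_scope.
Local Open Scope quotient_scope.
Context {R : realType}.
Local Notation mu := (@lebesgue_measure R).
Local Notation C := R[i].
Local Notation Re := (@complex.Re R).
Local Notation Im := (@complex.Im R).
Variable D : set R.
Hypothesis mD : measurable D.

Lemma L2_ext (u v : L2R D) : {ae mu, forall x, D x -> repr u x = repr v x} -> u = v.
Proof. by move=> uv; rewrite -[u]reprK -[v]reprK; apply/pi_L2_eq. Qed.

Lemma mul_conj_measurable (u v : L2R D) :
  measurable_fun D (fun x => Re (repr u x * Num.conj (repr v x))) /\
  measurable_fun D (fun x => Im (repr u x * Num.conj (repr v x))).
Proof.
have [/(realL2_measurable mD) u1 /(realL2_measurable mD) u2] := repr_realL2 u.
have [/(realL2_measurable mD) v1 /(realL2_measurable mD) v2] := repr_realL2 v.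
split.
- rewrite (_ : (fun x => _) = fun x => Re (repr u x) * Re (repr v x) + Im (repr u x) * Im (repr v x)).
    by apply: measurable_funD; apply: measurable_funM.
  by apply/funext => x; case: (repr u x) (repr v x) => [p q] [r s] /=; ring.
- rewrite (_ : (fun x => _) = fun x => Im (repr u x) * Re (repr v x) - Re (repr u x) * Im (repr v x)).
    by apply: measurable_funB; apply: measurable_funM.
  by apply/funext => x; case: (repr u x) (repr v x) => [p q] [r s] /=; ring.
Qed.

Lemma dot_ae (u v u' v' : L2R D) :
  {ae mu, forall x, D x -> repr u x * Num.conj (repr v x) = repr u' x * Num.conj (repr v' x)} ->
  dotL2R D u v = dotL2R D u' v'.
Proof.
move=> uv; have FF := ae_filter_ringOfSetsType mu.
have [m1 m2] := mul_conj_measurable u v; have [m1' m2'] := mul_conj_measurable u' v'.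
rewrite /= /dotL2 /Cintegral; congr (_ +i* _); apply: ae_Rintegral => //;
  by apply: filterS uv => x h /h ->.
Qed.

Lemma repr0 : {ae mu, forall x, D x -> repr (0 : L2R D) x = 0}.
Proof. by have := repr_pi_L2 (0 : sqfun mu D); rewrite pi_L20. Qed.

Lemma dot_ae0 (u v : L2R D) :
  {ae mu, forall x, D x -> repr u x * Num.conj (repr v x) = 0} -> dotL2R D u v = 0.
Proof.
move=> uv; have FF := ae_filter_ringOfSetsType mu.
rewrite -[RHS](linear0l (dotL2R D) v) -[RHS]/(dotL2R D 0 v); apply: dot_ae.
by apply: filterS2 uv repr0 => x h1 h2 Dx; rewrite h1// h2// mul0r.
Qed.

(** Multiplication by an indicator, on classes of functions. *)
Lemma restrict_L2 (u : L2R D) (Z : set R) : measurable Z ->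
  exists v : L2R D, {ae mu, forall x, D x -> repr v x = if x \in Z then repr u x else 0}.
Proof.
move=> mZ; have [u1 u2] := repr_realL2 u.
have r f : realL2 mu D f -> realL2 mu D (f \_ Z).
  move=> lf; have : realL2 mu (D `&` Z) f.
    by apply: realL2_sub lf; [exact: measurableI|exact: mD|exact: subIsetl].
  rewrite /realL2 (_ : f \_ (D `&` Z) = (f \_ Z) \_ D)//.
  by apply/funext => x; rewrite /patch in_setI; case: (x \in D); case: (x \in Z).
pose f x : C := if x \in Z then repr u x else 0.
exists (toL2 mu D f); apply: toL2P; apply/asboolP; split.
- by have := r _ u1; congr realL2; apply/funext => x; rewrite /f /patch; case: ifP.
- by have := r _ u2; congr realL2; apply/funext => x; rewrite /f /patch; case: ifP.
Qed.

Lemma dot_self_eq0 (u : L2R D) : dotL2R D u u = 0 -> u = 0.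
Proof. by move=> /eqP; rewrite dnorm_eq0 => /eqP. Qed.

Lemma indicator_L2 (I : set R) (p q : R) : measurable I -> I `<=` `[p, q] ->
  (fun x => (\1_I x)%:C) \in sqint mu D.
Proof.
move=> mI Ipq; apply/asboolP; split => /=; last exact: realL2_0.
have : realL2 mu setT (\1_I : R -> R).
  rewrite /realL2 (_ : (\1_I : R -> R) \_ setT = (\1_I : R -> R)); last first.
    by apply/funext => x; rewrite /patch mem_setT.
  apply: (@bounded_Lfun2 _ _ p q 1).
  - exact: measurable_indic.
  - by move=> x; rewrite indicE; case: (_ \in _); rewrite ?normr1 ?normr0.
  - move=> x nx; rewrite indicE memNset// => /Ipq; rewrite /= in_itv/=.
    exact/negP.
by apply: realL2_sub => //; exact: measurableT.
Qed.

Lemma ae_neq_point (p : R) : {ae mu, forall x, x != p}.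
Proof.
exists [set p]; split; [by []|exact: lebesgue_measure_set1|].
by move=> x /= /negP; rewrite negbK => /eqP.
Qed.
End L2_ae.

Lemma ae_and {R : realType} (P Q : R -> Prop) : {ae lebesgue_measure, forall y, P y} ->
  {ae lebesgue_measure, forall y, Q y} -> {ae lebesgue_measure, forall y, P y /\ Q y}.
Proof. by have FF := ae_filter_ringOfSetsType (@lebesgue_measure R); apply: filterS2. Qed.

Section lebesgue_ball.
Context {R : realType}.
Local Notation mu := (@lebesgue_measure R).

(** Lebesgue differentiation for balls of radius [r], with the length [2 r] multiplied out. *)
Lemma lebesgue_pt_average (f : R -> R) (y : R) : mu.-integrable setT (EFin \o f) ->
  lebesgue_pt f y -> forall e, 0 < e -> exists2 d, 0 < d & forall r, 0 < r < d ->
    `|\int[mu]_(x in ball y r) f x - 2 * r * f y| <= e * r.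
Proof.
move=> fi fy e e0; have [d d0 Hd] := near_lebesgue_pt fy e0.
exists d => // r /andP[r0 rd].
have mf : measurable_fun setT f by apply/measurable_EFinP; exact: (measurable_int mu fi).
have mb : measurable (ball y r) by exact: measurable_ball.
have fb : mu.-integrable (ball y r) (EFin \o f) by apply: integrableS fi.
have i1 : mu.-integrable (ball y r) (EFin \o (fun=> 1 : R)).
  rewrite ball_itv; apply: integrableS (@segment_integrable_cst R 1 (y - r) (y + r)) => //.
  exact: subset_itv_oo_cc.
have -> : \int[mu]_(x in ball y r) f x - 2 * r * f y =
    \int[mu]_(x in ball y r) (1 * f x + - f y * 1).
  have E : fine (mu (ball y r)) = 2 * r.
    by rewrite lebesgue_measure_ball ?(ltW r0)//= mulr_natl.
  rewrite Rintegral_comb// Rintegral_cst// -[fine _]/(fine (mu (ball y r))) E; ring.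
rewrite -lee_fin; apply: le_trans (Hd r _); last by rewrite r0.
apply: norm_Rintegral_le => //.
- exact: integrable_comb.
- apply: measurableT_comp => //; apply: measurable_funB => //; exact: measurable_funTS.
- by move=> x bx; left; split=> //; rewrite mul1r mulr1.
Qed.
End lebesgue_ball.

(** * Unitary groups that act by local translations *)

Lemma common_lower_bound (R : realType) m (d : 'I_m -> R) : (forall k, 0 < d k) ->
  exists2 e, 0 < e & forall k, e < d k.
Proof.
move=> d0; have S0 : 0 <= \sum_k (d k)^-1 by apply: sumr_ge0 => k _; rewrite invr_ge0 ltW.
exists ((1 + \sum_k (d k)^-1)^-1) => [|k]; first by rewrite invr_gt0; lra.
rewrite -[ltRHS]invrK ltf_pV2 ?posrE ?invr_gt0//; last by lra.
have : (d k)^-1 <= \sum_k (d k)^-1.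
  by rewrite (bigD1 k)//= lerDl; apply: sumr_ge0 => i _; rewrite invr_ge0 ltW.
lra.
Qed.

Section translation_group.
Local Open Scope complex_scope.
Local Open Scope quotient_scope.
Context {R : realType}.
Local Notation mu := (@lebesgue_measure R).
Local Notation C := R[i].
Local Notation Re := (@complex.Re R).
Local Notation Im := (@complex.Im R).
Variables (m : nat) (a b : 'I_m -> R) (c : R) (right : bool).
Hypothesis tpiece : trivIset setT (piece a b c right).
Local Notation Om := (Om a b c right).
Local Notation piece := (piece a b c right).
Local Notation H := (L2R Om).
Local Notation dot := (dotL2R Om).
Variable U : R -> H -> H.
Hypothesis U0 : U 0 = id.
Hypothesis UD : forall s t, U (s + t) = U s \o U t.
Hypothesis Uint : integrability_property U.
Hypothesis Uiso : forall v f g, dot (U v f) (U v g) = dot f g.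
Hypothesis Ulin : forall v, linear (U v).
Let mOm : measurable Om := measurable_Om a b c right.
Let mpiece j : measurable (piece j) := measurable_piece a b c right j.

Lemma piece_between j x y z : piece j x -> piece j y ->
  (x <= z <= y) || (y <= z <= x) -> piece j z.
Proof. by move=> jx jy /orP[]; exact: piece_interval. Qed.

(** The points [y] such that [y] and [y + v] stay in [piece j] when they are moved by at most [d]. *)
Definition margin j (d v : R) : set R := [set y | [/\ piece j (y - d), piece j (y + d),
  piece j (y + v - d) & piece j (y + v + d)]].

Lemma margin_open j d v : open (margin j d v).
Proof.
have oc e : open [set y | piece j (y + e)].
  apply: (open_comp (f := fun y => y + e)) (piece_open (j := j)) => x _.
  by apply: cvgD; [exact: cvg_id|exact: cvg_cst].
rewrite (_ : margin j d v = [set y | piece j (y + - d)] `&` [set y | piece j (y + d)] `&`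
  ([set y | piece j (y + (v - d))] `&` [set y | piece j (y + (v + d))])).
  by apply: openI; apply: openI; exact: oc.
by apply/seteqP; split => y /=; rewrite !addrA => -[]; [move=> *; split|move=> [? ?] [? ?]].
Qed.

(** The integrability property describes only small translations; a translation by [w *+ n] is
    composed of [n] translations by [w], during which the point stays between [y] and [y + w *+ n]. *)
Lemma shift_steps h j d w n : 0 < d -> `|w| < d ->
  {ae mu, forall y, margin j d (w *+ n) y -> repr (U (w *+ n) h) y = repr h (y + w *+ n)}.
Proof.
move=> d0 wd; have FF := ae_filter_ringOfSetsType mu.
elim: n => [|n IH]; first by apply: aeW => y _; rewrite mulr0n U0 addr0.
have [V0|/set0P[x Vx]] := eqVneq (margin j d (w *+ n.+1)) set0.
  by rewrite V0; apply: aeW.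
have sub t y : `|t| < d -> margin j d (w *+ n.+1) y -> piece j (y + t).
  move=> td [y1 y2 _ _]; apply: piece_between y1 y2 _.
  by move: td; rewrite ltr_norml => /andP[? ?]; apply/orP; left; lra.
have sub0 y : margin j d (w *+ n.+1) y -> piece j y.
  by move=> Vy; have := @sub 0 y; rewrite normr0 addr0; apply.
have := Uint (x := x) (V := margin j d (w *+ n.+1)) (e := d) _ _ _ d0 _ wd (U (w *+ n) h).
have Ox : Om x by exists j => //; exact: sub0.
have nV : nbhs x (margin j d (w *+ n.+1)).
  by apply: open_nbhs_nbhs; split=> //; exact: margin_open.
have VO : margin j d (w *+ n.+1) `<=` Om by move=> y Vy; exists j => //; exact: sub0.
move=> /(_ Ox nV VO); have VtO t : `|t| < d -> forall y, margin j d (w *+ n.+1) y -> Om (y + t).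
  by move=> td y Vy; exists j => //; exact: sub.
move=> /(_ VtO) H1; have H2 := ae_shift w IH.
apply: filterS2 H1 H2 => y H1 H2 Vy.
rewrite mulrS UD/= H1// H2; first by rewrite addrA.
have [v1 v2 v3 v4] := Vy; rewrite mulrS in v3 v4.
have le1 : (y <= y + w <= y + (w + w *+ n)) || (y + (w + w *+ n) <= y + w <= y).
  have [w0|w0] := leP 0 w.
    have := mulrn_wge0 n w0 => wn; apply/orP; left; lra.
  have := mulrn_wle0 n (ltW w0) => wn; apply/orP; right; lra.
split.
- apply: (piece_between v1 v3); lra.
- apply: (piece_between v2 v4); lra.
- by rewrite -(addrA y).
- by rewrite -(addrA y).
Qed.

Definition joined v y := exists j, piece j y /\ piece j (y + v).

(** Each such [y] lies in [margin j d v] for [d] small enough, and it suffices to let [d] run through a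
    sequence that tends to 0. *)
Lemma shift_property v h : {ae mu, forall y, joined v y -> repr (U v h) y = repr h (y + v)}.
Proof.
have FF := ae_filter_ringOfSetsType mu.
have ajd (j : option 'I_m) (k : nat) : {ae mu, forall y, margin j k.+1%:R^-1 v y ->
    repr (U v h) y = repr h (y + v)}.
  pose d : R := k.+1%:R^-1; have d0 : 0 < d by rewrite invr_gt0.
  (* Enough steps for each to be shorter than [d]. *)
  pose N := (Num.truncn (`|v| / d)).+1.
  have Nv : `|v| / d < N%:R by exact: truncnS_gt.
  have wd : `|v / N%:R| < d.
    by rewrite normrM normfV normr_nat ltr_pdivrMr// mulrC -ltr_pdivrMr.
  have := shift_steps h j N d0 wd; rewrite -[_ *+ N]mulr_natr divfK//.
  by rewrite pnatr_eq0.
have := @filter_forall R (option 'I_m) _ (almost_everywhere mu) FF (fun j => ae_foralln (ajd j)).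
apply: filterS => y /= Hy [j [jy jyv]].
have nb z (s : R) : piece j z -> \forall e \near (0 : R), piece j (z + s * e).
  move=> jz; have nz : nbhs z (piece j) by apply: open_nbhs_nbhs; split => //; exact: piece_open.
  have cz : continuous (fun e : R => z + s * e).
    move=> e; apply: cvgD; first exact: cvg_cst.
    by apply: cvgM; [exact: cvg_cst|exact: cvg_id].
  by have := cz 0; rewrite /continuous_at mulr0 addr0; apply.
have : \forall e \near (0 : R), margin j e v y.
  near=> e; rewrite -[e]mul1r; split; rewrite -?mulNr; near: e; exact: nb.
move=> /nbhs_ballP[r /= r0 Hr].
pose k := Num.truncn r^-1.
have kr : k.+1%:R^-1 < r by rewrite -ltf_pV2 ?posrE ?invr_gt0// invrK truncnS_gt.
by apply: (Hy j k); apply: Hr; rewrite /ball/= sub0r normrN gtr0_norm// invr_gt0.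
Unshelve. all: by end_near. Qed.

(** [U (dir * s)] with [0 <= s] translates functions towards the end point of the half-line, and hence
    out of each interval through its end point [exit_end].  What enters does so through the end points
    [entry_end]: the half-line has none. *)
Definition dir : R := if right then 1 else -1.
Definition exit_end (j : option 'I_m) : R :=
  if j is Some k then if right then a k else b k else c.
Definition entry_end (k : 'I_m) : R := if right then b k else a k.

Lemma piece_inj j j' y : piece j y -> piece j' y -> j = j'.
Proof. by move=> jy j'y; apply: tpiece => //; exists y. Qed.

(** The points at distance at most [s] from an entry end.  Elsewhere the values of [U (dir * s) f] are
    values of [f] ([joined_outside_tail]). *)
Definition tail (s : R) : set R :=
  \bigcup_k (piece (Some k) `&` [set y | dir * (entry_end k - y) <= s]).

Lemma measurable_tail s : measurable (tail s).
Proof.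
apply: fin_bigcup_measurable; first exact: finite_finset.
move=> k _; apply: measurableI; first exact: mpiece.
rewrite (_ : [set y | _] = (if right then `[entry_end k - s, +oo[ else `]-oo, entry_end k + s])%classic).
  by case: right.
by apply/seteqP; split => y; rewrite /dir; case: right => /=; rewrite in_itv/= ?andbT; lra.
Qed.

Lemma joined_outside_tail s y : 0 <= s -> Om y -> ~ tail s y -> joined (dir * s) y.
Proof.
move=> s0 [j _ jy] nT; exists j; split=> //.
case: j jy => [k|] jy.
  have : ~~ (dir * (entry_end k - y) <= s) by apply/negP => ?; apply: nT; exists k.
  move: jy; rewrite /dir/entry_end/=; case: right; rewrite !in_itv/= -ltNge; lra.
by move: jy; rewrite /dir/=; case: right; rewrite /= !in_itv/=; lra.
Qed.

Lemma joined_not_tail s y : joined (dir * s) y -> ~ tail s y.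
Proof.
move=> [j [jy jys]] [k _ [ky /= ks]]; have jk := piece_inj jy ky; subst j.
by move: jys ks; rewrite /dir/entry_end/=; case: right; rewrite !in_itv/=; lra.
Qed.

(** If the support [A] of [f] can move by [s] without meeting an end point, then all of [f] arrives at
    the translate of [A], and nothing is left that could enter elsewhere.  Indeed let [psi] be the part
    of [U (dir * s) f] in the tail.  Pulled back by the group, [psi] vanishes on [A], because the translate
    of [A] does not meet the tail; so [psi] is orthogonal to [U (dir * s) f], that is, to itself. *)
Lemma support_transport (f : H) (A : set R) s : 0 <= s ->
  {ae mu, forall y, Om y -> ~ A y -> repr f y = 0} ->
  (forall y, A y -> joined (- (dir * s)) y) ->
  {ae mu, forall y, Om y -> ~ A (y + dir * s) -> repr (U (dir * s) f) y = 0}.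
Proof.
have FF := ae_filter_ringOfSetsType mu.
move=> s0 fA Aj; set v := dir * s; set g := U v f.
have [psi Hpsi] := restrict_L2 mOm g (measurable_tail s).
have Uf := shift_property v f.
have Upsi := shift_property (- v) psi.
have d0 : dot g psi = 0.
  have -> : psi = U v (U (- v) psi) by rewrite -[RHS]/((U v \o U (- v)) psi) -UD subrr U0.
  rewrite Uiso; apply: dot_ae0; first exact: mOm.
  have Hpsi' := ae_shift (- v) Hpsi.
  apply: filterS3 fA Upsi Hpsi' => y h1 h2 h3 Oy.
  have [Ay|nAy] := pselect (A y); last by rewrite h1// mul0r.
  have jy := Aj _ Ay; have [j [jy1 jy2]] := jy.
  rewrite h2// h3; last by exists j.
  have nT : ~ tail s (y - v) by apply: joined_not_tail; exists j; rewrite subrK.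
  by rewrite memNset// conjC0 mulr0.
have /dot_self_eq0 psi0 : dot psi psi = 0.
  rewrite -d0; apply: dot_ae; first exact: mOm.
  apply: filterS Hpsi => y h Oy; rewrite h//; case: ifP => // _.
  by rewrite conjC0 !mulr0.
have fA' := ae_shift v fA; have r0 := @repr0 R Om.
have gT : {ae mu, forall y, Om y -> tail s y -> repr g y = 0}.
  rewrite psi0 in Hpsi; apply: filterS2 r0 Hpsi => y h3 h4 Oy Ty.
  by have := h4 Oy; rewrite h3// mem_set.
apply: filterS3 Uf fA' gT => y h1 h2 h3 Oy nA.
have [Ty|nT] := pselect (tail s y); first exact: h3.
have [j [jy jyv]] := joined_outside_tail s0 Oy nT.
rewrite /g h1; last by exists j.
by apply: h2 => //; exists j.
Qed.

Variable t : R.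
Hypothesis t_gt0 : 0 < t.
Hypothesis t_lt : forall k, t < b k - a k.

(** The points whose distance from the exit end of the interval [j] lies between [r] and [s]. *)
Definition block j (r s : R) : set R := [set y | r < dir * (y - exit_end j) < s].

Lemma block_itv j r s : block j r s = (if right then `]exit_end j + r, exit_end j + s[
  else `]exit_end j - s, exit_end j - r[)%classic.
Proof. by apply/seteqP; split => y; rewrite /block /dir/=; case: right => /=; rewrite in_itv/=; lra. Qed.

Lemma measurable_block j r s : measurable (block j r s).
Proof. by rewrite block_itv; case: right. Qed.

Lemma block_piece j r s y : 0 <= r -> s <= t -> block j r s y -> piece j y.
Proof.
move=> r0 st; rewrite block_itv; case: j => [k|] /=; first have := t_lt k;
  by case: right; rewrite /= !in_itv/=; lra.
Qed.

(** Where the contents of the blocks at distances between [r] and [s] from the exits will be at time [t],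
    namely at distances between [t - s] and [t - r] from the entries. *)
Definition window (r s : R) : set R :=
  [set y | exists k, t - s < dir * (entry_end k - y) <= t - r].

(** Up to time [r] the function stays inside the interval.  Between the times [r] and [s] it leaves, and
    at time [s] it can be found only at distance at most [s - r] from the entries.  From there it is
    translated until time [t]. *)
Lemma transport_block (f : H) j r s : 0 <= r -> r < s -> s <= t ->
  {ae mu, forall y, Om y -> ~ block j r s y -> repr f y = 0} ->
  {ae mu, forall y, Om y -> ~ window r s y -> repr (U (dir * t) f) y = 0}.
Proof.
move=> r0 rs st fA.
have UDD x y f' : U (dir * x) (U (dir * y) f') = U (dir * (x + y)) f'.
  by rewrite -[LHS]/((U (dir * x) \o U (dir * y)) f') -UD mulrDr.
have bs x y : dir * (y + dir * x - exit_end j) = dir * (y - exit_end j) + x.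
  by rewrite /dir; case: right; ring.
have FF := ae_filter_ringOfSetsType mu.
have A1 : {ae mu, forall y, Om y -> ~ block j 0 (s - r) y -> repr (U (dir * r) f) y = 0}.
  have Aj y : block j r s y -> joined (- (dir * r)) y.
    move=> By; exists j; split; first exact: block_piece By.
    apply: (@block_piece j 0 (s - r)) => //; first by lra.
    by move: By; rewrite /block /= -mulrN bs; lra.
  apply: filterS (support_transport r0 fA Aj) => y h Oy nB; apply: h => // By.
  by apply: nB; move: By; rewrite /block /= bs; lra.
set u0 := U (dir * r) f in A1.
have A2 : {ae mu, forall y, Om y -> ~ tail (s - r) y -> repr (U (dir * (s - r)) u0) y = 0}.
  have sr : 0 <= s - r by lra.
  have A1' := ae_shift (dir * (s - r)) A1.
  apply: filterS2 (shift_property (dir * (s - r)) u0) A1' => y h1 h2 Oy nT.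
  have [j' [jy jyv]] := joined_outside_tail sr Oy nT.
  rewrite h1; last by exists j'.
  apply: h2; first by exists j'.
  move=> By; have := block_piece (lexx 0) _ By => /(_ ltac:(lra)) jyv'.
  have jj := piece_inj jyv jyv'; subst j'.
  move: By jy; rewrite /block /= bs /dir; case: (j) => [k|] /=; case: right; rewrite /= !in_itv/=; lra.
set u1 := U (dir * (s - r)) u0 in A2.
have ts : 0 <= t - s by lra.
have Aj y : tail (s - r) y -> joined (- (dir * (t - s))) y.
  move=> [k _ [ky /= ks]]; exists (Some k); split=> //.
  by move: ky ks (t_lt k); rewrite /dir/entry_end/=; case: right; rewrite !in_itv/=; lra.
have A3 := support_transport ts A2 Aj.
have E : U (dir * (t - s)) u1 = U (dir * t) f.
  by rewrite /u1 /u0 !UDD; congr (U (dir * _) _); ring.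
rewrite E in A3; apply: filterS A3 => y h Oy nW; apply: h => // -[k _ [ky /= ks]].
apply: nW; exists k.
by move: ky ks; rewrite /dir/entry_end/=; case: right; rewrite !in_itv/=; lra.
Qed.

Definition block_fun j r s : H := toL2 mu Om (fun y => (\1_(block j r s) y)%:C).

Lemma repr_block_fun j r s : {ae mu, forall y, Om y ->
  repr (block_fun j r s) y = (\1_(block j r s) y)%:C}.
Proof.
apply: toL2P.
apply: (@indicator_L2 _ _ _ _ (exit_end j - `|r| - `|s|) (exit_end j + `|r| + `|s|)).
- exact: mOm.
- exact: measurable_block.
- rewrite block_itv => y /=;
  have [[n1 n2] [n3 n4]] := ((ler_norm r, ler_norm s), (ler_norm (- r), ler_norm (- s))).
  by rewrite !normrN in n3 n4; move: y; case: right => y /=; rewrite !in_itv/=; lra.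
Qed.

Lemma indicE (A : set R) y : A y -> (\1_A y : R) = 1.
Proof. by move=> Ay; rewrite indicE mem_set. Qed.
Lemma indicN (A : set R) y : ~ A y -> (\1_A y : R) = 0.
Proof. by move=> Ay; rewrite numfun.indicE memNset. Qed.

Lemma dot_block_fun j l r s : 0 <= r -> r < s -> s <= t ->
  dot (block_fun j r s) (block_fun l r s) = ((j == l)%:R * (s - r))%:C.
Proof.
move=> r0 rs st; have FF := ae_filter_ringOfSetsType mu.
have prod : {ae mu, forall y, Om y -> repr (block_fun j r s) y * Num.conj (repr (block_fun l r s) y)
    = (if j == l then \1_(block j r s) y else 0)%:C}.
  apply: filterS2 (repr_block_fun j r s) (repr_block_fun l r s) => y h1 h2 Oy.
  rewrite h1// h2//; case: eqVneq => [<-|jl].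
    have [By|By] := pselect (block j r s y).
      by rewrite !indicE// conjC1 mulr1.
    by rewrite !indicN// mul0r.
  have [By|By] := pselect (block j r s y); last by rewrite indicN// mul0r.
  rewrite [X in _ * Num.conj X%:C]indicN ?conjC0 ?mulr0// => Bl.
  move: jl; rewrite (piece_inj (block_piece r0 st By) (block_piece r0 st Bl)).
  by rewrite eqxx.
have [m1 m2] := mul_conj_measurable mOm (block_fun j r s) (block_fun l r s).
have mi : measurable_fun Om (\1_(block j r s) : R -> R).
  by apply: measurable_indic; exact: measurable_block.
rewrite /= /dotL2 /Cintegral; congr (_ +i* _).
- transitivity (\int[mu]_(y in Om) (if j == l then \1_(block j r s) y else 0)).
    apply: ae_Rintegral; [exact: mOm|exact: m1|by case: (j == l)|].
    by apply: filterS prod => y h /h ->.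
  case: eqP => jl; last by rewrite mul0r /Rintegral integral0.
  have E : mu (block j r s) = (s - r)%:E.
    rewrite block_itv; case: right; rewrite lebesgue_measure_itv/= lte_fin;
      (case: ltP => lt0; last by exfalso; lra);
      by rewrite -!EFinD; congr EFin; ring.
  rewrite mul1r; transitivity (fine (mu (block j r s))); last by rewrite E.
  rewrite /Rintegral integral_indic//; last exact: measurable_block.
  by rewrite setIidl//; move=> y /(block_piece r0 st) jy; exists j.
- transitivity (\int[mu]_(y in Om) (0 : R)); last by rewrite /Rintegral integral0.
  apply: ae_Rintegral; [exact: mOm|exact: m2|by []|].
  by apply: filterS prod => y h /h ->.
Qed.

(** The image of the whole block of length [t].  Near the entries this function carries the values of
    the images of all smaller blocks ([localize]). *)
Definition profile j : H := U (dir * t) (block_fun j 0 t).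

Lemma entry_piece k y : 0 < dir * (entry_end k - y) <= t -> piece (Some k) y.
Proof.
by have := t_lt k; rewrite /dir /entry_end /=; case: right; rewrite in_itv/=; lra.
Qed.

Lemma window_disjoint r s r' s' y : 0 <= r -> s <= r' -> s' <= t ->
  window r s y -> window r' s' y -> False.
Proof.
move=> r0 sr st [k /andP[k1 k2]] [l /andP[l1 l2]].
have ck : piece (Some k) y by apply: entry_piece; lra.
have cl : piece (Some l) y by apply: entry_piece; lra.
by have [kl] := piece_inj ck cl; move: l1 l2; rewrite -kl; lra.
Qed.

(** Cut the block of length [t] at the distances [r] and [s].  The images of the three parts add up to
    [profile j] and are supported in disjoint windows. *)
Lemma localize j r s : 0 < r -> r < s -> s < t ->
  {ae mu, forall y, Om y -> repr (U (dir * t) (block_fun j r s)) y =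
     if y \in window r s then repr (profile j) y else 0}.
Proof.
move=> r0 rs st; have FF := ae_filter_ringOfSetsType mu.
have E : block_fun j 0 t = 1 *: block_fun j 0 r + (1 *: block_fun j r s + block_fun j s t).
  have bs x y : dir * (y - (exit_end j + dir * x)) = dir * (y - exit_end j) - x.
    by rewrite /dir; case: right; ring.
  have tt y x : dir * (y - exit_end j) = x -> y = exit_end j + dir * x.
    by rewrite /dir; case: right; lra.
  apply: L2_ext.
  have L1 := repr_linear 1 (block_fun j 0 r) (1 *: block_fun j r s + block_fun j s t).
  have L2 := repr_linear 1 (block_fun j r s) (block_fun j s t).
  have LL := ae_and L1 L2.
  have N := ae_and (ae_neq_point (exit_end j + dir * r)) (ae_neq_point (exit_end j + dir * s)).
  have B1 := ae_and (repr_block_fun j 0 t) (repr_block_fun j 0 r).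
  have B2 := ae_and (repr_block_fun j r s) (repr_block_fun j s t).
  have NB := ae_and N LL.
  apply: filterS3 NB B1 B2 => y [[/eqP n1 /eqP n2] [l1 l2]] [b1 b2] [b3 b4] Oy.
  rewrite l1// l2// !mul1r b1// b2// b3// b4//.
  have {}n1 : dir * (y - exit_end j) != r by apply/eqP => /tt.
  have {}n2 : dir * (y - exit_end j) != s by apply/eqP => /tt.
  rewrite -!rmorphD/=; congr (_%:C); rewrite !numfun.indicE.
  have bE r' s' : (y \in block j r' s') = (r' < dir * (y - exit_end j) < s').
    by apply/idP/idP => [/set_mem//|?]; exact: mem_set.
  rewrite !bE; move: (dir * _) n1 n2 => z n1 n2.
  have F (p q : R) : q <= p -> (p < q) = false by move=> ?; apply/negbTE; rewrite -leNgt.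
  have [z0|z0] := leP z 0; first by rewrite (F r z) ?(F s z) ?addr0//; lra.
  have [zr|rz|zr] := ltgtP z r; last by rewrite zr eqxx in n1.
    by rewrite (_ : z < t = true) ?(F s z) ?addr0//; lra.
  have [zs|sz|zs] := ltgtP z s; last by rewrite zs eqxx in n2.
    by rewrite (_ : z < t = true) ?addr0 ?add0r//; lra.
  by rewrite /= !add0r.
have bf r' s' : {ae mu, forall y, Om y -> ~ block j r' s' y -> repr (block_fun j r' s') y = 0}.
  by apply: filterS (repr_block_fun j r' s') => y h Oy nB; rewrite h// indicN.
have T r' s' := transport_block (j := j) (r := r') (s := s') (f := block_fun j r' s').
have T1 := T 0 r (lexx 0) r0 (ltW (lt_trans rs st)) (bf 0 r).
have T2 := T r s (ltW r0) rs (ltW st) (bf r s).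
have T3 := T s t (ltW (lt_trans r0 rs)) st (lexx t) (bf s t).
rewrite /profile E !Ulin.
have L1 := repr_linear 1 (U (dir * t) (block_fun j 0 r))
  (1 *: U (dir * t) (block_fun j r s) + U (dir * t) (block_fun j s t)).
have L2 := repr_linear 1 (U (dir * t) (block_fun j r s)) (U (dir * t) (block_fun j s t)).
apply: filterS3 (ae_and L1 L2) (ae_and T1 T2) T3 => y [l1 l2] [t1 t2] t3 Oy.
case: ifPn => [/set_mem W|W]; last by rewrite t2// => Wy; move: W; rewrite mem_set.
rewrite l1// l2// t1 ?t3 ?mulr0 ?add0r ?addr0 ?mul1r// => W'.
- by apply: window_disjoint W W'; lra.
- by apply: window_disjoint W' W; lra.
Qed.
Lemma mul_conj_integrable (u v : H) :
  mu.-integrable Om (EFin \o (fun y => Re (repr u y * Num.conj (repr v y)))) /\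
  mu.-integrable Om (EFin \o (fun y => Im (repr u y * Num.conj (repr v y)))).
Proof.
have [u1 u2] := repr_realL2 u; have [v1 v2] := repr_realL2 v; split.
- have := integrable_comb 1 1 mOm (realL2_mul mOm u1 v1) (realL2_mul mOm u2 v2).
  apply: eq_integrable; first exact: mOm.
  by move=> y _ /=; congr EFin; case: (repr u y) (repr v y) => [p q] [r s] /=; ring.
- have := integrable_comb 1 (-1) mOm (realL2_mul mOm u2 v1) (realL2_mul mOm u1 v2).
  apply: eq_integrable; first exact: mOm.
  by move=> y _ /=; congr EFin; case: (repr u y) (repr v y) => [p q] [r s] /=; ring.
Qed.

Lemma sum_option (F : option 'I_m -> R) :
  \sum_j F j = F None + \sum_k F (Some k).
Proof.
rewrite (bigD1 None)//=; congr (_ + _).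
rewrite (reindex_omap Some id)/=; last by case.
by apply: eq_bigl => k; rewrite eqxx.
Qed.

(* The place near the entry [k] at which mass from distance [x] to the exits is found at time [t]. *)
Local Notation point x k := (entry_end k - dir * (t - x)).

Lemma point_ball x e k y : ball (point x k) e y ->
  t - (x + e) < dir * (entry_end k - y) < t - (x - e).
Proof.
rewrite /ball/= ltr_norml /dir; case: right; lra.
Qed.

Lemma ball_window x e k y : ball (point x k) e y -> window (x - e) (x + e) y.
Proof. by move=> /point_ball H1; exists k; lra. Qed.

Lemma window_ball x e k y : 0 < e -> e < x -> x + e < t -> piece (Some k) y ->
  window (x - e) (x + e) y -> y != entry_end k - dir * (t - (x - e)) -> ball (point x k) e y.
Proof.
move=> e0 ex xt ky [l /andP[l1 l2]] ne.
have ly : piece (Some l) y by apply: entry_piece; lra.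
have [lk] := piece_inj ky ly; subst l.
have {}ne : dir * (entry_end k - y) != t - (x - e).
  by apply: contra ne => /eqP E; apply/eqP; move: E; rewrite /dir; case: right; lra.
have {ne}l3 : dir * (entry_end k - y) < t - (x - e) by rewrite lt_neqAle ne.
by move: l1 l3; rewrite /ball/= ltr_norml /dir; case: right; lra.
Qed.

(** [h] will be the real or the imaginary part. *)
Lemma window_integral (h : C -> R) j l x e : h 0 = 0 ->
  (forall u v : H, mu.-integrable Om (EFin \o (fun y => h (repr u y * Num.conj (repr v y))))) ->
  0 < e -> e < x -> x + e < t ->
  \int[mu]_(y in Om) h (repr (U (dir * t) (block_fun j (x - e) (x + e))) y *
      Num.conj (repr (U (dir * t) (block_fun l (x - e) (x + e))) y)) =
  \sum_k \int[mu]_(y in ball (point x k) e)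
     ((fun y => h (repr (profile j) y * Num.conj (repr (profile l) y))) \_ Om) y.
Proof.
move=> h0 hi e0 ex xt; have FF := ae_filter_ringOfSetsType mu.
have [xe0 xex] : 0 < x - e /\ x - e < x + e by split; lra.
set A := U _ _; set B := U _ _.
have mh (u v : H) : measurable_fun Om (fun y => h (repr u y * Num.conj (repr v y))).
  by have /measurable_int/measurable_EFinP := hi u v.
have mhc (u v : H) i : measurable_fun (piece i) (fun y => h (repr u y * Num.conj (repr v y))).
  by apply: measurable_funS (mh u v); [exact: mOm|exact: piece_sub_Om].
have loc := ae_and (localize j xe0 xex xt) (localize l xe0 xex xt).
rewrite -/A -/B in loc.
rewrite (Rintegral_Om tpiece (hi A B)) sum_option.
have wk k y : ball (point x k) e y -> piece (Some k) y.
  by move=> /point_ball H1; apply: entry_piece; lra.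
rewrite (_ : \int[mu]_(y in piece None) _ = 0) ?add0r; last first.
  transitivity (\int[mu]_(y in piece None) (0 : R)); last by rewrite /Rintegral integral0.
  apply: ae_Rintegral; [exact: mpiece|exact: mhc|by []|].
  apply: filterS loc => y [l1 l2] cy.
  have Oy : Om y by exists None.
  rewrite l1// memNset ?mul0r// => -[k /andP[k1 k2]].
  have ky : piece (Some k) y by apply: entry_piece; lra.
  by have := piece_inj cy ky.
apply: eq_bigr => k _.
set phi := fun y => h (repr (profile j) y * _).
transitivity (\int[mu]_(y in piece (Some k)) ((phi \_ (ball (point x k) e)) y)).
  apply: ae_Rintegral; [exact: mpiece|exact: mhc| |].
    apply: measurable_funTS; apply/(measurable_restrictT _ _).1; first exact: measurable_ball.
    by apply: measurable_funS (mhc (profile j) (profile l) (Some k)); [exact: mpiece|exact: wk].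
  apply: filterS2 loc (ae_neq_point (entry_end k - dir * (t - (x - e)))) => y [l1 l2] ne cy.
  have Oy : Om y by exists (Some k).
  rewrite l1// l2// patchE; have [yb|yb] := pselect (ball (point x k) e y).
    by rewrite !mem_set//; exact: ball_window yb.
  rewrite [in RHS]memNset// memNset ?mul0r// => W; apply: yb.
  exact: window_ball W ne.
transitivity (\int[mu]_(y in ball (point x k) e) ((phi \_ (ball (point x k) e)) y)).
  congr fine; apply: (@integral_support _ (piece (Some k)) (ball (point x k) e)) => [y|y _ yb].
    exact: wk.
  by rewrite patchE memNset.
apply: eq_Rintegral => y yb; rewrite !patchE yb mem_set//.
by exists (Some k) => //; apply: wk; exact: set_mem.
Qed.

(** Divide the integrals over the windows of width [2 e] by [2 e] and let [e] tend to 0. *)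
Lemma profile_sum (h : C -> R) j l (val : R) x : h 0 = 0 ->
  (forall u v : H, mu.-integrable Om (EFin \o (fun y => h (repr u y * Num.conj (repr v y))))) ->
  (forall e, 0 < e -> e < x -> x + e < t ->
    \int[mu]_(y in Om) h (repr (U (dir * t) (block_fun j (x - e) (x + e))) y *
      Num.conj (repr (U (dir * t) (block_fun l (x - e) (x + e))) y)) = 2 * e * val) ->
  0 < x -> x < t ->
  (forall k, lebesgue_pt
     ((fun y => h (repr (profile j) y * Num.conj (repr (profile l) y))) \_ Om) (point x k)) ->
  \sum_k h (repr (profile j) (point x k) * Num.conj (repr (profile l) (point x k))) = val.
Proof.
move=> h0 hi valE x0 xt L.
pose phi y := h (repr (profile j) y * Num.conj (repr (profile l) y)).
pose Phi := phi \_ Om; have {}L : forall k, lebesgue_pt Phi (point x k) := L.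
have Phii : mu.-integrable setT (EFin \o Phi).
  have := hi (profile j) (profile l); rewrite integrable_mkcond; last exact: mOm.
  by rewrite restrict_EFin.
have PhiE k : Phi (point x k) = phi (point x k).
  rewrite /Phi patchE mem_set//; exists (Some k) => //; apply: entry_piece.
  by rewrite /dir; case: right; lra.
under eq_bigr => k _ do rewrite -/(phi _) -PhiE.
apply/eqP; rewrite -subr_eq0 -normr_le0; apply/ler_addgt0Pl => n n0; rewrite addr0.
have n1 : 0 < n / m.+1%:R by rewrite divr_gt0.
have ex k := cid2 (lebesgue_pt_average Phii (L k) n1).
pose d k := s2val (ex k).
have d0 k : 0 < d k := s2valP (ex k).
have [e1 e10 e1d] := common_lower_bound d0.
pose e := Num.min (Num.min (x / 2) ((t - x) / 2)) e1.
have e0 : 0 < e by rewrite !lt_min !divr_gt0 ?subr_gt0.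
have ed k : e < d k by apply: le_lt_trans (e1d k); rewrite ge_min lexx orbT.
have exx : e < x by apply: le_lt_trans (_ : e <= x / 2) _; [rewrite !ge_min lexx|lra].
have ext : x + e < t.
  have : e <= (t - x) / 2 by rewrite !ge_min lexx orbT.
  lra.
have := valE e e0 exx ext; rewrite (window_integral j l h0 hi e0 exx ext) => E.
have : `|\sum_k (\int[mu]_(y in ball (point x k) e) Phi y - 2 * e * Phi (point x k))| <= n * e.
  apply: le_trans (ler_norm_sum _ _ _) _.
  apply: (@le_trans _ _ (\sum_(k < m) (n / m.+1%:R * e))).
    by apply: ler_sum => k _; apply: (s2valP' (ex k)); rewrite e0 ed.
  rewrite sumr_const card_ord -[leLHS]mulr_natl mulrA ler_wpM2r ?(ltW e0)//.
  rewrite mulrCA ler_piMr ?(ltW n0)// ler_pdivrMr// mul1r ler_nat; exact: leqnSn.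
rewrite sumrB E -mulr_sumr -mulrBr normrM (gtr0_norm (_ : 0 < 2 * e)) ?mulr_gt0//.
rewrite distrC; set X := `|_| => HX.
have : 2 * X <= n by rewrite -(ler_pM2r e0) mulrAC.
have X0 : 0 <= X by exact: normr_ge0. lra.
Qed.

(** Choose [x] such that all the points [point x k] are Lebesgue points of the products of two profiles.
    By [dot_block_fun] and the isometry of [U], the values of the profiles at these points are the rows of
    an orthonormal family that has more rows than columns. *)
Lemma no_translation_group : False.
Proof.
have FF := ae_filter_ringOfSetsType mu.
have leb (h : C -> R) j l :
  (forall u v : H, mu.-integrable Om (EFin \o (fun y => h (repr u y * Num.conj (repr v y))))) ->
  {ae mu, forall z, forall k, lebesgue_pt
     ((fun y => h (repr (profile j) y * Num.conj (repr (profile l) y))) \_ Om)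
     (z + (entry_end k - dir * t))}.
  move=> hi; apply: filter_forall => k; apply: ae_shift.
  by apply: lebesgue_differentiation; apply: integrable_locally_restrict; [exact: mOm|exact: hi].
have iRe u v := (mul_conj_integrable u v).1; have iIm u v := (mul_conj_integrable u v).2.
have aeall : {ae mu, forall z, forall jl : option 'I_m * option 'I_m,
  (forall k, lebesgue_pt
     ((fun y => Re (repr (profile jl.1) y * Num.conj (repr (profile jl.2) y))) \_ Om)
     (z + (entry_end k - dir * t))) /\
  (forall k, lebesgue_pt
     ((fun y => Im (repr (profile jl.1) y * Num.conj (repr (profile jl.2) y))) \_ Om)
     (z + (entry_end k - dir * t)))}.
  by apply: filter_forall => -[j l]; apply: ae_and; exact: leb.
have [x [x0 xt Lx]] : exists x, [/\ 0 < x, x < t & forall jl : option 'I_m * option 'I_m,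
  (forall k, lebesgue_pt
     ((fun y => Re (repr (profile jl.1) y * Num.conj (repr (profile jl.2) y))) \_ Om) (point x k)) /\
  (forall k, lebesgue_pt
     ((fun y => Im (repr (profile jl.1) y * Num.conj (repr (profile jl.2) y))) \_ Om) (point x k))].
  (* [x] is found through [z = dir * x], because then the points [point x k] are translates of [z]. *)
  pose lo : R := if right then 0 else - t.
  have lot : lo < lo + t by rewrite ltrDl.
  have [z /andP[z1 z2] Hz] := ae_exists_itv lot aeall.
  exists (dir * z).
  have pE k : point (dir * z) k = z + (entry_end k - dir * t).
    by rewrite /dir; case: right; ring.
  split; [by move: z1 z2; rewrite /lo /dir; case: right; lra
    |by move: z1 z2; rewrite /lo /dir; case: right; lra|].
  by move=> jl; split=> k; rewrite pE; have [] := Hz jl.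
have dotE j l e : 0 < e -> e < x -> x + e < t ->
    dot (U (dir * t) (block_fun j (x - e) (x + e))) (U (dir * t) (block_fun l (x - e) (x + e))) =
    (2 * e * (j == l)%:R)%:C.
  move=> e0 ex xt'; rewrite Uiso dot_block_fun; [|lra|lra|lra].
  by congr (_%:C); ring.
pose G : 'M[C]_(#|option 'I_m : finType|, m) := \matrix_(i, k) repr (profile (enum_val i)) (point x k).
apply: (@no_orthonormal_rows R _ _ G); first by rewrite card_option card_ord.
move=> i i'; set j := enum_val i; set l := enum_val i'.
have [LR LI] := Lx (j, l).
have GE : \sum_k G i k * Num.conj (G i' k) =
    \sum_k repr (profile j) (point x k) * Num.conj (repr (profile l) (point x k)).
  by apply: eq_bigr => k _; rewrite !mxE.
have ijl : (i == i') = (j == l) by rewrite (inj_eq enum_val_inj).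
rewrite GE ijl; apply/eqP; rewrite eq_complex Re_sum Im_sum.
rewrite (@profile_sum Re j l (j == l)%:R x)//; last first.
  by move=> e e0 ex xt'; have := congr1 Re (dotE j l e e0 ex xt').
rewrite (@profile_sum Im j l 0 x)//; last first.
  by move=> e e0 ex xt'; have := congr1 Im (dotE j l e e0 ex xt'); rewrite mulr0.
by case: (j == l); rewrite /= !eqxx.
Qed.
End translation_group.

(** * From open intervals to the normal form *)

Section intervals.
Context {R : realType}.
Implicit Type I : set R.

Lemma bounded_set_bounds I : bounded_set I <-> has_lbound I /\ has_ubound I.
Proof.
split=> [[M [_ HM]]|[[l Hl] [u Hu]]].
  have {}HM x : I x -> - (M + 1) <= x <= M + 1.
    by move=> Ix; rewrite -ler_norml; apply: HM Ix; rewrite ltrDl.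
  by split; [exists (- (M + 1))|exists (M + 1)] => x /HM /andP[].
exists (`|l| + `|u|); split; first exact: num_real.
move=> M HM x Ix /=; have lx := Hl _ Ix; have xu := Hu _ Ix.
have [[l1 l2] [u1 u2]] := ((ler_norm l, ler_norm (- l)), (ler_norm u, ler_norm (- u))).
have [l0 u0] : 0 <= `|l| /\ 0 <= `|u| by [].
by rewrite !normrN in l2 u2; rewrite ler_norml; lra.
Qed.

Lemma bounded_open_interval I : open I -> is_interval I -> I !=set0 ->
  bounded_set I -> exists p : R * R, p.1 < p.2 /\ I = `]p.1, p.2[%classic.
Proof.
move=> oI iI [x Ix] /bounded_set_bounds[lI uI].
have E : I = `]inf I, sup I[%classic.
  by rewrite -[LHS](interior_id _).1// interval_bounded_interior// set_itvoo.
exists (inf I, sup I); split=> //=.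
by move: Ix; rewrite {1}E /= in_itv/= => /andP[]; exact: lt_trans.
Qed.

(** An unbounded interval has no lower or no upper bound, and it lacks both only if it is the line. *)
Lemma unbounded_open_interval I : open I -> is_interval I -> I <> setT ->
  ~ bounded_set I -> exists c right, I = if right then `]c, +oo[%classic else `]-oo, c[%classic.
Proof.
move=> oI iI IT /bounded_set_bounds nb.
have EI : I° = I by apply/interior_id.
have [lI|lI] := pselect (has_lbound I); have [uI|uI] := pselect (has_ubound I).
- by case: nb.
- by exists (inf I), true; rewrite -[LHS]EI interval_right_unbounded_interior// set_itvoy.
- by exists (sup I), false; rewrite -[LHS]EI interval_left_unbounded_interior// set_itvNyo.
- by case: IT; exact: interval_unbounded_setT.
Qed.

(** The unbounded interval becomes the half-line, and the nonempty ones among the others are numbered. *)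
Lemma normal_form_exists n (J : 'I_n -> set R) : (forall i, open (J i)) ->
  (forall i, is_interval (J i)) -> trivIset setT J ->
  (exists! i, ~ bounded_set (J i)) -> \bigcup_i J i <> setT ->
  exists m (a b : 'I_m -> R) c right, [/\ forall k, a k < b k,
    trivIset setT (piece a b c right) & \bigcup_i J i = Om a b c right].
Proof.
move=> oJ iJ tJ [i0 [Ji0 uniq0]] JT.
pose S := [pred i | (i != i0) && `[< J i !=set0 >]].
pose m := #|S|.
(* [idx] is an injection, so that disjointness carries over. *)
pose idx (j : option 'I_m) := if j is Some k then enum_val k else i0.
have idxS k : idx (Some k) != i0 /\ J (idx (Some k)) !=set0.
  by have := enum_valP k; rewrite inE => /andP[? /asboolP].
have bi k : exists p : R * R, p.1 < p.2 /\ J (idx (Some k)) = `]p.1, p.2[%classic.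
  have [/eqP ki0 Jk] := idxS k; apply: bounded_open_interval => //.
  by apply: contrapT => /uniq0 E; apply: ki0.
have [p Hp] := choice bi.
have JT0 : J i0 <> setT.
  by move=> E; apply: JT; apply/seteqP; split=> // x _; exists i0 => //; rewrite E.
have [c [right Jc]] := unbounded_open_interval (oJ i0) (iJ i0) JT0 Ji0.
have JE j : piece (fun k => (p k).1) (fun k => (p k).2) c right j = J (idx j).
  by case: j => [k|] /=; [rewrite (Hp k).2|rewrite Jc].
exists m, (fun k => (p k).1), (fun k => (p k).2), c, right; split.
- by move=> k; have [] := Hp k.
- move=> j j' _ _; rewrite !JE => /(tJ _ _ I I).
  case: j j' => [k|] [k'|] //=; first by move=> /enum_val_inj ->.
    by move=> E; have [/eqP] := idxS k.
  by move=> E; have [/eqP] := idxS k'; rewrite /= -E.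
- apply/seteqP; split=> x [i _]; last by rewrite JE => Jx; exists (idx i).
  move=> Jx; have [ii0|ii0] := eqVneq i i0.
    by exists None => //; rewrite JE /= -ii0.
  have iS : i \in S by rewrite inE ii0/=; apply/asboolP; exists x.
  by exists (Some (enum_rank_in iS i)) => //; rewrite JE /= enum_rankK_in.
Qed.
End intervals.

Theorem corollary4p6 (R : realType) (n : nat) (J : 'I_n -> set R)
    (Omega : set R)
    (J_open : forall i, open (J i))
    (J_itv : forall i, is_interval (J i))
    (J_disj : trivIset setT J)
    (J_unbounded : exists! i, ~ bounded_set (J i))
    (Omega_def : Omega = \bigcup_i J i)
    (Omega_neqT : Omega <> setT) :
  ~ (exists A : linop (L2R Omega),
       self_adjoint (dotL2R Omega) A /\ extends_D A) /\
  ~ (exists U : R -> L2R Omega -> L2R Omega,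
       unitary_group (dotL2R Omega) U /\ integrability_property U).
Proof.
subst Omega.
have [m [a [b [c [right [ab tpiece ->]]]]]] :=
  normal_form_exists J_open J_itv J_disj J_unbounded Omega_neqT.
split; first exact: no_self_adjoint_extension.
move=> [U [[Uu U0 UD _] Uint]].
have [t t0 t_lt] : exists2 t, 0 < t & forall k, t < b k - a k.
  by apply: common_lower_bound => k; rewrite subr_gt0.
apply: (no_translation_group tpiece U0 UD Uint _ _ t0 t_lt) => v.
  by move=> f g; have [_ iso _] := Uu v; exact: iso.
by have [] := Uu v.
Qed.
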